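(* Let $(M,g)$ be a two-dimensional Riemannian manifold of constant Gaussian curvature and let $\{g^{(t)}\}$ be an infinitesimally cogeodesical deformation of $(M,g)$. Let $K^{(t)}$ denote the Gaussian curvature of $(M,g^{(t)})$. Then the variation of the Gaussian curvature $$\delta K=\left.\frac{\partial}{\partial t}\right|_{t=0}K^{(t)}$$ is a constant function on $M$.
   Context: All manifolds are assumed to be connected (and smooth). Consider a (smooth) one-parameter family of Riemannian metrics $g^{(t)}=g+t\,\delta g+\mathscr{O}(t^2)$, $t\in\,]-\varepsilon,\varepsilon[$, on a manifold $M$, with $g^{(0)}=g$; an upper index $(t)$ indicates that a Riemannian invariant is taken with respect to $g^{(t)}$. For $p\in M$ and $v_p\in \mathrm{T}_pM$, let $\phi(t)$ be the distance, measured with respect to the initial metric $g$, between the point $\exp^{(t)}(v_p)$ (where $\exp^{(t)}$ is the exponential map of $g^{(t)}$) and the $g$-geodesic which starts in $p$ with velocity $v_p$. The family $\{g^{(t)}\}$ is called an infinitesimally cogeodesical deformation of $(M,g)$ if, for all $p\in M$ and all $v_p\in \mathrm{T}_pM$, $\phi(t)=0+\mathscr{O}(t^2)$. *)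

(* Defs.v *)
From HB Require Import structures.
From mathcomp Require Import all_boot all_order all_algebra.
From mathcomp Require Import all_classical all_reals all_analysis.

Set Implicit Arguments.
Unset Strict Implicit.
Unset Printing Implicit Defensive.

Import Order.TTheory GRing.Theory Num.Theory.
Import numFieldNormedType.Exports.

Local Open Scope classical_set_scope.
Local Open Scope ring_scope.

(* Used only for open U in finite-dimensional V, where f is of class C^k.+1 iff
   f is continuous and all its directional derivatives exist and are C^k. *)
Fixpoint Ck_on (R : realType) (V W : normedModType R) (k : nat)
    (U : set V) (f : V -> W) : Prop :=
  match k with
  | 0 => forall x, U x -> {for x, continuous f}
  | k'.+1 => (forall x, U x -> {for x, continuous f}) /\
             (forall v : V, (forall x, U x -> derivable f x v) /\
                            Ck_on k' U (fun x => 'D_v f x))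
  end.

Definition smooth_on (R : realType) (V W : normedModType R)
  (U : set V) (f : V -> W) : Prop := forall k, Ck_on k U f.

(* The values of [cmap] outside [cdom], and of [cinv] outside the image of
   [cdom], are irrelevant. *)
Record chart (R : realType) (n : nat) (M : topologicalType) := Chart {
  cdom : set M;
  cmap : M -> 'rV[R]_n;
  cinv : 'rV[R]_n -> M;
  cdom_open : open cdom;
  cimg_open : open (cmap @` cdom);
  cmapK : forall p, cdom p -> cinv (cmap p) = p;
  cmap_continuous : forall p, cdom p -> {for p, continuous cmap};
  cinv_continuous : forall x, (cmap @` cdom) x -> {for x, continuous cinv} }.

Definition transition (R : realType) (n : nat) (M : topologicalType)
  (c d : chart R n M) : 'rV[R]_n -> 'rV[R]_n := cmap d \o cinv c.

(* The smooth structure is given by a smooth atlas, not necessarily maximal;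
   [chart_at p] is a preferred chart around [p]. *)
Record smoothManifold (R : realType) (n : nat) := SmoothManifold {
  carrier :> topologicalType;
  chart_index : Type;
  mchart : chart_index -> chart R n carrier;
  chart_at : carrier -> chart_index;
  chart_atP : forall p, cdom (mchart (chart_at p)) p;
  transition_smooth : forall i j : chart_index,
    smooth_on (cmap (mchart i) @` (cdom (mchart i) `&` cdom (mchart j)))
              (transition (mchart i) (mchart j));
  carrier_hausdorff : hausdorff_space carrier;
  carrier_second_countable : @second_countable carrier;
  carrier_connected : connected [set: carrier] }.

Section Riemannian.
Variables (R : realType) (n : nat).
Implicit Type M : smoothManifold R n.

Definition mdom M (i : chart_index M) : set M := cdom (mchart i).
Definition mmap M (i : chart_index M) : M -> 'rV[R]_n := cmap (mchart i).
Definition mimg M (i : chart_index M) : set 'rV[R]_n := mmap i @` mdom i.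

(* [gmx i x] is the matrix of components g_ab, in the chart [i], at the point
   with coordinates [x]; it is meaningful for x in [mimg i] only.  The last
   field is the transformation law of a covariant 2-tensor. *)
Record metric M := Metric {
  gmx : chart_index M -> 'rV[R]_n -> 'M[R]_n;
  gmx_smooth : forall i, smooth_on (mimg i) (gmx i);
  gmx_sym : forall i x, mimg i x -> (gmx i x)^T = gmx i x;
  gmx_pos : forall i x (v : 'rV[R]_n), mimg i x -> v != 0 ->
    0 < (v *m gmx i x *m v^T) 0 0;
  gmx_transition : forall i j p (v w : 'rV[R]_n), mdom i p -> mdom j p ->
    let tau := transition (mchart i) (mchart j) in
    (v *m gmx i (mmap i p) *m w^T) 0 0 =
    ('D_v tau (mmap i p) *m gmx j (mmap j p) *m ('D_w tau (mmap i p))^T) 0 0 }.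

(* Only the values of [g] at times in ]-eps, eps[ matter. *)
Definition smooth_family M (eps : R) (g : R -> metric M) : Prop :=
  forall i : chart_index M,
    smooth_on [set z : R^o * 'rV[R]_n | `|z.1| < eps /\ mimg i z.2]
              (fun z => gmx (g z.1) i z.2).

Definition partial (k : 'I_n) (f : 'rV[R]_n -> R) (x : 'rV[R]_n) : R :=
  'D_(delta_mx 0 k) (f : 'rV[R]_n -> R^o) x.

(* Gamma^k_ab *)
Definition christoffel M (g : metric M) (i : chart_index M) (k a b : 'I_n)
    (x : 'rV[R]_n) : R :=
  2^-1 * \sum_(l < n) invmx (gmx g i x) k l *
    (partial a (fun y => gmx g i y l b) x +
     partial b (fun y => gmx g i y a l) x -
     partial l (fun y => gmx g i y a b) x).

(* R^l_abc, where R(d_a, d_b) d_c = sum_l R^l_abc d_l and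
   R(X, Y) = nabla_X nabla_Y - nabla_Y nabla_X - nabla_[X,Y]. *)
Definition riemann M (g : metric M) (i : chart_index M) (l a b c : 'I_n)
    (x : 'rV[R]_n) : R :=
  partial a (christoffel g i l b c) x - partial b (christoffel g i l a c) x +
  \sum_(m < n) (christoffel g i m b c x * christoffel g i l a m x -
                christoffel g i m a c x * christoffel g i l b m x).

Definition local_curve M (i : chart_index M) (gam : R -> M) : R -> 'rV[R]_n :=
  mmap i \o gam.

Definition geodesic_equation_at M (g : metric M) (i : chart_index M)
    (gam : R -> M) (s : R) : Prop :=
  let x := local_curve i gam in
  [/\ \forall u \near s, derivable x u 1,
      derivable (derive1 x) s 1 &
      forall k : 'I_n,
        derive1 (derive1 x) s 0 k + \sum_(a < n) \sum_(b < n)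
          christoffel g i k a b (x s) * derive1 x s 0 a * derive1 x s 0 b = 0].

(* The geodesic equation being covariant, it is enough to require it in one
   chart around each point of the curve. *)
Definition is_geodesic M (g : metric M) (I : set R) (gam : R -> M) : Prop :=
  forall s, I s ->
    {for s, continuous gam} /\
    exists i, mdom i (gam s) /\ geodesic_equation_at g i gam s.

(* A tangent vector at p is represented by a chart i around p together with its
   components v in that chart. *)
Definition starts_at M (gam : R -> M) (p : M) (i : chart_index M)
    (v : 'rV[R]_n) : Prop :=
  [/\ gam 0 = p, derivable (local_curve i gam) 0 1 &
      derive1 (local_curve i gam) 0 = v].

Definition interval_around_01 (I : set R) : Prop :=
  [/\ open I, is_interval I, I 0 & I 1].

(* The graph of the (partially defined) exponential map: q = exp_p(v). *)
Definition is_exp M (g : metric M) (p : M) (i : chart_index M) (v : 'rV[R]_n)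
    (q : M) : Prop :=
  exists I gam, [/\ interval_around_01 I, is_geodesic g I gam,
                    starts_at gam p i v & gam 1 = q].

Definition C1_curve M (gam : R -> M) : Prop :=
  forall s, {for s, continuous gam} /\
    forall i, mdom i (gam s) ->
      [/\ \forall u \near s, derivable (local_curve i gam) u 1 &
          {for s, continuous (derive1 (local_curve i gam))}].

Definition speed M (g : metric M) (gam : R -> M) (s : R) : R :=
  let i := chart_at (gam s) in
  let v := derive1 (local_curve i gam) s in
  Num.sqrt ((v *m gmx g i (mmap i (gam s)) *m v^T) 0 0).

Definition length M (g : metric M) (gam : R -> M) : \bar R :=
  (\int[lebesgue_measure]_(s in `[0%R, 1%R]) (speed g gam s)%:E)%E.

(* C^1 curves need not be regular, so that every piecewise C^1 curve can be
   reparametrized, with zero velocity at its ends and corners, to a C^1 curve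
   R -> M of the same length. *)
Definition dist M (g : metric M) (p q : M) : \bar R :=
  ereal_inf [set length g gam | gam in
    [set gam : R -> M | [/\ C1_curve gam, gam 0 = p & gam 1 = q]]].

Definition dist_to_set M (g : metric M) (q : M) (A : set M) : \bar R :=
  ereal_inf [set dist g q a | a in A].

(* The geodesic of [g 0] with initial velocity v is any geodesic arc
   gam : I -> M with that initial velocity, I being an open interval containing
   [0, 1]; it is not required to be maximal, since a maximal geodesic may be
   dense (already in a flat torus), all distances to it then being zero. *)
Definition infinitesimally_cogeodesical M (g : R -> metric M) : Prop :=
  forall (p : M) (i : chart_index M) (v : 'rV[R]_n) (I : set R) (gam : R -> M),
    mdom i p -> interval_around_01 I ->
    is_geodesic (g 0) I gam -> starts_at gam p i v ->
    exists C : R, \forall t \near (0 : R), forall q : M,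
      is_exp (g t) p i v q ->
      (dist_to_set (g 0%R) q (gam @` I) <= (C * t ^+ 2)%:E)%E.

End Riemannian.

(* <R(d_0, d_1) d_1, d_0> / det g, in the preferred chart around p. *)
Definition gauss_curvature (R : realType) (M : smoothManifold R 2)
    (g : metric M) (p : M) : R :=
  let i := chart_at p in
  let x := mmap i p in
  (\sum_(l < 2) gmx g i x l 0 * riemann g i l 0 1 1 x) / \det (gmx g i x).

(* Main.v *)
(** For geodesics [x_t] of [g t] and [x_0] of [g 0] with the same initial data
    [(x, v)], the difference [x_t s - x_0 s] is [- t s^2 / 2 T(v, v)] up to
    higher order terms, [T] being the variation at [t = 0] of the Levi-Civita
    connection.  Since [x_t s] stays within [O(t^2)] of the curve [x_0], the
    vector [T(v, v)] is parallel to [v] for all [v], whence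
    [T(X, Y) = psi(X) Y + psi(Y) X] for a one-form [psi].

    In a chart let [C_a] be the matrix whose entry [(b, k)] is [Gamma^k_ab].
    In dimension two the curvature matrix
    [F = d_0 C_1 - d_1 C_0 + C_1 C_0 - C_0 C_1] is equal to [K G J], [G] being
    the matrix of the metric and [J] a constant rotation.  Writing [k] for the
    constant curvature of [g 0] and [h], [kappa] for the variations of [G] and
    [K], the variation of [F = K G J] reads
    [nabla_a psi_b = - kappa G_ab - k h_ab], and the integrability condition of
    these equations is [d kappa = 0].  As [K] does not depend on the chart,
    [kappa] is locally constant on the connected manifold [M]. *)

Require Import Defs.
From mathcomp Require Import all_boot all_order all_algebra.
From mathcomp Require Import all_classical all_reals all_analysis.
From mathcomp Require Import measurable_realfun ring lra.
Import Order.TTheory GRing.Theory Num.Theory.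
Import numFieldNormedType.Exports.
Set Implicit Arguments.
Unset Strict Implicit.
Unset Printing Implicit Defensive.
Local Open Scope classical_set_scope.
Local Open Scope ring_scope.

(** * Calculus of maps of class C^k *)

(** The hypothesis gives a constant and a range of times for each geodesic arc separately, with no
    uniformity in the initial vector, and it measures the distance to the whole arc, not to the
    point reached at time 1. Hence the order of choices: fix a small [l] and the initial velocity
    [l *: v], obtain the constant, and only then shrink [t]. At time 1 the deviation is
    [l ^+ 2 * t / 2] times the variation of the acceleration, up to an error of order
    [l ^+ 2 * t * (t + l)]; after division by [l ^+ 2 * t] the errors fall below any nonzero
    component across [v]. Only endpoints satisfying [is_exp] are concerned, so the perturbed
    geodesics have to be built, on one interval for all small [t]; and the bound is on a Riemannian
    distance, which has to be compared with coordinates. The curvature half takes place on the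
    product of time and chart: the formulas of Riemannian geometry use the space directions only,
    and exchanging the variation with a space derivative is the symmetry of second derivatives. *)

Section Ck_calculus.
Variables (R : realType) (V : normedModType R).

Lemma Ck_on_eq (W : normedModType R) k (U : set V) (f g : V -> W) : open U ->
  (forall x, U x -> f x = g x) -> Ck_on k U f -> Ck_on k U g.
Proof.
move=> oU; elim: k f g => [|k IH] f g fg /=.
  move=> cf x Ux; have nfg : {near nbhs x, f =1 g}.
    by near=> y; apply: fg; near: y; exact: open_nbhs_nbhs.
  by apply: cvg_trans (near_eq_cvg nfg) _; rewrite -fg//; exact: cf.
move=> [cf df]; split.
  move=> x Ux; have nfg : {near nbhs x, f =1 g}.
    by near=> y; apply: fg; near: y; exact: open_nbhs_nbhs.
  by apply: cvg_trans (near_eq_cvg nfg) _; rewrite -fg//; exact: cf.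
move=> v; have [dfv Cf] := df v; split.
  move=> x Ux; apply: near_eq_derivable (dfv x Ux).
  by near=> y; apply: fg; near: y; exact: open_nbhs_nbhs.
apply: IH Cf => x Ux; apply: near_eq_derive.
by near=> y; apply: fg; near: y; exact: open_nbhs_nbhs.
Unshelve. all: by end_near. Qed.

Lemma Ck_on_pred (W : normedModType R) k (U : set V) (f : V -> W) :
  Ck_on k.+1 U f -> Ck_on k U f.
Proof.
elim: k f => [|k IH] f /=; first by case.
move=> [cf df]; split=> // v; have [dfv Cf] := df v; split => //.
exact: IH.
Qed.

Lemma Ck_on_cst (W : normedModType R) k (U : set V) (a : W) :
  Ck_on k U (fun=> a).
Proof.
elim: k a => [|k IH] a /=; first by move=> x _; exact: cvg_cst.
split; first by move=> x _; exact: cvg_cst.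
move=> v; split; first by move=> x _; exact: derivable_cst.
have -> : (fun x => 'D_v (fun=> a) x) = (fun=> 0 : W); last exact: IH.
by apply/funext => x; exact: derive_cst.
Qed.

Lemma Ck_on_add (W : normedModType R) k (U : set V) (f g : V -> W) : open U ->
  Ck_on k U f -> Ck_on k U g -> Ck_on k U (fun x => f x + g x).
Proof.
move=> oU; elim: k f g => [|k IH] f g /=.
  by move=> cf cg x Ux; apply: cvgD; [exact: cf|exact: cg].
move=> [cf df] [cg dg]; split.
  by move=> x Ux; apply: cvgD; [exact: cf|exact: cg].
move=> v; have [dfv Cf] := df v; have [dgv Cg] := dg v; split.
  by move=> x Ux; apply: derivableD; [exact: dfv|exact: dgv].
apply: (Ck_on_eq oU _ (IH _ _ Cf Cg)) => x Ux.
by rewrite -deriveD//; [exact: dfv|exact: dgv].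
Qed.

Lemma Ck_on_opp (W : normedModType R) k (U : set V) (f : V -> W) : open U ->
  Ck_on k U f -> Ck_on k U (fun x => - f x).
Proof.
move=> oU; elim: k f => [|k IH] f /=.
  by move=> cf x Ux; apply: cvgN; exact: cf.
move=> [cf df]; split; first by move=> x Ux; apply: cvgN; exact: cf.
move=> v; have [dfv Cf] := df v; split.
  by move=> x Ux; apply: derivableN; exact: dfv.
apply: (Ck_on_eq oU _ (IH _ Cf)) => x Ux.
by rewrite -deriveN//; exact: dfv.
Qed.

Lemma Ck_on_mul k (U : set V) (f g : V -> R) : open U ->
  Ck_on k U f -> Ck_on k U g -> Ck_on k U (fun x => f x * g x).
Proof.
move=> oU; elim: k f g => [|k IH] f g /=.
  by move=> cf cg x Ux; apply: cvgM; [exact: cf|exact: cg].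
move=> Cf1 Cg1; move: (Cf1) (Cg1) => [cf df] [cg dg]; split.
  by move=> x Ux; apply: cvgM; [exact: cf|exact: cg].
move=> v; have [dfv Cf] := df v; have [dgv Cg] := dg v; split.
  by move=> x Ux; apply: derivableM; [exact: dfv|exact: dgv].
have H := Ck_on_add oU (IH _ _ (Ck_on_pred Cf1) Cg)
                       (IH _ _ (Ck_on_pred Cg1) Cf).
apply: (Ck_on_eq oU _ H) => x Ux.
by rewrite -[LHS](deriveM (dfv x Ux) (dgv x Ux)).
Qed.

Lemma Ck_on_inv k (U : set V) (f : V -> R) : open U ->
  (forall x, U x -> f x != 0) ->
  Ck_on k U f -> Ck_on k U (fun x => (f x)^-1).
Proof.
move=> oU f0; elim: k => [|k IH].
  by move=> /= cf x Ux; apply: cvgV; [exact: f0|exact: cf].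
move=> Cf1; have IHf := IH (Ck_on_pred Cf1); move: (Cf1) => [cf df].
split.
  by move=> x Ux; apply: cvgV; [exact: f0|exact: cf].
move=> v; have [dfv Cf] := df v; split.
  by move=> x Ux; apply: derivableV; [exact: f0|exact: dfv].
have H := Ck_on_opp oU (Ck_on_mul oU (Ck_on_mul oU IHf IHf) Cf).
apply: (Ck_on_eq oU _ H) => x Ux.
rewrite (deriveV (f0 x Ux) (dfv x Ux)).
by rewrite expr2 invfM scaleNr.
Qed.

Lemma Ck_on_mxP k m n (U : set V) (M : V -> 'M[R]_(m, n)) : open U ->
  Ck_on k U M <-> forall i j, Ck_on k U (fun x => M x i j).
Proof.
move=> oU; have cP (N : V -> 'M[R]_(m, n)) x :
    {for x, continuous N} <-> forall i j, {for x, continuous (fun x => N x i j)}.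
  split=> [cN i j|cN].
      apply: (@continuous_comp _ _ _ N (fun A : 'M[R]_(m, n) => A i j)) => //.
      exact: coord_continuous.
  apply/cvgrPdist_le => e e0; near=> y.
  rewrite [leLHS]/Num.Def.normr/= mx_normrE (bigmax_le _ (ltW e0))//= => i _.
  rewrite !mxE; move: i; near: y; apply: filter_forall => /= i.
  by have /cvgrPdist_le := cN i.1 i.2; apply.
elim: k M => [|k IH] M.
  split; first by move=> cM i j x Ux; exact: (cP _ _).1 (cM x Ux) i j.
  by move=> cM x Ux; apply/cP => i j; exact: cM.
split=> [[cM dM] i j|CM].
  split; first by move=> x Ux; exact: (cP _ _).1 (cM x Ux) i j.
  move=> v; have [dMv CM] := dM v; split.
    by move=> x Ux; exact: (derivable_mxP _ _ _).1 (dMv x Ux) i j.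
  apply: Ck_on_eq ((IH _).1 CM i j) => // x Ux.
  by rewrite derive_mx ?mxE//; exact: dMv.
split; first by move=> x Ux; apply/cP => i j; have [+ _] := CM i j; exact.
move=> v; have dM x : U x -> derivable M x v.
  by move=> Ux; apply/derivable_mxP => i j; have [_ /(_ v)[+ _]] := CM i j; exact.
split=> //; apply/IH => i j; have [_ /(_ v)[_]] := CM i j.
apply: Ck_on_eq => // x Ux.
by rewrite derive_mx ?mxE//; exact: dM.
Unshelve. all: by end_near. Qed.

Lemma smooth_on_eq (W : normedModType R) (U : set V) (f g : V -> W) : open U ->
  (forall x, U x -> f x = g x) -> smooth_on U f -> smooth_on U g.
Proof. by move=> oU fg sf k; exact: Ck_on_eq (sf k). Qed.

Lemma smooth_on_cst (W : normedModType R) (U : set V) (a : W) :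
  smooth_on U (fun=> a).
Proof. by move=> k; exact: Ck_on_cst. Qed.

Lemma smooth_on_add (W : normedModType R) (U : set V) (f g : V -> W) : open U ->
  smooth_on U f -> smooth_on U g -> smooth_on U (fun x => f x + g x).
Proof. by move=> oU sf sg k; exact: Ck_on_add. Qed.

Lemma smooth_on_opp (W : normedModType R) (U : set V) (f : V -> W) : open U ->
  smooth_on U f -> smooth_on U (fun x => - f x).
Proof. by move=> oU sf k; exact: Ck_on_opp. Qed.

Lemma smooth_on_sub_fun (W : normedModType R) (U : set V) (f g : V -> W) :
  open U -> smooth_on U f -> smooth_on U g -> smooth_on U (fun x => f x - g x).
Proof. by move=> oU sf sg; apply: smooth_on_add => //; exact: smooth_on_opp. Qed.

Lemma smooth_on_mul (U : set V) (f g : V -> R) : open U ->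
  smooth_on U f -> smooth_on U g -> smooth_on U (fun x => f x * g x).
Proof. by move=> oU sf sg k; exact: Ck_on_mul. Qed.

Lemma smooth_on_inv (U : set V) (f : V -> R) : open U ->
  (forall x, U x -> f x != 0) ->
  smooth_on U f -> smooth_on U (fun x => (f x)^-1).
Proof. by move=> oU f0 sf k; exact: Ck_on_inv. Qed.

Lemma smooth_on_sum (W : normedModType R) (I : Type) (r : seq I) (P : pred I)
    (U : set V) (f : I -> V -> W) : open U ->
  (forall i, smooth_on U (f i)) ->
  smooth_on U (fun x => \sum_(i <- r | P i) f i x).
Proof.
move=> oU sf; elim: r => [|i r IH].
  by apply: smooth_on_eq (smooth_on_cst U (0 : W)) => // x _; rewrite big_nil.
have [Pi|nPi] := boolP (P i).
  apply: smooth_on_eq (smooth_on_add oU (sf i) IH) => // x _.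
  by rewrite big_cons Pi.
by apply: smooth_on_eq IH => // x _; rewrite big_cons (negbTE nPi).
Qed.

Lemma smooth_on_prod (I : Type) (r : seq I) (P : pred I)
    (U : set V) (f : I -> V -> R) : open U ->
  (forall i, smooth_on U (f i)) ->
  smooth_on U (fun x => \prod_(i <- r | P i) f i x).
Proof.
move=> oU sf; elim: r => [|i r IH].
  by apply: smooth_on_eq (smooth_on_cst U (1 : R)) => // x _; rewrite big_nil.
have [Pi|nPi] := boolP (P i).
  apply: smooth_on_eq (smooth_on_mul oU (sf i) IH) => // x _.
  by rewrite big_cons Pi.
by apply: smooth_on_eq IH => // x _; rewrite big_cons (negbTE nPi).
Qed.

Lemma smooth_on_derive (W : normedModType R) (U : set V) (f : V -> W) v :
  smooth_on U f -> smooth_on U (fun x => 'D_v f x).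
Proof. by move=> sf k; have [_ /(_ v)[]] := sf k.+1. Qed.

Lemma smooth_on_derivable (W : normedModType R) (U : set V) (f : V -> W) x v :
  smooth_on U f -> U x -> derivable f x v.
Proof. by move=> sf; have [_ /(_ v)[+ _]] := sf 1; exact. Qed.

Lemma smooth_on_continuous (W : normedModType R) (U : set V) (f : V -> W) x :
  smooth_on U f -> U x -> {for x, continuous f}.
Proof. by move=> sf; exact: (sf 0). Qed.

Lemma smooth_on_mxP m n (U : set V) (M : V -> 'M[R]_(m, n)) : open U ->
  smooth_on U M <-> forall i j, smooth_on U (fun x => M x i j).
Proof.
move=> oU; split=> [sM i j k|sM k]; first exact/(Ck_on_mxP k M oU).1.
by apply/Ck_on_mxP => // i j; exact: sM.
Qed.

Lemma smooth_on_mulmx m n p (U : set V) (M : V -> 'M[R]_(m, n))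
    (N : V -> 'M[R]_(n, p)) : open U ->
  smooth_on U M -> smooth_on U N -> smooth_on U (fun x => M x *m N x).
Proof.
move=> oU /(smooth_on_mxP _ oU) sM /(smooth_on_mxP _ oU) sN.
apply/(smooth_on_mxP _ oU) => i j.
have H : smooth_on U (fun x => \sum_k M x i k * N x k j).
  by apply: smooth_on_sum => // k; exact: smooth_on_mul.
by apply: smooth_on_eq H => // x _; rewrite mxE.
Qed.

Lemma smooth_on_det n (U : set V) (M : V -> 'M[R]_n) : open U ->
  smooth_on U M -> smooth_on U (fun x => \det (M x)).
Proof.
move=> oU /(smooth_on_mxP _ oU) sM; apply: smooth_on_sum => // s.
apply: smooth_on_mul => //; first exact: smooth_on_cst.
by apply: smooth_on_prod => // i; exact: sM.
Qed.

Lemma smooth_on_invmx n (U : set V) (M : V -> 'M[R]_n) : open U ->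
  (forall x, U x -> M x \in unitmx) ->
  smooth_on U M -> smooth_on U (fun x => invmx (M x)).
Proof.
move=> oU uM sM; have sMij := (smooth_on_mxP _ oU).1 sM.
(* Cramer's rule: cofactors divided by the determinant. *)
have H : smooth_on U (fun x => \matrix_(i, j)
    ((\det (M x))^-1 * ((-1) ^+ (j + i) * \det (row' j (col' i (M x)))))).
  apply/(smooth_on_mxP _ oU) => i j.
  have H' : smooth_on U (fun x => (\det (M x))^-1 *
      ((-1) ^+ (j + i) * \det (row' j (col' i (M x))))).
    apply: smooth_on_mul => //.
      apply: smooth_on_inv => //; last exact: smooth_on_det.
      by move=> x Ux; rewrite -unitfE -unitmxE; exact: uM.
    apply: smooth_on_mul => //; first exact: smooth_on_cst.
    apply: smooth_on_det => //; apply/(smooth_on_mxP _ oU) => a b.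
    by apply: smooth_on_eq (sMij (lift j a) (lift i b)) => // x _; rewrite !mxE.
  by apply: smooth_on_eq H' => // x _; rewrite mxE.
apply: smooth_on_eq H => // x Ux; apply/matrixP => i j.
by rewrite /invmx uM// !mxE.
Qed.

End Ck_calculus.

(** * Mean value theorems and symmetry of second derivatives *)

Section directional.
Variables (R : realType).

Lemma is_derive_line (V W : normedModType R) (f : V -> W) x v (s : R) :
  derivable f (x + s *: v) v ->
  is_derive s 1 (fun s : R => f (x + s *: v)) ('D_v f (x + s *: v)).
Proof.
have E : (fun h : R => h^-1 *: (((fun s : R => f (x + s *: v)) \o shift s) (h *: 1)
           - f (x + s *: v))) =
         (fun h : R => h^-1 *: ((f \o shift (x + s *: v)) (h *: v)
           - f (x + s *: v))).
  apply/funext => h /=; congr (_ *: (f _ - _)).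
  by rewrite [h *: 1]mulr1 scalerDl addrCA.
by move=> df; apply: DeriveDef; rewrite /derivable /derive E.
Qed.

(** [a] and [b] come in either order, since the parameter of the metrics has either sign. Confining
    [s] to a ball about [a] instead of the segment suits hypotheses stated on balls. *)
Lemma between_MVT (f df : R -> R) (a b : R) :
  (forall s, `|s - a| <= `|b - a| -> is_derive s 1 f (df s)) ->
  exists2 s, `|s - a| <= `|b - a| & f b - f a = df s * (b - a).
Proof.
move=> dfs.
have [ab|/ltW ba] := leP a b.
  have in_ab s : s \in `[a, b] -> `|s - a| <= `|b - a|.
    rewrite in_itv /= => /andP[sa sb].
    by rewrite !ger0_norm ?subr_ge0// lerD2r.
  have [||s sab E] := @MVT_segment _ f df a b ab.
  - by move=> s /subset_itv_oo_cc/in_ab; exact: dfs.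
  - by apply: derivable_within_continuous => s /in_ab/dfs; case.
  by exists s => //; exact: in_ab.
have in_ba s : s \in `[b, a] -> `|s - a| <= `|b - a|.
  rewrite in_itv /= => /andP[sb sa].
  by rewrite !ler0_norm ?subr_le0// lerN2 lerD2r.
have [||s sab E] := @MVT_segment _ f df b a ba.
- by move=> s /subset_itv_oo_cc/in_ba; exact: dfs.
- by apply: derivable_within_continuous => s /in_ba/dfs; case.
exists s; first exact: in_ba.
by rewrite -opprB E -mulrN opprB.
Qed.

Lemma between_MVT_le (f df : R -> R) (a b B : R) :
  (forall s, `|s - a| <= `|b - a| -> is_derive s 1 f (df s)) ->
  (forall s, `|s - a| <= `|b - a| -> `|df s| <= B) ->
  `|f b - f a| <= B * `|b - a|.
Proof.
move=> dfs dfB; have [s sab ->] := between_MVT dfs.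
by rewrite normrM ler_wpM2r//; exact: dfB.
Qed.

Lemma MVT_dir (V : normedModType R) (f : V -> R) x v (c : R) :
  (forall s, `|s| <= `|c| -> derivable f (x + s *: v) v) ->
  exists2 s, `|s| <= `|c| & f (x + c *: v) - f x = c * 'D_v f (x + s *: v).
Proof.
move=> df.
have [|s] := @between_MVT (fun s => f (x + s *: v))
   (fun s => 'D_v f (x + s *: v)) 0 c.
  by move=> s; rewrite !subr0 => sc; apply: is_derive_line; exact: df.
rewrite !subr0 scale0r addr0 => sc E; exists s => //.
by rewrite E mulrC.
Qed.

(** One goes from [x] to the endpoint along one frame direction at a time and applies [MVT_dir] on
    each leg. The intermediate point varies with the leg, but only derivatives along the frame are
    needed, so that this is available before differentiability. *)
Lemma MVT_frame (V : normedModType R) m (e : 'I_m -> V) (c : 'I_m -> R)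
    (f : V -> R) x (r := \sum_i `|c i| * `|e i|) :
  (forall y i, `|y - x| <= r -> derivable f y (e i)) ->
  exists2 xi : 'I_m -> V, (forall i, `|xi i - x| <= r) &
    f (x + \sum_i c i *: e i) - f x = \sum_i c i * 'D_(e i) f (xi i).
Proof.
elim: m e c @r => [|m IH] e c r df.
  by exists (fun=> x); [case|rewrite !big_ord0 addr0 subrr].
have r'r : \sum_(i < m) `|c (widen_ord (leqnSn m) i)| *
    `|e (widen_ord (leqnSn m) i)| + `|c ord_max| * `|e ord_max| = r.
  by rewrite /r big_ord_recr.
have cm_ge0 : 0 <= `|c ord_max| * `|e ord_max| by rewrite mulr_ge0.
have [y i yx|xi xix E] := IH (fun i => e (widen_ord (leqnSn m) i))
    (fun i => c (widen_ord (leqnSn m) i)).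
  by apply: df; rewrite (le_trans yx)// -r'r lerDl.
set S := \sum_(i < m) _ in E.
have S_le s : `|s| <= `|c ord_max| -> `|x + S + s *: e ord_max - x| <= r.
  move=> sc; rewrite addrAC [x + S]addrC addrK -r'r.
  rewrite (le_trans (ler_normD _ _))// lerD//.
    rewrite (le_trans (ler_norm_sum _ _ _))//.
    by apply: ler_sum => i _; rewrite normrZ.
  by rewrite normrZ ler_wpM2r.
have [|s sc Es] := @MVT_dir _ f (x + S) (e ord_max) (c ord_max).
  by move=> s sc; apply: df; exact: S_le.
exists (fun i => oapp xi (x + S + s *: e ord_max) (unlift ord_max i)).
  move=> i; case: unliftP => [j _|_] /=; last exact: S_le.
  by rewrite (le_trans (xix j))// -r'r lerDl.
rewrite !big_ord_recr /= unlift_none /= addrA -Es.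
rewrite (eq_bigr (fun i => c (widen_ord (leqnSn m) i) *
    'D_(e (widen_ord (leqnSn m) i)) f (xi i))); last first.
  move=> i _; rewrite (_ : widen_ord _ i = lift ord_max i) ?liftK//.
  by apply/val_inj/esym; exact: lift_max.
by rewrite -E [RHS]addrC subrKA.
Qed.

(* Both sides are limits of the second difference quotient of [f] over the
   parallelogram with sides [h *: u] and [h *: v]. *)
Lemma derive_commute (V : normedModType R) (U : set V) (f : V -> R) u v x :
  open U -> smooth_on U f -> U x ->
  'D_u (fun y => 'D_v f y) x = 'D_v (fun y => 'D_u f y) x.
Proof.
move=> oU sf Ux.
have swap (a b c d : R) : a - b - (c - d) = a - c - (b - d) by ring.
have close (a a' b b' e : R) :
    a' = b' -> `|a - a'| <= e / 2 -> `|b - b'| <= e / 2 -> `|a - b| <= e.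
  move=> -> ab bb; rewrite -(subrKA b') (splitr e) (le_trans (ler_normD _ _))//.
  by rewrite lerD// distrC.
suff H e : 0 < e ->
    `|'D_u (fun y => 'D_v f y) x - 'D_v (fun y => 'D_u f y) x| <= e.
  by apply/eqP; rewrite -subr_eq0 -normr_le0; apply/ler_addgt0Pl => e /H; rewrite addr0.
move=> e0; have e20 : 0 < e / 2 by rewrite divr_gt0.
have cont a b : \forall y \near x,
    U y /\ `|'D_a ('D_b f) x - 'D_a ('D_b f) y| <= e / 2.
  near=> y; split; first by near: y; exact: open_nbhs_nbhs.
  near: y; have : {for x, continuous (fun y => 'D_a (fun y => 'D_b f y) y)}.
    apply: smooth_on_continuous Ux; apply: smooth_on_derive.
    exact: smooth_on_derive.
  by move/cvgrPdist_le => /(_ _ e20).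
have /nbhs_ballP[r /= r0 rP] : \forall y \near x,
    (U y /\ `|'D_u ('D_v f) x - 'D_u ('D_v f) y| <= e / 2) /\
    (U y /\ `|'D_v ('D_u f) x - 'D_v ('D_u f) y| <= e / 2).
  by apply: filterI; exact: cont.
(* Small enough for the parallelogram to lie in the ball of radius [r]; the 1 keeps the denominator
   positive when [u] and [v] vanish. *)
pose h := r / (2 * (`|u| + `|v| + 1)).
have uv1 : 0 < `|u| + `|v| + 1 by rewrite ltr_wpDl// addr_ge0.
have h0 : 0 < h by rewrite divr_gt0// mulr_gt0.
have hr : h * (`|u| + `|v|) < r.
  have := r0; rewrite {2}(_ : r = h * (2 * (`|u| + `|v| + 1))) => [_|].
    rewrite ltr_pM2l//; have := addr_ge0 (normr_ge0 u) (normr_ge0 v); lra.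
  by rewrite /h divfK// mulf_neq0// gt_eqF.
have inb (s s' : R) : `|s| <= `|h| -> `|s'| <= `|h| -> ball x r (x + s *: u + s' *: v).
  rewrite (gtr0_norm h0) => sh s'h; rewrite -ball_normE /ball_ /=.
  rewrite opprD addrA opprD addrA subrr sub0r -opprD normrN.
  apply: le_lt_trans hr; rewrite (le_trans (ler_normD _ _))// !normrZ mulrDr.
  by rewrite lerD// ler_wpM2r.
have mixed a b : (forall s s' : R, `|s| <= `|h| -> `|s'| <= `|h| ->
      ball x r (x + s *: a + s' *: b)) ->
    exists2 y, ball x r y & f (x + h *: a + h *: b) - f (x + h *: b)
      - (f (x + h *: a) - f x) = h * (h * 'D_b ('D_a f) y).
  move=> inab; have inU y : ball x r y -> U y by move=> /rP[[]].
  have hh : `|h| <= `|h| by [].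
  have h_0 : `|0 : R| <= `|h| by rewrite normr0.
  have inab0 (s : R) : `|s| <= `|h| -> ball x r (x + s *: a).
    by move=> sh; rewrite -[x + _]addr0 -(scale0r b); exact: inab.
  have dg (s : R) : `|s - 0| <= `|h - 0| -> is_derive s 1
      (fun s : R => f (x + h *: b + s *: a) - f (x + s *: a))
      ('D_a f (x + h *: b + s *: a) - 'D_a f (x + s *: a)).
    rewrite !subr0 => sh; apply: is_deriveB; apply: is_derive_line.
      apply: (smooth_on_derivable sf); apply: inU.
      by rewrite -addrA [h *: b + _]addrC addrA; exact: inab.
    by apply: (smooth_on_derivable sf); apply: inU; exact: inab0.
  have [s sh E1] := between_MVT dg; rewrite !subr0 in sh.
  have [|s' s'h E2] := @MVT_dir _ (fun y => 'D_a f y) (x + s *: a) b h.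
    move=> s' s'h; apply: (smooth_on_derivable (smooth_on_derive a sf)).
    by apply: inU; exact: inab.
  exists (x + s *: a + s' *: b); first exact: inab.
  move: E1; rewrite !subr0 !scale0r !addr0.
  rewrite -(addrA x (h *: b)) [h *: b + _]addrC addrA => E1.
  rewrite swap E1 mulrC; congr (_ * _); rewrite -E2.
  by rewrite -addrA [h *: b + _]addrC addrA.
have [y1 y1x E1] := mixed u v inb.
have [y2 y2x E2] : exists2 y, ball x r y & f (x + h *: v + h *: u) -
    f (x + h *: u) - (f (x + h *: v) - f x) = h * (h * 'D_u ('D_v f) y).
  apply: mixed => s s' sh s'h.
  by rewrite -addrA [s *: v + _]addrC addrA; exact: inb.
have E : 'D_u ('D_v f) y2 = 'D_v ('D_u f) y1.
  apply: (mulfI (lt0r_neq0 h0)); apply: (mulfI (lt0r_neq0 h0)).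
  by rewrite -[LHS]E2 -[RHS]E1 (addrAC x (h *: v)); exact: swap.
have /rP[_ [_ H1]] := y1x; have /rP[[_ H2] _] := y2x.
exact: close E H2 H1.
Unshelve. all: by end_near. Qed.

(** Partial derivatives on a product are directional derivatives along vectors with a zero
    component: this links derivatives in the chart at a fixed time, or in time at a fixed point, to
    those on spacetime. *)
Lemma slice_derivable (V1 V2 W : normedModType R) (f : V1 * V2 -> W) t x v :
  derivable (fun y => f (t, y)) x v <-> derivable f (t, x) (0, v).
Proof.
rewrite /derivable; set F := (X in cvg (X @ _)).
set F' := (X in _ <-> cvg (X @ _)).
suff -> : F = F' by [].
apply/funext => h; rewrite /F /F' /=; congr (_ *: (f _ - _)).
by congr pair; rewrite -[(h *: _).1]/(h *: (0 : V1)) scaler0 add0r.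
Qed.

Lemma slice_derive (V1 V2 W : normedModType R) (f : V1 * V2 -> W) t x v :
  'D_v (fun y => f (t, y)) x = 'D_(0, v) f (t, x).
Proof.
rewrite /derive; set F := (X in lim (X @ _)).
set F' := (X in _ = lim (X @ _)).
suff -> : F = F' by [].
apply/funext => h; rewrite /F /F' /=; congr (_ *: (f _ - _)).
by congr pair; rewrite -[(h *: _).1]/(h *: (0 : V1)) scaler0 add0r.
Qed.

Lemma slice_derivable1 (V1 V2 W : normedModType R) (f : V1 * V2 -> W) t x v :
  derivable (fun s => f (s, x)) t v <-> derivable f (t, x) (v, 0).
Proof.
rewrite /derivable; set F := (X in cvg (X @ _)).
set F' := (X in _ <-> cvg (X @ _)).
suff -> : F = F' by [].
apply/funext => h; rewrite /F /F' /=; congr (_ *: (f _ - _)).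
by congr pair; rewrite -[(h *: _).2]/(h *: (0 : V2)) scaler0 add0r.
Qed.

Lemma slice_derive1 (V1 V2 W : normedModType R) (f : V1 * V2 -> W) t x v :
  'D_v (fun s => f (s, x)) t = 'D_(v, 0) f (t, x).
Proof.
rewrite /derive; set F := (X in lim (X @ _)).
set F' := (X in _ = lim (X @ _)).
suff -> : F = F' by [].
apply/funext => h; rewrite /F /F' /=; congr (_ *: (f _ - _)).
by congr pair; rewrite -[(h *: _).2]/(h *: (0 : V2)) scaler0 add0r.
Qed.

End directional.

(** * Differentiability of C^1 functions and the chain rule *)

Section first_order.
Variable R : realType.

Lemma norm_mx_le m n (A : 'M[R]_(m, n)) B : 0 <= B ->
  (forall i j, `|A i j| <= B) -> `|A| <= B.
Proof.
move=> B0 AB; rewrite [leLHS]/Num.Def.normr/= mx_normrE bigmax_le//.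
Qed.

Lemma norm_mx_ge m n (A : 'M[R]_(m, n)) i j : `|A i j| <= `|A|.
Proof.
rewrite [leRHS]/Num.Def.normr/= mx_normrE.
exact: (le_bigmax _ (fun i : 'I_m * 'I_n => `|A i.1 i.2|) (i, j)).
Qed.

Lemma norm_delta_mx_le m n (i : 'I_m) (j : 'I_n) :
  `|delta_mx i j : 'M[R]_(m, n)| <= 1.
Proof.
apply: norm_mx_le => // a b.
by rewrite mxE; case: (_ && _); rewrite ?normr1// normr0.
Qed.

(** Let [g] be the linear form given by the partial derivatives at [x]. By [MVT_frame] the increment
    of [f - g] is a sum of terms [h 0 i] times the change of a partial derivative between [x] and a
    nearby point, hence [o(h)] by continuity. *)
Lemma C1_differentiable n (U : set 'rV[R]_n) (f : 'rV[R]_n -> R) x :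
  open U -> Ck_on 1 U f -> U x -> differentiable f x.
Proof.
move=> oU [_ df] Ux.
pose g (y : 'rV[R]_n) := \sum_i 'D_(delta_mx 0 i) f x * y 0 i.
have dg : differentiable g x.
  rewrite (_ : g = \sum_i (fun y : 'rV[R]_n => 'D_(delta_mx 0 i) f x *: (y 0 i : R))).
    apply: differentiable_sum => i; apply: differentiableZ.
    exact: differentiable_coord.
  by apply/funext => y; rewrite fct_sumE.
suff dE : differentiable (f - g) x.
  by rewrite -(subrK g f); exact: differentiableD.
pose E : 'rV[R]_n -> R^o := f - g.
have lE : E \o shift x = cst (E x) + (\0 : 'rV[R]_n -> R^o) +o_ (0 : 'rV[R]_n) id.
  apply/eqaddoP => e e0.
  have n0 : 0 < n.+1%:R :> R by rewrite ltr0n.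
  (* The error is shared among [n] coordinates; [n.+1] avoids a division by zero for [n = 0]. *)
  have e10 : 0 < e / n.+1%:R by rewrite divr_gt0.
  have /nbhs_ballP[r /= r0 rP] : \forall y \near x,
      U y /\ forall i, `|'D_(delta_mx 0 i) f y - 'D_(delta_mx 0 i) f x| <= e / n.+1%:R.
    near=> y; split; first by near: y; exact: open_nbhs_nbhs.
    near: y; apply: filter_forall => i.
    have [_ cf] := df (delta_mx 0 i).
    by have /cvgrPdist_le/(_ _ e10) := cf x Ux; under eq_near do rewrite distrC.
  near=> h.
  have hr : \sum_(i < n) `|h 0 i| * `|delta_mx 0 i : 'rV[R]_n| < r.
    apply: (@le_lt_trans _ _ (n.+1%:R * `|h|)); last first.
      rewrite mulrC -ltr_pdivlMr//; near: h.
      by apply: (@nbhs0_lt R 'rV[R]_n); rewrite divr_gt0.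
    apply: (@le_trans _ _ (\sum_(i < n) `|h|)).
      apply: ler_sum => i _; rewrite -[leRHS]mulr1 ler_pM//.
        exact: norm_mx_ge.
      exact: norm_delta_mx_le.
    rewrite sumr_const card_ord -[leLHS]mulr_natl; apply: ler_wpM2r => //.
    by rewrite ler_nat.
  have inr y : `|y - x| <= \sum_(i < n) `|h 0 i| * `|delta_mx 0 i : 'rV[R]_n| ->
      ball x r y.
    by move=> yx; rewrite -ball_normE /ball_/= distrC (le_lt_trans yx).
  have [|xi xix] := @MVT_frame _ _ n (fun i => delta_mx 0 i) (fun i => h 0 i) f x.
    move=> y i yx; have [d1 _] := df (delta_mx 0 i); apply: d1.
    by case: (rP _ (inr _ yx)).
  rewrite -(row_sum_delta h) => Eq.
  rewrite /E !fctE /= /g addr0 (addrC h x).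
  have -> : f (x + h) - \sum_i 'D_(delta_mx 0 i) f x * (x + h) 0 i -
     (f x - \sum_i 'D_(delta_mx 0 i) f x * x 0 i) =
     \sum_i h 0 i * ('D_(delta_mx 0 i) f (xi i) - 'D_(delta_mx 0 i) f x).
    have aux (a b c d : R) : a + b - c - (b - d) = a - (c - d) by ring.
    rewrite -[f (x + h)](subrK (f x)) Eq aux -sumrB -sumrB.
    apply: eq_bigr => i _; rewrite mxE; ring.
  rewrite (le_trans (ler_norm_sum _ _ _))//.
  apply: (@le_trans _ _ (\sum_(i < n) (`|h| * (e / n.+1%:R)))).
    apply: ler_sum => i _; rewrite normrM ler_pM//; first exact: norm_mx_ge.
    by have [_] := rP _ (inr _ (xix i)); exact.
  rewrite sumr_const card_ord -[leLHS]mulr_natl.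
  have -> : n%:R * (`|h| * (e / n.+1%:R)) = e * `|h| * (n%:R / n.+1%:R) by ring.
  by rewrite ler_piMr ?mulr_ge0 ?(ltW e0)// ler_pdivrMr// mul1r ler_nat.
have c0 : continuous (\0 : 'rV[R]_n -> R^o).
  exact: (@cst_continuous 'rV[R]_n R^o 0).
have dE0 : 'd E x = (\0 : 'rV[R]_n -> R^o) :> (_ -> _).
  exact: diff_unique lE.
apply/diff_locallyP; by rewrite dE0; split.
Unshelve. all: by end_near. Qed.


Lemma derive_line0 (V W : normedModType R) (f : V -> W) x v :
  'D_v f x = 'D_1 (fun h : R => f (h *: v + x)) 0.
Proof.
rewrite /derive; set F := (X in lim (X @ _)); set F' := (X in _ = lim (X @ _)).
suff -> : F = F' by [].
apply/funext => h; rewrite /F /F' /=; congr (_ *: (f _ - f _)).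
  by rewrite addr0 [h *: 1]mulr1.
by rewrite scale0r add0r.
Qed.

(** Only [f] has to be differentiable: the restriction of [c] to the line through [x] in direction
    [v] is differentiable as soon as [c] has a derivative along [v]. *)
Lemma is_derive_comp (V W1 W2 : normedModType R) (c : V -> W1) (f : W1 -> W2) x v :
  derivable c x v -> differentiable f (c x) ->
  is_derive x v (f \o c) ('D_('D_v c x) f (c x)).
Proof.
move=> dc df.
have /derivable1_diffP dl := (derivable1P c x v).1 dc.
set l := fun h : R => c (h *: v + x) in dl.
have l0 : l 0 = c x by rewrite /l scale0r add0r.
have dfl : differentiable f (l 0) by rewrite l0.
apply: DeriveDef.
  by apply/derivable1P/derivable1_diffP; exact: differentiable_comp dl dfl.
rewrite derive_line0 deriveE; last exact: differentiable_comp dl dfl.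
rewrite (_ : (fun h : R => _) = f \o l)// diff_comp//= deriveE//.
by rewrite derive_line0 -/l (deriveE _ dl) l0.
Qed.

Lemma derive_sum_delta (W : normedModType R) n (f : 'rV[R]_n -> W) x v :
  differentiable f x -> 'D_v f x = \sum_i v 0 i *: 'D_(delta_mx 0 i) f x.
Proof.
move=> df; rewrite deriveE// {1}(row_sum_delta v) linear_sum.
by apply: eq_bigr => i _; rewrite linearZ /= deriveE.
Qed.

End first_order.

(** * Locally Lipschitz maps, the regularity asked of the geodesic field *)

Section locally_lipschitz.
Variable R : realType.
Implicit Types V W : normedModType R.

Definition loclip V W (f : V -> W) (x : V) := exists L r : R,
  [/\ 0 < L, 0 < r & forall y z, `|y - x| < r -> `|z - x| < r ->
      `|f y - f z| <= L * `|y - z|].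

Lemma near_norm_lt V (x : V) (r : R) : 0 < r -> \forall y \near x, `|y - x| < r.
Proof.
move=> r0; apply/nbhs_ballP; exists r => //= y.
by rewrite -ball_normE /ball_/= distrC.
Qed.

Lemma loclip_continuous V W (f : V -> W) x : loclip f x -> {for x, continuous f}.
Proof.
move=> [L [r [L0 r0 H]]]; apply/cvgrPdist_lt => e e0; near=> y.
have yr : `|y - x| < r by near: y; exact: near_norm_lt.
have ye : `|y - x| < e / L by near: y; apply: near_norm_lt; rewrite divr_gt0.
rewrite distrC; apply: le_lt_trans (H _ _ yr _) _; first by rewrite subrr normr0.
by rewrite mulrC -ltr_pdivlMr.
Unshelve. all: by end_near. Qed.

Lemma loclip_cst V W (a : W) x : loclip (fun _ : V => a) x.
Proof.
by exists 1, 1; split=> // y z _ _; rewrite subrr normr0 mulr_ge0.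
Qed.

Lemma loclip_le V W (f : V -> W) x :
  (forall y z, `|f y - f z| <= `|y - z|) -> loclip f x.
Proof. by move=> H; exists 1, 1; split=> // y z _ _; rewrite mul1r. Qed.

Lemma loclip_add V W (f g : V -> W) x :
  loclip f x -> loclip g x -> loclip (fun y => f y + g y) x.
Proof.
move=> [L [r [L0 r0 H]]] [L' [r' [L'0 r'0 H']]].
exists (L + L'), (Num.min r r'); split; [exact: addr_gt0|by rewrite lt_min r0|].
move=> y z; rewrite !lt_min => /andP[yr yr'] /andP[zr zr'].
rewrite opprD addrACA mulrDl (le_trans (ler_normD _ _))// lerD//.
  exact: H.
exact: H'.
Qed.

Lemma loclip_opp V W (f : V -> W) x : loclip f x -> loclip (fun y => - f y) x.
Proof.
move=> [L [r [L0 r0 H]]]; exists L, r; split=> // y z yr zr.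
by rewrite -opprD normrN; exact: H.
Qed.

Lemma loclip_mul V (f g : V -> R) x :
  loclip f x -> loclip g x -> loclip (fun y => f y * g y) x.
Proof.
move=> [L [r [L0 r0 H]]] [L' [r' [L'0 r'0 H']]].
have xx a : 0 < a -> `|x - x| < a by rewrite subrr normr0.
pose B := `|f x| + L * r; pose B' := `|g x| + L' * r'.
have B0 : 0 < B by rewrite ltr_wpDl// mulr_gt0.
have B'0 : 0 < B' by rewrite ltr_wpDl// mulr_gt0.
exists (B * L' + B' * L), (Num.min r r'); split.
- by rewrite addr_gt0// mulr_gt0.
- by rewrite lt_min r0.
move=> y z; rewrite !lt_min => /andP[yr yr'] /andP[zr zr'].
have fB : `|f y| <= B.
  rewrite -(subrK (f x) (f y)) (le_trans (ler_normD _ _))// addrC lerD//.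
  by rewrite (le_trans (H _ _ yr (xx _ r0)))// ler_wpM2l ?ltW.
have gB : `|g z| <= B'.
  rewrite -(subrK (g x) (g z)) (le_trans (ler_normD _ _))// addrC lerD//.
  by rewrite (le_trans (H' _ _ zr' (xx _ r'0)))// ler_wpM2l ?ltW.
have -> : f y * g y - f z * g z = f y * (g y - g z) + g z * (f y - f z) by ring.
rewrite (le_trans (ler_normD _ _))// !normrM mulrDl -!mulrA lerD// ler_pM//.
  exact: H'.
exact: H.
Qed.

Lemma loclip_sum V W (I : Type) (s : seq I) (f : I -> V -> W) x :
  (forall i, loclip (f i) x) -> loclip (fun y => \sum_(i <- s) f i y) x.
Proof.
move=> lf; elim: s => [|i s IH].
  rewrite (_ : (fun y => _) = (fun=> 0 : W)); first exact: loclip_cst.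
  by apply/funext => y; rewrite big_nil.
rewrite (_ : (fun y => _) = (fun y => f i y + \sum_(i <- s) f i y)).
  exact: loclip_add.
by apply/funext => y; rewrite big_cons.
Qed.

Lemma loclip_comp V V' W (g : V -> V') (f : V' -> W) x :
  loclip g x -> loclip f (g x) -> loclip (f \o g) x.
Proof.
move=> [L [r [L0 r0 H]]] [L' [r' [L'0 r'0 H']]].
exists (L' * L), (Num.min r (r' / L)); split; first exact: mulr_gt0.
  by rewrite lt_min r0 divr_gt0.
have gx y : `|y - x| < Num.min r (r' / L) -> `|g y - g x| < r'.
  rewrite lt_min => /andP[yr yr'].
  apply: le_lt_trans (H _ _ yr _) _; first by rewrite subrr normr0.
  by rewrite mulrC -ltr_pdivlMr.
move=> y z yx zx; rewrite /= (le_trans (H' _ _ (gx _ yx) (gx _ zx)))//.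
rewrite -mulrA ler_wpM2l ?(ltW L'0)//.
by move: yx zx; rewrite !lt_min => /andP[yr _] /andP[zr _]; exact: H.
Qed.

Lemma loclip_mx V m n (f : V -> 'M[R]_(m, n)) x :
  (forall i j, loclip (fun y => f y i j) x) -> loclip f x.
Proof.
move=> lf.
have -> : f = (fun y => \sum_i \sum_j f y i j *: delta_mx i j).
  by apply/funext => y; exact: matrix_sum_delta.
apply: loclip_sum => i; apply: loclip_sum => j.
have [L [r [L0 r0 H]]] := lf i j; exists L, r; split=> // y z yr zr.
rewrite -scalerBl normrZ -[leRHS]mulr1 ler_pM//; first exact: H.
exact: norm_delta_mx_le.
Qed.

(** The frame [e] with its coordinates [c] is abstract because the lemma is meant for the product of
    time and chart. *)
Lemma C1_loclip V m (e : 'I_m -> V) (c : V -> 'I_m -> R) (U : set V)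
    (f : V -> R) x :
  (forall h, h = \sum_i c h i *: e i) -> (forall h i, `|c h i| <= `|h|) ->
  open U -> Ck_on 1 U f -> U x -> loclip f x.
Proof.
move=> ce cle oU [_ df] Ux.
have /nbhs_ballP[r /= r0 rP] : \forall y \near x,
    U y /\ forall i, `|'D_(e i) f y - 'D_(e i) f x| <= 1.
  near=> y; split; first by near: y; exact: open_nbhs_nbhs.
  near: y; apply: filter_forall => i.
  have [_ cf] := df (e i).
  by have /cvgrPdist_le/(_ _ ltr01) := cf x Ux; under eq_near do rewrite distrC.
pose E := \sum_i `|e i|; have E0 : 0 <= E by apply: sumr_ge0.
pose L := \sum_i (`|'D_(e i) f x| + 1).
have L0 : 0 <= L by apply: sumr_ge0 => i _; rewrite addr_ge0.
have K0 : 0 < 1 + 2 * E by rewrite ltr_wpDr// mulr_ge0.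
(* The path of [MVT_frame] from [z] to [y] stays within [E * |y - z|] of [z], so within [r] of [x]
   when [y] and [z] are in the smaller ball. The 1 added to [L] matters only for the empty frame,
   where [L] is 0. *)
exists (L + 1), (r / (1 + 2 * E)); split; [exact: ltr_wpDl|exact: divr_gt0|].
move=> y z yr zr.
have hE : \sum_i `|c (y - z) i| * `|e i| <= `|y - z| * E.
  by rewrite mulr_sumr; apply: ler_sum => i _; rewrite ler_wpM2r.
have inr w : `|w - z| <= \sum_i `|c (y - z) i| * `|e i| -> ball x r w.
  move=> wz; rewrite -ball_normE /ball_/= distrC -(subrKA z).
  have : `|y - z| < 2 * (r / (1 + 2 * E)).
    rewrite -(subrKA x) (le_lt_trans (ler_normD _ _))// (distrC x) mulr2n mulrDl.
    by rewrite !mul1r ltrD.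
  move=> yz; apply: le_lt_trans (ler_normD _ _) _.
  have := le_trans wz hE; move: zr; rewrite ltr_pdivlMr// => zr wz'.
  have : `|y - z| * E <= 2 * (r / (1 + 2 * E)) * E by rewrite ler_wpM2r// ltW.
  have : r / (1 + 2 * E) * (1 + 2 * E) = r by rewrite divfK// gt_eqF.
  have : `|z - x| < r / (1 + 2 * E) by rewrite ltr_pdivlMr.
  lra.
have [|xi xix] := @MVT_frame _ _ m e (c (y - z)) f z.
  move=> w i wz; have [d1 _] := df (e i); apply: d1.
  by case: (rP _ (inr _ wz)).
rewrite -ce [z + _]addrC subrK => ->.
rewrite (le_trans (ler_norm_sum _ _ _))// mulrDl mul1r.
apply: (@le_trans _ _ (L * `|y - z|)); last by rewrite lerDl.
rewrite mulr_suml; apply: ler_sum => i _; rewrite normrM mulrC ler_pM//.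
have [_ /(_ i) D1] := rP _ (inr _ (xix i)).
rewrite -(subrK ('D_(e i) f x) ('D_(e i) f (xi i))).
by rewrite (le_trans (ler_normD _ _))// addrC lerD.
Unshelve. all: by end_near. Qed.

Lemma C1_loclip_prod n (U : set (R^o * 'rV[R]_n)) (f : R^o * 'rV[R]_n -> R) x :
  open U -> Ck_on 1 U f -> U x -> loclip f x.
Proof.
pose e (i : 'I_n.+1) : R^o * 'rV[R]_n :=
  oapp (fun j => (0, delta_mx 0 j)) (1, 0) (unlift ord0 i).
pose c (h : R^o * 'rV[R]_n) (i : 'I_n.+1) : R :=
  oapp (fun j => h.2 0 j) h.1 (unlift ord0 i).
apply: (@C1_loclip _ _ e c).
  move=> [t h]; rewrite big_ord_recl /e /c unlift_none /=.
  under eq_bigr do rewrite liftK /=.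
  rewrite (eq_bigr (fun i => (0, h 0 i *: delta_mx 0 i))); last first.
    by move=> i _; congr pair; exact: scaler0.
  rewrite -(@big_morph _ _ (pair (0 : R^o)) (0 : R^o * 'rV[R]_n) +%R 0 +%R).
  - rewrite -row_sum_delta; congr pair.
      by rewrite addr0; exact/esym/mulr1.
    by rewrite -[(t *: _).2]/(t *: (0 : 'rV[R]_n)) scaler0 add0r.
  - by move=> a b; congr pair; exact/esym/addr0.
  - by [].
move=> [t h] i; rewrite /c; case: unliftP => [j _|_] /=.
  by rewrite (le_trans (norm_mx_ge _ _ _))// le_max lexx orbT.
by rewrite le_max lexx.
Qed.

End locally_lipschitz.

(** * Existence and stability of solutions of ordinary differential equations *)

Section clamp.
Variable R : realType.
Implicit Types c r s : R.

Definition clamp c r s := Num.max (c - r) (Num.min s (c + r)).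

Lemma clamp_dist_le c r s : 0 <= r -> `|clamp c r s - c| <= r.
Proof.
move=> r0; rewrite /clamp ler_norml.
case: (leP s (c + r)) => H1; [case: (leP (c - r) s)|case: (leP (c - r) (c + r))];
  lra.
Qed.

Lemma clamp_id c r s : `|s - c| <= r -> clamp c r s = s.
Proof.
rewrite ler_norml => /andP[H1 H2].
by rewrite /clamp min_l ?max_r//; lra.
Qed.

Lemma clamp_lipschitz c r s t : `|clamp c r s - clamp c r t| <= `|s - t|.
Proof.
have := ler_norm (s - t); have := ler_norm (t - s); rewrite (distrC t).
rewrite /clamp ler_norml.
case: (leP s (c + r)) => H1; case: (leP t (c + r)) => H2;
  case: (leP (c - r) (c + r)); try case: (leP (c - r) s);
  try case: (leP (c - r) t); lra.
Qed.

End clamp.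

Section cauchy_lipschitz.
Variables (R : realType) (m n : nat).
Local Notation V := 'M[R]_(m, n).

(** The radius 3 leaves room around the times between -2 and 2 at which [picard] evaluates
    antiderivatives. *)
Lemma antiderivative (f : R -> R) : continuous f -> exists F : R -> R,
  F 0 = 0 /\ forall s : R, `|s| < 3 -> is_derive s 1 F (f s).
Proof.
move=> cf; pose G s := (\int[lebesgue_measure]_(t in `[(-3 : R), s]) f t)%R.
exists (fun s => G s - G 0); split; first by rewrite subrr.
move=> s; rewrite ltr_norml => /andP[s3 s3'].
have if3 : lebesgue_measure.-integrable `[(-3 : R), 3] (EFin \o f).
  apply: continuous_compact_integrable; first exact: segment_compact.
  exact: continuous_subspaceT.
have [dG EG] := @continuous_FTC1_closed _ f (-3) s 3 s3' if3 s3 (cf s).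
have dG' : is_derive s 1 G (f s) by apply: DeriveDef; [exact: dG|rewrite -derive1E; exact: EG].
by have := is_deriveB dG' (is_derive_cst (G 0) s 1); rewrite subr0.
Qed.

Lemma mx_is_derive (V' : normedModType R) (y : V' -> V) x v (dy : V) :
  (forall i j, is_derive x v (fun u => y u i j) (dy i j)) -> is_derive x v y dy.
Proof.
move=> dyij; have dyx : derivable y x v by apply/derivable_mxP => i j; case: (dyij i j).
apply: DeriveDef => //; rewrite derive_mx//; apply/matrixP => i j; rewrite mxE.
exact: derive_val.
Qed.

Lemma is_derive_mx (V' : normedModType R) (y : V' -> V) x v (dy : V) i j :
  is_derive x v y dy -> is_derive x v (fun u => y u i j) (dy i j).
Proof.
move=> [dyx <-]; apply: DeriveDef; first exact: (derivable_mxP _ _ _).1 dyx i j.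
by rewrite derive_mx// mxE.
Qed.

Lemma mx_MVT_le (y dy : R -> V) (a b B : R) : 0 <= B ->
  (forall s, `|s - a| <= `|b - a| -> is_derive s 1 y (dy s)) ->
  (forall s, `|s - a| <= `|b - a| -> `|dy s| <= B) ->
  `|y b - y a| <= B * `|b - a|.
Proof.
move=> B0 dys dyB; apply: norm_mx_le => [|i j]; first by rewrite mulr_ge0.
rewrite !mxE; apply: (between_MVT_le (f := fun s => y s i j)
  (df := fun s => dy s i j)) => s sab.
  by apply: is_derive_mx; exact: dys.
by rewrite (le_trans (norm_mx_ge _ _ _))// dyB.
Qed.

Lemma is_derive_continuous (V' : normedModType R) (y : R -> V') (s : R) dy :
  is_derive s 1 y dy -> {for s, continuous y}.
Proof.
move=> [dy1 _]; apply: differentiable_continuous; exact/derivable1_diffP.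
Qed.

(** The intervals of radius [2 * M / 2 ^+ k] about [u k] are nested, as the radius decreases by
    [M / 2 ^+ k.+1] more than half-way room allows for the next step; the supremum of their left
    ends lies in all of them. *)
Lemma geometric_limit (u : nat -> R) M : 0 <= M ->
  (forall k, `|u k.+1 - u k| <= M / 2 ^+ k) ->
  exists l, forall k, `|u k - l| <= 2 * M / 2 ^+ k.
Proof.
move=> M0 uM.
have step k : 2 * M / 2 ^+ k.+1 = M / 2 ^+ k.
  by rewrite exprS invfM mulrACA mulfV ?mul1r// gt_eqF// ltr0n.
have lo k : u k - 2 * M / 2 ^+ k <= u k.+1 - 2 * M / 2 ^+ k.+1.
  have := uM k; rewrite step ler_norml => /andP[H _].
  have -> : 2 * M / 2 ^+ k = M / 2 ^+ k + M / 2 ^+ k by ring.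
  lra.
have hi k : u k.+1 + 2 * M / 2 ^+ k.+1 <= u k + 2 * M / 2 ^+ k.
  have := uM k; rewrite step ler_norml => /andP[_ H].
  have -> : 2 * M / 2 ^+ k = M / 2 ^+ k + M / 2 ^+ k by ring.
  lra.
have lo_mono k d : u k - 2 * M / 2 ^+ k <= u (k + d)%N - 2 * M / 2 ^+ (k + d).
  elim: d => [|d IH]; first by rewrite addn0.
  by rewrite addnS (le_trans IH).
have hi_mono k d : u (k + d)%N + 2 * M / 2 ^+ (k + d) <= u k + 2 * M / 2 ^+ k.
  elim: d => [|d IH]; first by rewrite addn0.
  by rewrite addnS (le_trans _ IH).
have M2 k : 0 <= 2 * M / 2 ^+ k by rewrite !mulr_ge0// invr_ge0 exprn_ge0.
have lohi j k : u j - 2 * M / 2 ^+ j <= u k + 2 * M / 2 ^+ k.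
  have := lo_mono j k; have := hi_mono k j; have := M2 (k + j)%N.
  rewrite [(j + k)%N]addnC; lra.
pose S := range (fun k => u k - 2 * M / 2 ^+ k).
exists (sup S) => k.
have : u k - 2 * M / 2 ^+ k <= sup S.
  apply: ub_le_sup; last by exists k.
  by exists (u 0 + 2 * M / 2 ^+ 0) => _ [j _ <-]; exact: lohi.
have : sup S <= u k + 2 * M / 2 ^+ k.
  apply: ge_sup; first by exists (u 0%N - 2 * M / 2 ^+ 0), 0%N.
  by move=> _ [j _ <-]; exact: lohi.
rewrite ler_norml; lra.
Qed.

(** Successive approximations. The constant 1/4 makes the integral operator halve distances over
    times up to 2. The interval of times is fixed, with a margin around 0 and 1; smallness is asked
    of the field instead. *)
Lemma picard (F : V -> V) (y0 : V) :
  (forall y z, `|F y - F z| <= 4^-1 * `|y - z|) ->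
  exists y : R -> V, y 0 = y0 /\
    forall s : R, `|s| < 2 -> is_derive s 1 y (F (y s)).
Proof.
move=> Flip.
have cF : continuous F.
  move=> y; apply: loclip_continuous; exists 1, 1; split=> // a b _ _.
  by rewrite (le_trans (Flip _ _))// ler_wpM2r// invf_le1// ler1n.
(* The premise on [f] sits inside the existential so that [choice] gives an operator on all
   functions. *)
have antider (f : R -> V) : exists G : R -> V, continuous f ->
    G 0 = 0 /\ forall s : R, `|s| < 3 -> is_derive s 1 G (f s).
  have [cf|ncf] := pselect (continuous f); last by exists (fun=> 0).
  have cfij i j : continuous (fun s => f s i j).
    move=> s; apply: (@continuous_comp _ _ _ f (fun A : V => A i j)).
      exact: cf.
    exact: coord_continuous.
  have [G HG] := choice (fun ij => antiderivative (cfij ij.1 ij.2)).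
  exists (fun s => \matrix_(i, j) G (i, j) s) => _; split.
    by apply/matrixP => i j; rewrite !mxE (HG (i, j)).1.
  move=> s s3; apply: mx_is_derive => i j.
  rewrite (_ : (fun u => _) = G (i, j)); first exact: (HG (i, j)).2.
  by apply/funext => u; rewrite mxE.
have [P HP] := choice antider.
(* Clamping the time makes the iterates continuous, and their differences bounded, on all of the
   line, although the antiderivatives are controlled only for times below 3. *)
pose clamp2 (s : R) := clamp 0 2 s.
have clamp2_le s : `|clamp2 s| <= 2.
  by have := clamp_dist_le 0 s (ler0n R 2); rewrite subr0.
have clamp2_cont : continuous clamp2.
  move=> s; apply: (loclip_continuous (V := R) (W := R)).
  by apply: loclip_le => a b; exact: clamp_lipschitz.
pose Phi (y : R -> V) s := y0 + P (F \o y) (clamp2 s).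
have cFy (y : R -> V) : continuous y -> continuous (F \o y).
  by move=> cy s; apply: continuous_comp; [exact: cy|exact: cF].
have cPhi y : continuous y -> continuous (Phi y).
  move=> /cFy cy s; apply: cvgD; first exact: cvg_cst.
  apply: (@continuous_comp _ _ _ clamp2 (P (F \o y))); first exact: clamp2_cont.
  have [_ dP] := HP _ cy; apply: is_derive_continuous (dP _ _).
  by rewrite (le_lt_trans (clamp2_le s))// ltr_nat.
have contr y z e : continuous y -> continuous z -> 0 <= e ->
    (forall s, `|y s - z s| <= e) -> forall s, `|Phi y s - Phi z s| <= e / 2.
  move=> cy cz e0 yz s; rewrite /Phi opprD addrACA subrr add0r.
  have [Py0 dPy] := HP _ (cFy _ cy); have [Pz0 dPz] := HP _ (cFy _ cz).
  have := @mx_MVT_le (fun s => P (F \o y) s - P (F \o z) s)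
    (fun s => F (y s) - F (z s)) 0 (clamp2 s) (e / 4).
  rewrite Py0 Pz0 !subr0 => H; apply: le_trans (H _ _ _) _.
  - by rewrite divr_ge0.
  - move=> u; rewrite !subr0 => us.
    have u3 : `|u| < 3.
      by rewrite (le_lt_trans us)// (le_lt_trans (clamp2_le s))// ltr_nat.
    by apply: is_deriveB; [exact: dPy|exact: dPz].
  - by move=> u _; rewrite (le_trans (Flip _ _))// mulrC ler_wpM2r// invr_ge0.
  - have := clamp2_le s; move: (clamp2 s) => c c2.
    have -> : e / 2 = e / 4 * 2 by field.
    by rewrite ler_wpM2l// divr_ge0.
pose y_ k := iter k Phi (fun=> y0).
have cy_ k : continuous (y_ k).
  by elim: k => [|k IH]; [exact: cst_continuous|exact: cPhi].
pose M := 2 * `|F y0|; have M0 : 0 <= M by rewrite mulr_ge0.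
have y_step k s : `|y_ k.+1 s - y_ k s| <= M / 2 ^+ k.
  elim: k s => [|k IH] s.
    rewrite /= expr0 divr1 /Phi addrC addKr.
    have [Py0 dPy] := HP _ (cFy _ (cy_ 0%N)).
    have := @mx_MVT_le (P (F \o y_ 0%N)) (fun=> F y0) 0 (clamp2 s) `|F y0|.
    rewrite Py0 !subr0 => H; apply: le_trans (H _ _ _) _ => //.
      move=> u; rewrite !subr0 => us; apply: dPy.
      by rewrite (le_lt_trans us)// (le_lt_trans (clamp2_le s))// ltr_nat.
    by rewrite /M mulrC ler_wpM2r.
  rewrite exprSr invfM mulrA; apply: contr.
  - exact: (cy_ k.+1).
  - exact: (cy_ k).
  - by rewrite divr_ge0// exprn_ge0.
  - exact: IH.
have lim_y s : exists l : V, forall k, `|y_ k s - l| <= 2 * M / 2 ^+ k.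
  have lim_ij ij : exists l, forall k,
      `|y_ k s ij.1 ij.2 - l| <= 2 * M / 2 ^+ k.
    apply: geometric_limit => // k; apply: le_trans (y_step k s).
    by have := norm_mx_ge (y_ k.+1 s - y_ k s) ij.1 ij.2; rewrite !mxE.
  have [l Hl] := choice lim_ij; exists (\matrix_(i, j) l (i, j)) => k.
  apply: norm_mx_le => [|i j]; first by rewrite divr_ge0 ?mulr_ge0// exprn_ge0.
  by rewrite !mxE; exact: (Hl (i, j) k).
have [y Hy] := choice lim_y.
have small e : 0 < e -> exists k, 2 * M / 2 ^+ k < e.
  move=> e0; have [k Hk] : exists k : nat, 2 * M / e < k%:R.
    by exists (Num.truncn (2 * M / e)).+1; exact: truncnS_gt.
  exists k; rewrite ltr_pdivrMr ?exprn_gt0//.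
  move: Hk; rewrite ltr_pdivrMr// => /lt_le_trans; apply.
  rewrite mulrC ler_wpM2l ?(ltW e0)// -natrX ler_nat.
  by rewrite ltnW// ltn_expl.
have cy : continuous y.
  move=> s; apply/cvgrPdist_lt => e e0.
  have e30 : 0 < e / 3 by rewrite divr_gt0.
  have [k Hk] := small _ e30.
  near=> u.
  have : `|y_ k s - y_ k u| < e / 3.
    by near: u; have /cvgrPdist_lt/(_ _ e30) := cy_ k s.
  have := le_lt_trans (Hy s k) Hk; have := le_lt_trans (Hy u k) Hk.
  rewrite (distrC _ (y s)) => H1 H2 H3.
  rewrite -(subrKA (y_ k s)) (le_lt_trans (ler_normD _ _))//.
  have := ler_normD (y_ k s - y_ k u) (y_ k u - y u).
  rewrite subrKA; lra.
have fix_y s : Phi y s = y s.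
  apply/eqP; rewrite -subr_eq0 -normr_le0; apply/ler_addgt0Pl => e e0.
  rewrite addr0; have e20 : 0 < e / 2 by rewrite divr_gt0.
  have [k Hk] := small _ e20.
  have M2k : 0 <= 2 * M / 2 ^+ k by rewrite divr_ge0 ?mulr_ge0// exprn_ge0.
  have := contr _ _ _ cy (cy_ k) M2k _ s.
  have yk u : `|y u - y_ k u| <= 2 * M / 2 ^+ k by rewrite distrC; exact: Hy.
  move=> /(_ yk) H1; have := Hy s k.+1.
  rewrite -(subrKA (y_ k.+1 s)) => H2.
  have : 2 * M / 2 ^+ k.+1 = 2 * M / 2 ^+ k / 2.
    by rewrite exprSr invfM mulrA.
  have := ler_normD (Phi y s - y_ k.+1 s) (y_ k.+1 s - y s).
  move: H1 H2; rewrite -[Phi (y_ k) s]/(y_ k.+1 s); lra.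
have [P0 dP] := HP _ (cFy _ cy).
exists y; split.
  by rewrite -fix_y /Phi /clamp2 clamp_id ?subr0 ?normr0// P0 addr0.
move=> s s2.
have dPs : is_derive s 1 (fun s => y0 + P (F \o y) s) (F (y s)).
  rewrite -[F (y s)]add0r; apply: is_deriveD; apply: dP.
  by rewrite (lt_trans s2)// ltr_nat.
apply: near_eq_is_derive dPs; near=> u; rewrite -[RHS]fix_y /Phi /clamp2 clamp_id ?subr0//.
near: u; have : {for s, continuous (fun s : R => `|s|)} by exact: norm_continuous.
by move=> /cvgrPdist_lt/(_ (2 - `|s|)); rewrite subr_gt0 => /(_ s2); apply: filterS => u; rewrite distrC ltrBrDr => /(le_lt_trans _)/ltW; apply; rewrite -lerBlDr ler_norm.
Unshelve. all: by end_near. Qed.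

(** No exponential estimate is needed: if [D] is the maximum of the distance, reached at [s0], the
    mean value inequality from 0 to [s0] gives [D <= D / 4 + e]. *)
Lemma ode_stability (F G : V -> V) (y z : R -> V) e :
  (forall a b, `|F a - F b| <= 4^-1 * `|a - b|) ->
  (forall s : R, `|s| <= 1 -> `|F (z s) - G (z s)| <= e) ->
  (forall s : R, `|s| <= 1 -> is_derive s 1 y (F (y s))) ->
  (forall s : R, `|s| <= 1 -> is_derive s 1 z (G (z s))) ->
  y 0 = z 0 ->
  forall s : R, `|s| <= 1 -> `|y s - z s| <= 2 * e.
Proof.
move=> Flip FG dy dz y0z0.
have N10 : -1 <= 1 :> R by lra.
have inI s : s \in `[(-1 : R), 1] -> `|s| <= 1 by rewrite in_itv /= -ler_norml.
have [|s0 s01 smax] := @EVT_max R (fun s => `|y s - z s|) (-1) 1 N10.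
  apply: continuous_in_subspaceT => s; rewrite inE/= => /inI s1.
  apply: (@continuous_comp _ _ _ (fun s => y s - z s) Num.norm).
    by apply: cvgB; [exact: is_derive_continuous (dy _ s1)|
                     exact: is_derive_continuous (dz _ s1)].
  exact: norm_continuous.
set D := `|y s0 - z s0| in smax.
have e0 : 0 <= e by rewrite (le_trans _ (FG 0 _)) ?normr0.
have D0 : 0 <= D by exact: normr_ge0.
have s01' := inI _ s01.
have : D <= (4^-1 * D + e) * `|s0|.
  have := @mx_MVT_le (fun s => y s - z s) (fun s => F (y s) - G (z s)) 0 s0 (4^-1 * D + e).
  rewrite y0z0 !subr0 subrr subr0; apply.
  - by rewrite addr_ge0// mulr_ge0// invr_ge0.
  - move=> s; rewrite !subr0 => /le_trans /(_ s01') s1.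
    by apply: is_deriveB; [exact: dy|exact: dz].
  - move=> s; rewrite !subr0 => /le_trans /(_ s01') s1.
    rewrite -(subrKA (F (z s))) (le_trans (ler_normD _ _))// lerD//; last exact: FG.
    rewrite (le_trans (Flip _ _))// ler_wpM2l ?invr_ge0// smax//.
    by rewrite in_itv/= -ler_norml.
have : (4^-1 * D + e) * `|s0| <= 4^-1 * D + e.
  by rewrite ler_piMr// addr_ge0// mulr_ge0// invr_ge0.
move=> H1 H2 s s1; have : `|y s - z s| <= D.
  by apply: smax; rewrite in_itv/= -ler_norml.
lra.
Qed.

End cauchy_lipschitz.

(** * Charts, and a lower bound for the Riemannian distance *)

Lemma continuous_at_sum (R : realType) (T : topologicalType) (I : Type)
    (r : seq I) (f : I -> T -> R) x :
  (forall i, {for x, continuous (f i)}) ->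
  {for x, continuous (fun y => \sum_(i <- r) f i y)}.
Proof.
move=> cf; elim: r => [|i r IH].
  rewrite (_ : (fun y => _) = (fun=> 0)); first exact: cvg_cst.
  by apply/funext => y; rewrite big_nil.
rewrite (_ : (fun y => _) = (fun y => f i y + \sum_(i <- r) f i y)).
  by apply: cvgD; [exact: cf|exact: IH].
by apply/funext => y; rewrite big_cons.
Qed.

Section transitions.
Variables (R : realType) (n : nat) (M : smoothManifold R n).
Implicit Types (i j : chart_index M) (p : M).

Definition overlap i j : set 'rV[R]_n := mmap i @` (mdom i `&` mdom j).

Lemma mimg_open i : open (mimg i).
Proof. exact: cimg_open. Qed.

Lemma mdom_open i : open (mdom i).
Proof. exact: cdom_open. Qed.

Lemma mdom_mimg i p : mdom i p -> mimg i (mmap i p).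
Proof. by move=> ip; exists p. Qed.

Lemma mmapK i p : mdom i p -> cinv (mchart i) (mmap i p) = p.
Proof. exact: cmapK. Qed.

Lemma cinvK i x : mimg i x -> mmap i (cinv (mchart i) x) = x.
Proof. by case=> p ip <-; rewrite mmapK. Qed.

Lemma mdom_cinv i x : mimg i x -> mdom i (cinv (mchart i) x).
Proof. by case=> p ip <-; rewrite mmapK. Qed.

Lemma mmap_continuous i p : mdom i p -> {for p, continuous (mmap i)}.
Proof. exact: cmap_continuous. Qed.

Lemma near_mdom i p : mdom i p -> \forall q \near p, mdom i q.
Proof. by move=> ip; apply: open_nbhs_nbhs; split=> //; exact: mdom_open. Qed.

Lemma overlapE i j x : overlap i j x <-> mimg i x /\ mdom j (cinv (mchart i) x).
Proof.
split=> [[p [ip jp] <-]|[[p ip <-]]]; rewrite mmapK//.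
  by split=> //; exists p.
by move=> jp; exists p.
Qed.

Lemma overlap_open i j : open (overlap i j).
Proof.
rewrite openE => x /overlapE[ix jx]; rewrite /interior.
have nix : \forall y \near x, mimg i y.
  by apply: open_nbhs_nbhs; split=> //; exact: mimg_open.
have njx : \forall y \near x, mdom j (cinv (mchart i) y).
  have /= := @cinv_continuous _ _ _ (mchart i) x ix; apply.
  exact: near_mdom.
by near=> y; apply/overlapE; split; [near: y|near: y].
Unshelve. all: by end_near. Qed.

Lemma transition_differentiable i j x : overlap i j x ->
  differentiable (transition (mchart i) (mchart j)) x.
Proof.
move=> ox; set tau := transition _ _.
have -> : tau = \sum_k (fun y => tau y 0 k *: delta_mx 0 k).
  by apply/funext => y; rewrite fct_sumE; exact: row_sum_delta.
apply: differentiable_sum => k; apply: differentiableZl.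
apply: (C1_differentiable (@overlap_open i j)) => //.
by apply: (Ck_on_mxP 1 tau (@overlap_open i j)).1 0 k; exact: transition_smooth.
Qed.

Lemma local_curve_derivative i j (c : R -> M) s :
  {for s, continuous c} -> mdom i (c s) -> mdom j (c s) ->
  derivable (local_curve i c) s 1 ->
  derive1 (local_curve j c) s =
  'D_(derive1 (local_curve i c) s) (transition (mchart i) (mchart j))
    (mmap i (c s)).
Proof.
move=> cc ic jc dc; set tau := transition _ _.
have os : overlap i j (local_curve i c s) by exists (c s).
have := is_derive_comp dc (transition_differentiable os).
rewrite !derive1E => H; rewrite -(derive_val (is_derive := H)).
apply: near_eq_derive; near=> u.
rewrite /= /tau /transition /= /local_curve /= -/(mmap i (c u)).
rewrite -[cinv (mchart i) _]/(cinv (mchart i) (mmap i (c u))) mmapK//.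
by near: u; apply: cc; exact: near_mdom.
Unshelve. all: by end_near. Qed.

(** The preferred chart in [speed] may jump along the curve; reading the speed in one chart around a
    given time is what makes it continuous and allows it to be estimated. *)
Lemma speed_chart (g : metric M) i (c : R -> M) s : C1_curve c -> mdom i (c s) ->
  let v := derive1 (local_curve i c) s in
  speed g c s = Num.sqrt ((v *m gmx g i (local_curve i c s) *m v^T) 0 0).
Proof.
move=> C1c ic v; have [cc dc] := C1c s; have [+ _] := dc _ ic.
move=> /nbhs_singleton dci; rewrite /speed.
set j := chart_at (c s); have jc : mdom j (c s) by exact: chart_atP.
have /= := @gmx_transition _ _ _ g i j _ v v ic jc.
rewrite -(local_curve_derivative cc ic jc dci) => /esym.
exact: congr1.
Qed.

Lemma speed_continuous (g : metric M) (c : R -> M) : C1_curve c ->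
  continuous (speed g c).
Proof.
move=> C1c s; have [cc dc] := C1c s.
set i := chart_at (c s); have ic : mdom i (c s) by exact: chart_atP.
have [dX cX'] := dc _ ic.
pose X := local_curve i c; pose X' := derive1 X.
have cX : {for s, continuous X}.
  by apply: (@continuous_comp _ _ _ c (mmap i)) => //; exact: mmap_continuous.
pose q u := \sum_b (\sum_a X' u 0 a * gmx g i (X u) a b) * X' u 0 b.
have E : \forall u \near s, Num.sqrt (q u) = speed g c u.
  near=> u; rewrite (speed_chart _ C1c (i := i)); last first.
    by near: u; apply: cc; exact: near_mdom.
  congr Num.sqrt; rewrite !mxE; apply: eq_bigr => b _; rewrite !mxE.
  by congr (_ * _).
suff cq : {for s, continuous (fun u => Num.sqrt (q u))}.
  by rewrite /continuous_at -(nbhs_singleton E); apply: cvg_trans cq; exact: near_eq_cvg.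
apply: (@continuous_comp _ _ _ q Num.sqrt); last exact: sqrt_continuous.
have cX'k a : {for s, continuous (fun u => X' u 0 a)}.
  by apply: (@continuous_comp _ _ _ X' (fun A : 'rV[R]_n => A 0 a)) => //; exact: coord_continuous.
have cG a b : {for s, continuous (fun u => gmx g i (X u) a b)}.
  apply: (@continuous_comp _ _ _ X (fun x => gmx g i x a b)) => //.
  apply: (smooth_on_continuous ((smooth_on_mxP _ (@mimg_open i)).1 (@gmx_smooth _ _ _ g i) a b)).
  exact: mdom_mimg.
apply: continuous_at_sum => b; apply: cvgM; last exact: cX'k.
by apply: continuous_at_sum => a; apply: cvgM; [exact: cX'k|exact: cG].
Unshelve. all: by end_near. Qed.

End transitions.

Section distance_lower_bound.
Variables (R : realType) (n : nat) (M : smoothManifold R n) (g : metric M).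
Variables (i : chart_index M) (x0 : 'rV[R]_n) (r C : R).
Hypotheses (r0 : 0 < r) (C0 : 0 < C).
Hypothesis ball_mimg : forall x, `|x - x0| < r -> mimg i x.
Hypothesis speed_ge : forall x (v : 'rV[R]_n) k, `|x - x0| < r ->
  `|v 0 k| <= C * Num.sqrt ((v *m gmx g i x *m v^T) 0 0).

Let near_chart p := mdom i p /\ `|mmap i p - x0| < r.

Let near_chart_open p : near_chart p -> \forall q \near p, near_chart q.
Proof.
move=> [ip pr]; have pr' : 0 < r - `|mmap i p - x0| by rewrite subr_gt0.
near=> q; split; first by near: q; exact: near_mdom.
have : `|mmap i p - mmap i q| < r - `|mmap i p - x0|.
  by near: q; have /cvgrPdist_lt/(_ _ pr') := mmap_continuous ip.
rewrite distrC => H; rewrite -(subrKA (mmap i p)).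
by rewrite (le_lt_trans (ler_normD _ _))// -ltrBrDr.
Unshelve. all: by end_near. Qed.

(** Each coordinate of the displacement is the integral of its derivative, which is at most [C]
    times the speed as long as the curve stays near [x0]. *)
Lemma chart_displacement_le (c : R -> M) (s d : R) : C1_curve c ->
  (length g c < d%:E)%E -> 0 < s <= 1 ->
  (forall u, 0 <= u <= s -> near_chart (c u)) ->
  `|local_curve i c s - local_curve i c 0| <= C * d.
Proof.
move=> C1c lcd /andP[s0 s1] cn; set X := local_curve i c.
have d0 : 0 < d.
  by rewrite -lte_fin (le_lt_trans _ lcd)// integral_ge0// => u _; rewrite lee_fin sqrtr_ge0.
apply: norm_mx_le => [|a k]; first by rewrite mulr_ge0// ltW.
rewrite !mxE ord1.
have dX u : 0 <= u <= s -> derivable X u 1.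
  by move=> us; have [_ /(_ i (cn _ us).1)[+ _]] := C1c u; move/nbhs_singleton.
have cX' u : 0 <= u <= s -> {for u, continuous (fun u => derive1 X u 0 k)}.
  move=> us; have [_ /(_ i (cn _ us).1)[_ cX']] := C1c u.
  apply: (@continuous_comp _ _ _ (derive1 X) (fun A : 'rV[R]_n => A 0 k)) => //.
  exact: coord_continuous.
have dXk u : 0 <= u <= s -> is_derive u 1 (fun u => X u 0 k) (derive1 X u 0 k).
  move=> us; apply: (is_derive_mx (y := X)); rewrite derive1E.
  by apply: derivableP; exact: dX.
have cX'w : {within `[0, s], continuous (fun u => derive1 X u 0 k)}.
  by apply: continuous_in_subspaceT => u; rewrite inE/= in_itv/=; exact: cX'.
have mX' : measurable_fun `[0, s] (fun u => derive1 X u 0 k).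
  by apply: subspace_continuous_measurable_fun => //; exact: cX'w.
have mspeed : measurable_fun setT (speed g c).
  by apply: continuous_measurable_fun; exact: speed_continuous.
have ms D : measurable D -> measurable_fun D (fun u => (speed g c u)%:E).
  by move=> mD; apply/measurable_EFinP; exact: measurable_funTS.
have us0 u : u \in `]0, s[ -> 0 <= u <= s.
  by rewrite in_itv/= => /andP[/ltW-> /ltW->].
have FTC : (\int[lebesgue_measure]_(u in `[0%R, s]) (derive1 X u 0 k)%:E =
    (X s 0 k)%:E - (X 0 0 k)%:E)%E.
  apply: (@continuous_FTC2 _ (fun u => derive1 X u 0 k) (fun u => X u 0 k) 0 s s0 cX'w).
  - split.
    + by move=> u /us0/dXk; case.
    + apply: cvg_at_right_filter.
      by apply: is_derive_continuous (dXk 0 _); rewrite lexx ltW.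
    + apply: cvg_at_left_filter.
      by apply: is_derive_continuous (dXk s _); rewrite lexx ltW.
  - by move=> u /us0/dXk H; rewrite derive1E; exact: derive_val.
have C_ge0 := ltW C0.
have : (`|X s 0 k - X 0 0 k|%:E <= C%:E * length g c)%E.
  rewrite -[X in (X <= _)%E]/(`|(X s 0 k)%:E - (X 0 0 k)%:E|)%E -FTC.
  apply: (le_trans (le_abse_integral _ _ _)) => //; first exact/measurable_EFinP.
  apply: (@le_trans _ _
      (\int[lebesgue_measure]_(u in `[0%R, s]) (C%:E * (speed g c u)%:E))%E).
    apply: ge0_le_integral => //.
    - by apply: measurableT_comp => //; exact/measurable_EFinP.
    - by apply: emeasurable_funM => //; exact: ms.
    - move=> u; rewrite /= in_itv/= => us; rewrite lee_fin.
      have [iu ru] := cn _ us.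
      by rewrite (speed_chart _ C1c iu); exact: speed_ge.
  have sp0 u : (0 <= (speed g c u)%:E)%E by rewrite lee_fin sqrtr_ge0.
  rewrite ge0_integralZl_EFin//; last exact: ms.
  apply: lee_wpmul2l; first by rewrite lee_fin.
  apply: ge0_subset_integral => //; first exact: ms.
  by apply: subset_itvl; rewrite bnd_simp.
move=> H; rewrite -lee_fin; apply: (le_trans H).
by rewrite EFinM; apply: lee_wpmul2l; [rewrite lee_fin|exact: ltW].
Qed.

(** This rests on the Hausdorff property: otherwise a curve could leave the chart while its
    coordinates remain in a compact set, as on a line with a doubled point. *)
Let closed_core (r' : R) : r' < r ->
  closed (cinv (mchart i) @` [set x | `|x - x0| <= r']).
Proof.
move=> r'r; apply: compact_closed; first exact: carrier_hausdorff.
apply: continuous_compact.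
  apply: continuous_in_subspaceT => x; rewrite inE/= => xr.
  by apply: cinv_continuous; apply: ball_mimg; exact: le_lt_trans r'r.
apply: bounded_closed_compact.
  exists (`|x0| + r'); split; first exact: num_real.
  move=> B /= HB x /= xr; rewrite -(subrK x0 x) (le_trans (ler_normD _ _))//.
  by apply: ltW; apply: le_lt_trans HB; rewrite addrC lerD2l.
rewrite (_ : [set x | _] = (fun x => `|x - x0|) @^-1` [set y | y <= r'])//.
apply: closed_comp; last exact: closed_le.
move=> x _; apply: (loclip_continuous (W := R)); apply: loclip_le => a b.
by rewrite (le_trans (ler_dist_dist _ _))// opprB addrA subrK.
Qed.

Lemma chart_dist_le (x y : 'rV[R]_n) (d : R) : `|x - x0| < r / 2 ->
  C * d < r / 4 ->
  (dist g (cinv (mchart i) x) (cinv (mchart i) y) < d%:E)%E -> mimg i y ->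
  `|y - x| <= C * d.
Proof.
move=> xr Cdr /ereal_inf_lt[_ [c [C1c c0 c1] <-] lcd] iy.
have r40 : 0 < r / 4 by rewrite divr_gt0.
have xr' : `|x - x0| < r by lra.
have ix := ball_mimg xr'.
have X0 : local_curve i c 0 = x by rewrite /local_curve /= c0 cinvK.
have X1 : local_curve i c 1 = y by rewrite /local_curve /= c1 cinvK.
(* Otherwise let [s1] be the first exit time: before [s1] the curve stays in a
   compact set, which is closed and contained in the chart, hence so is [c s1]. *)
suff cn u : 0 <= u <= 1 -> near_chart (c u).
  have := chart_displacement_le C1c lcd _ cn.
  by rewrite X0 X1; apply; rewrite ltr01 lexx.
move=> u01; apply: contrapT => ncu.
pose A := [set s : R | 0 <= s <= 1 /\ ~ near_chart (c s)].
have A0 : A !=set0 by exists u.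
have Alb : has_lbound A by exists 0 => s [/andP[]].
have hiA : has_inf A by [].
pose s1 := inf A.
have s1_ge0 : 0 <= s1 by apply: lb_le_inf => // s [/andP[]].
have s1_lb s : A s -> s1 <= s by move=> As; exact: ge_inf.
have s1_le1 : s1 <= 1.
  by rewrite (le_trans (s1_lb u _))//; case/andP: u01.
have below s : 0 <= s < s1 -> near_chart (c s).
  move=> /andP[s0 ss1]; apply: contrapT => ncs.
  have : s1 <= s by apply: s1_lb; split=> //; rewrite s0/= (le_trans (ltW ss1)).
  by rewrite leNgt ss1.
have ncs1 : ~ near_chart (c s1).
  move=> ncs1.
  have cc : {for s1, continuous c} by have [] := C1c s1.
  have /nbhs_ballP[e /= e0 He] : \forall s \near s1, near_chart (c s).
    exact: cc (near_chart_open ncs1).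
  have [s As ss1] := inf_adherent e0 hiA.
  have := s1_lb _ As => s1s.
  case: As => _; apply; apply: He.
  by rewrite -ball_normE /ball_/= ltr_norml; move: ss1; rewrite -/s1; lra.
have nc0 : near_chart (c 0).
  by rewrite c0; split; [exact: mdom_cinv|rewrite cinvK].
have s1_gt0 : 0 < s1.
  rewrite lt_neqAle s1_ge0 andbT; apply/eqP => s10.
  by apply: ncs1; rewrite -s10.
(* The curve starts within [r / 2] of [x0] and moves by at most [C * d < r / 4]. *)
have core s : 0 <= s < s1 ->
    (cinv (mchart i) @` [set x | `|x - x0| <= 3 / 4 * r]) (c s).
  move=> ss1; have [ics rcs] := below _ ss1.
  exists (mmap i (c s)); last exact: mmapK.
  rewrite /=; have [->|s0] := eqVneq s 0.
    by rewrite c0 cinvK//; lra.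
  have H : `|local_curve i c s - local_curve i c 0| <= C * d.
    case/andP: ss1 => s_ge0 ss1.
    apply: (chart_displacement_le C1c lcd).
      by rewrite lt_neqAle eq_sym s0 s_ge0/= (le_trans (ltW ss1)).
    move=> w /andP[w0 ws]; apply: below; rewrite w0/=; exact: le_lt_trans ss1.
  have := ler_normD (local_curve i c s - x) (x - x0).
  rewrite subrKA -[local_curve i c s]/(mmap i (c s)); rewrite X0 in H.
  rewrite -[local_curve i c s]/(mmap i (c s)) in H; lra.
have r34 : 3 / 4 * r < r by lra.
have [z zr zs1] : (cinv (mchart i) @` [set x | `|x - x0| <= 3 / 4 * r]) (c s1).
  apply: (closed_core r34) => B.
  have cc : {for s1, continuous c} by have [] := C1c s1.
  move=> nB; have /nbhs_ballP[e /= e0 He] : \forall s \near s1, B (c s).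
    exact: cc nB.
  pose s := Num.max 0 (s1 - e / 2).
  have ss1 : 0 <= s < s1.
    by rewrite le_max lexx/= gt_max s1_gt0/= ltrBlDr ltrDl divr_gt0.
  exists (c s); split; first exact: core.
  apply: He; rewrite -ball_normE /ball_/= gtr0_norm; last by rewrite subr_gt0; case/andP: ss1.
  have : s1 - e / 2 <= s by rewrite le_max lexx orbT.
  lra.
apply: ncs1; rewrite -zs1.
have zr' : `|z - x0| < r by exact: le_lt_trans r34.
have iz := ball_mimg zr'.
by split; [exact: mdom_cinv|rewrite cinvK].
Qed.

End distance_lower_bound.

(** * Levi-Civita connection and curvature in matrix form *)

Section matrix_derivatives.
Variables (R : realType) (V : normedModType R).

Lemma is_derive_mulmx m n p (A : V -> 'M[R]_(m, n)) (B : V -> 'M[R]_(n, p))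
    x v dA dB : is_derive x v A dA -> is_derive x v B dB ->
  is_derive x v (fun y => A y *m B y) (dA *m B x + A x *m dB).
Proof.
move=> hA hB; apply: mx_is_derive => i j.
have H k : is_derive x v (fun y => A y i k * B y k j)
    (dA i k * B x k j + A x i k * dB k j).
  apply: (is_derive_eq (is_deriveM (is_derive_mx i k hA) (is_derive_mx k j hB))).
  rewrite /GRing.scale /=; ring.
have -> : (fun y => (A y *m B y) i j) = \sum_k (fun y => A y i k * B y k j).
  by apply/funext => y; rewrite fct_sumE mxE.
apply: (is_derive_eq (is_derive_sum H)).
by rewrite big_split /= !mxE.
Qed.

Lemma add_mxE m n (A B : 'M[R]_(m, n)) i j : (A + B) i j = A i j + B i j.
Proof. by rewrite mxE. Qed.

Lemma opp_mxE m n (A : 'M[R]_(m, n)) i j : (- A) i j = - A i j.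
Proof. by rewrite mxE. Qed.

Lemma is_derive_trmx m n (A : V -> 'M[R]_(m, n)) x v dA :
  is_derive x v A dA -> is_derive x v (fun y => (A y)^T) dA^T.
Proof.
move=> hA; apply: mx_is_derive => i j; rewrite mxE.
rewrite (_ : (fun y => _) = (fun y => A y j i)); first exact: is_derive_mx.
by apply/funext => y; rewrite mxE.
Qed.

Lemma smooth_is_derive (W : normedModType R) (U : set V) (f : V -> W) x v :
  smooth_on U f -> U x -> is_derive x v f ('D_v f x).
Proof. by move=> sf Ux; apply: derivableP; exact: smooth_on_derivable sf Ux. Qed.

Lemma derive_mxE m n (U : set V) (A : V -> 'M[R]_(m, n)) x v i j :
  smooth_on U A -> U x -> ('D_v A x) i j = 'D_v (fun y => A y i j) x.
Proof.
by move=> sA Ux; rewrite derive_mx ?mxE//; exact: smooth_on_derivable sA Ux.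
Qed.

Lemma derive_open_eq (W : normedModType R) (U : set V) (f g : V -> W) x v :
  open U -> U x -> (forall y, U y -> f y = g y) -> 'D_v f x = 'D_v g x.
Proof.
move=> oU Ux fg; apply: near_eq_derive; near=> y; apply: fg.
by near: y; exact: open_nbhs_nbhs.
Unshelve. all: by end_near. Qed.

Lemma derive_commute_mx m n (U : set V) (A : V -> 'M[R]_(m, n)) u v x :
  open U -> smooth_on U A -> U x ->
  'D_u (fun y => 'D_v A y) x = 'D_v (fun y => 'D_u A y) x.
Proof.
move=> oU sA Ux; apply/matrixP => i j.
have D2 w w' : ('D_w (fun y => 'D_w' A y) x) i j =
    'D_w (fun y => 'D_w' (fun z => A z i j) y) x.
  rewrite (derive_mxE _ _ _ (smooth_on_derive w' sA) Ux).
  by apply: (derive_open_eq _ oU Ux) => y Uy; exact: derive_mxE sA Uy.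
have sAij := (smooth_on_mxP A oU).1 sA i j.
exact: (etrans (D2 u v) (etrans (derive_commute u v oU sAij Ux) (esym (D2 v u)))).
Qed.

End matrix_derivatives.

Section matrix_identities.
Variables (R : realType) (n : nat).
Implicit Types (A B C D G : 'M[R]_n).

(** Six swaps, alternately of the first two and of the last two indices, lead back to [(a, b, c)]
    and collect three signs. *)
Lemma sym_skew_eq0 (S : 'I_n -> 'M[R]_n) : (forall a b c, S a b c = S b a c) ->
  (forall a b c, S a b c = - S a c b) -> forall a, S a = 0.
Proof.
move=> S1 S2 a; apply/matrixP => b c; rewrite [RHS]mxE.
have : S a b c = - S a b c.
  by rewrite {1}(S1 a b) (S2 b a) (S1 b c) (S2 c b) opprK (S1 c a) (S2 a c).
lra.
Qed.

(** The difference of two solutions, with its upper index lowered by [G], has both symmetries of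
    [sym_skew_eq0]. *)
Lemma metric_connection_unique (H C dG : 'I_n -> 'M[R]_n) G :
  G^T = G -> G \in unitmx ->
  (forall a b k, H a b k = H b a k) -> (forall a b k, C a b k = C b a k) ->
  (forall a, dG a = H a *m G + G *m (H a)^T) ->
  (forall a, dG a = C a *m G + G *m (C a)^T) -> forall a, H a = C a.
Proof.
move=> symG unitG Hsym Csym HG CG a.
have S1 b c d : ((H b - C b) *m G) c d = ((H c - C c) *m G) b d.
  rewrite !mxE; apply: eq_bigr => k _.
  by rewrite !(add_mxE, opp_mxE) (Hsym b) (Csym b).
have S2 b c d : ((H b - C b) *m G) c d = - ((H b - C b) *m G) d c.
  have E : (H b - C b) *m G + ((H b - C b) *m G)^T = 0.
    rewrite trmx_mul symG linearB /= mulmxBl mulmxBr addrACA -opprD.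
    by rewrite -HG -CG subrr.
  apply/eqP; rewrite -addr_eq0; have := congr1 (fun A : 'M[R]_n => A c d) E.
  by rewrite add_mxE [_^T _ _]mxE => ->; rewrite mxE.
have S0 := sym_skew_eq0 S1 S2 a.
by apply/subr0_eq; rewrite -(mulmxK unitG (H a - C a)) S0 mul0mx.
Qed.

(** The hypothesis equates the two mixed second derivatives of [G], with [C], [D] the connection
    matrices in directions [b], [a], and [A], [B] their derivatives along [a], [b]. *)
Lemma curvature_skew_algebra A B C D G :
  A *m G + C *m (D *m G + G *m D^T) + ((D *m G + G *m D^T) *m C^T + G *m A^T) =
  B *m G + D *m (C *m G + G *m C^T) + ((C *m G + G *m C^T) *m D^T + G *m B^T) ->
  (A - B + C *m D - D *m C) *m G + G *m (A - B + C *m D - D *m C)^T = 0.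
Proof.
have trD (X Y : 'M[R]_n) : (X + Y)^T = X^T + Y^T by rewrite linearD.
have trN (X : 'M[R]_n) : (- X)^T = - X^T by rewrite linearN.
move/eqP; rewrite -subr_eq0 => /eqP <-.
rewrite !(trD, trN, trmx_mul).
rewrite !(mulmxDl, mulmxDr, mulNmx, mulmxN, mulmxA).
by apply/matrixP => i j; rewrite !(add_mxE, opp_mxE); ring.
Qed.

End matrix_identities.

Section levi_civita.
Variables (R : realType) (V : normedModType R) (n : nat).
Variables (e : 'I_n -> V) (U : set V) (G : V -> 'M[R]_n).
Hypotheses (oU : open U) (sG : smooth_on U G).
Hypothesis symG : forall x, U x -> (G x)^T = G x.
Hypothesis unitG : forall x, U x -> G x \in unitmx.

(** The Christoffel symbols with the space [V] and the directions [e] as parameters: [V] is the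
    chart for a single metric, and spacetime with its space directions for the family, where the
    variation is one more directional derivative. *)
Definition chr (k a b : 'I_n) (x : V) : R :=
  2^-1 * \sum_(l < n) invmx (G x) k l *
    ('D_(e a) (fun y => G y l b) x + 'D_(e b) (fun y => G y a l) x -
     'D_(e l) (fun y => G y a b) x).

(* Row index [b], column index [k], so that [d_a G = C_a G + G C_a^T]. *)
Definition connection (a : 'I_n) (x : V) : 'M[R]_n :=
  \matrix_(b, k) chr k a b x.

(** Twice the Christoffel symbols of the first kind. *)
Let koszul (a : 'I_n) (x : V) : 'M[R]_n := \matrix_(b, l)
  ('D_(e a) (fun y => G y l b) x + 'D_(e b) (fun y => G y a l) x -
   'D_(e l) (fun y => G y a b) x).

Lemma connection_koszul a x : U x ->
  connection a x *m G x = 2^-1 *: koszul a x.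
Proof.
move=> Ux; have -> : connection a x = 2^-1 *: (koszul a x *m invmx (G x)).
  apply/matrixP => b k; rewrite !mxE /chr; congr (_ * _).
  apply: eq_bigr => l _; rewrite !mxE mulrC; congr (_ * _).
  by rewrite -[in LHS](symG Ux) -trmx_inv mxE.
by rewrite -scalemxAl mulmxKV// unitG.
Qed.

Let derive_sym v x b l : U x ->
  'D_v (fun y => G y l b) x = 'D_v (fun y => G y b l) x.
Proof.
move=> Ux; apply: (derive_open_eq _ oU Ux) => y Uy.
by rewrite -[in LHS](symG Uy) mxE.
Qed.

Lemma connection_metric a x : U x ->
  'D_(e a) G x = connection a x *m G x + G x *m (connection a x)^T.
Proof.
move=> Ux; have -> : G x *m (connection a x)^T = (connection a x *m G x)^T.
  by rewrite trmx_mul symG.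
rewrite connection_koszul//; apply/matrixP => b l.
rewrite (derive_mxE _ _ _ sG Ux) !mxE (derive_sym _ b a Ux) (derive_sym _ l a Ux).
rewrite (derive_sym _ b l Ux).
by field.
Qed.

Lemma connection_sym a b k x : U x -> connection a x b k = connection b x a k.
Proof.
move=> Ux; rewrite !mxE /chr; congr (_ * _); apply: eq_bigr => l _; congr (_ * _).
rewrite (derive_sym (e a) b l Ux) (derive_sym (e b) a l Ux) (derive_sym _ b a Ux).
ring.
Qed.

Lemma connection_unique (H : 'I_n -> 'M[R]_n) x : U x ->
  (forall a b k, H a b k = H b a k) ->
  (forall a, 'D_(e a) G x = H a *m G x + G x *m (H a)^T) ->
  forall a, H a = connection a x.
Proof.
move=> Ux Hsym HG; apply: (metric_connection_unique (symG Ux) (unitG Ux) Hsym).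
- by move=> a b k; exact: connection_sym.
- exact: HG.
- by move=> a; exact: connection_metric.
Qed.

Lemma chr_smooth k a b : smooth_on U (chr k a b).
Proof.
have sGij := (smooth_on_mxP G oU).1 sG.
apply: smooth_on_mul => //; first exact: smooth_on_cst.
apply: smooth_on_sum => // l; apply: smooth_on_mul => //.
  by apply: (smooth_on_mxP (fun x => invmx (G x)) oU).1; exact: smooth_on_invmx.
apply: smooth_on_sub_fun => //; last exact: smooth_on_derive.
by apply: smooth_on_add => //; exact: smooth_on_derive.
Qed.

Lemma connection_smooth a : smooth_on U (connection a).
Proof.
apply/smooth_on_mxP => // b k; apply: smooth_on_eq (chr_smooth k a b) => // x _.
by rewrite mxE.
Qed.

(** The entry [(c, l)] is [R^l_abc]. The products stand in reverse order because the lower index of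
    [connection] is the row. *)
Definition curvmx (a b : 'I_n) (x : V) : 'M[R]_n :=
  'D_(e a) (connection b) x - 'D_(e b) (connection a) x +
  connection b x *m connection a x - connection a x *m connection b x.

Lemma curvmx_smooth a b : smooth_on U (curvmx a b).
Proof.
have sC := connection_smooth.
apply: smooth_on_sub_fun => //; last exact: smooth_on_mulmx.
apply: smooth_on_add => //; last exact: smooth_on_mulmx.
by apply: smooth_on_sub_fun => //; exact: smooth_on_derive.
Qed.

Lemma curvmx_skew a b x : U x ->
  curvmx a b x *m G x + G x *m (curvmx a b x)^T = 0.
Proof.
move=> Ux; have sC := connection_smooth.
have D2 c d : 'D_(e c) (fun y => 'D_(e d) G y) x =
  ('D_(e c) (connection d) x *m G x +
   connection d x *m (connection c x *m G x + G x *m (connection c x)^T)) +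
  ((connection c x *m G x + G x *m (connection c x)^T) *m (connection d x)^T +
   G x *m ('D_(e c) (connection d) x)^T).
  rewrite (derive_open_eq (e c) oU Ux (fun y Uy => connection_metric d Uy)).
  have dC := smooth_is_derive (e c) (sC d) Ux.
  have dG := smooth_is_derive (e c) sG Ux.
  rewrite (connection_metric c Ux) in dG.
  have := is_deriveD (is_derive_mulmx dC dG) (is_derive_mulmx dG (is_derive_trmx dC)).
  by move=> [_].
apply: curvature_skew_algebra.
have DD := derive_commute_mx (e a) (e b) oU sG Ux.
exact: (etrans (esym (D2 a b)) (etrans DD (D2 b a))).
Qed.

End levi_civita.

(** * Chart invariance of the Gaussian curvature *)

Section two_by_two.
Variable R : realType.
Implicit Types (A F G : 'M[R]_2).

Lemma sum_ord2 (W : nmodType) (f : 'I_2 -> W) : \sum_(i < 2) f i = f 0 + f 1.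
Proof. by rewrite big_ord_recl big_ord_recl big_ord0 addr0; congr (_ + f _); apply/val_inj. Qed.

Lemma forall_ord2 (P : 'I_2 -> Prop) : P 0 -> P 1 -> forall i, P i.
Proof.
by move=> P0 P1 [[|[|//]] Hi]; [move: P0|move: P1]; congr P; apply/val_inj.
Qed.

Lemma matrix2P A F : A 0 0 = F 0 0 -> A 0 1 = F 0 1 -> A 1 0 = F 1 0 ->
  A 1 1 = F 1 1 -> A = F.
Proof.
by move=> *; apply/matrixP; do 2![apply: forall_ord2].
Qed.

Lemma det2 A : \det A = A 0 0 * A 1 1 - A 0 1 * A 1 0.
Proof.
rewrite (expand_det_row A 0) sum_ord2 /cofactor !det_mx11 !mxE /=.
rewrite expr0 expr1 mul1r mulN1r mulrN; congr (_ * A _ _ - _ * A _ _);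
  exact/val_inj.
Qed.

Definition rot2 : 'M[R]_2 := \matrix_(i, j) ((i : nat)%:R - (j : nat)%:R).

Lemma rot2E : [/\ rot2 0 0 = 0, rot2 0 1 = - 1, rot2 1 0 = 1 & rot2 1 1 = 0].
Proof. by rewrite !mxE /= modn_small//; split; ring. Qed.

Lemma rot2_congr A : A^T *m rot2 *m A = \det A *: rot2.
Proof.
have [r00 r01 r10 r11] := rot2E.
by rewrite det2; apply: matrix2P; rewrite !(mxE, sum_ord2) -/rot2 ?r00 ?r01 ?r10 ?r11; ring.
Qed.

Lemma det_rot2 : \det rot2 = 1.
Proof. by have [r00 r01 r10 r11] := rot2E; rewrite det2 r00 r01 r10 r11; ring. Qed.

(** [F *m G] is skew, hence in dimension two a multiple of [rot2]; and
    [G *m rot2 *m G = \det G *: rot2] rewrites [rot2 *m invmx G] as a multiple of [G *m rot2]. *)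
Lemma skew_curvature_form F G : G^T = G -> G \in unitmx ->
  F *m G + G *m F^T = 0 ->
  F = ((F *m G) 1 0 / \det G) *: (G *m rot2).
Proof.
move=> symG unitG skew; set c := (F *m G) 1 0.
have [r00 r01 r10 r11] := rot2E.
have FG : F *m G = c *: rot2.
  have E i j : (F *m G) i j = - (F *m G) j i.
    apply/eqP; rewrite -addr_eq0.
    have := congr1 (fun X : 'M[R]_2 => X i j) skew; rewrite add_mxE.
    rewrite (_ : G *m F^T = (F *m G)^T); last by rewrite trmx_mul symG.
    by rewrite [_^T _ _]mxE => ->; rewrite mxE.
  have E0 i : (F *m G) i i = 0 by have := E i i; lra.
  apply: matrix2P; rewrite [RHS]mxE ?r00 ?r01 ?r10 ?r11 ?mulr0 ?mulr1 ?E0//.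
  by rewrite E mulrN1.
have GJG : G *m rot2 *m G = \det G *: rot2 by rewrite -rot2_congr symG.
have dG : \det G != 0 by rewrite -unitfE -unitmxE.
have -> : F = c *: rot2 *m invmx G by rewrite -FG mulmxK.
by rewrite -[G *m rot2](mulmxK unitG) GJG -!scalemxAl !scalerA divfK.
Qed.

(** After substitution for [G], the factor [\det A] that [rot2_congr] produces on the left matches
    the one on the right; what remains is [k - k'] times an invertible matrix. *)
Lemma gauge_curvature_invariant A F F' G G' k k' :
  F *m A = A *m (\det A *: F') -> F = k *: (G *m rot2) ->
  F' = k' *: (G' *m rot2) -> G = A *m G' *m A^T -> G \in unitmx -> k = k'.
Proof.
move=> FA Fe F'e GA unitG; rewrite Fe F'e in FA.
have : \det G != 0 by rewrite -unitfE -unitmxE.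
rewrite GA !det_mulmx det_tr mulf_eq0 negb_or => /andP[dAG dA].
have [_ dG'] : \det A != 0 /\ \det G' != 0 by move: dAG; rewrite mulf_eq0 negb_or => /andP.
have : ((k - k') * \det A) *: (A *m G' *m rot2) = 0.
  rewrite mulrBl scalerBl; apply/eqP; rewrite subr_eq0; apply/eqP.
  move: FA; rewrite GA -!scalemxAl -!mulmxA [A^T *m _]mulmxA rot2_congr.
  by rewrite -!scalemxAr !scalerA [\det A * k']mulrC.
move/eqP; rewrite scaler_eq0 => /orP[|/eqP M0].
  by rewrite mulf_eq0 (negbTE dA) orbF subr_eq0 => /eqP.
have : \det (A *m G' *m rot2) != 0.
  by rewrite !det_mulmx det_rot2 mulr1 mulf_neq0.
by rewrite M0 det0 eqxx.
Qed.

(** Curvature is a two-form, so pulling it back multiplies it by the Jacobian determinant. [X] and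
    [P] stand for the derivatives of the connection and of the Jacobian matrix; the latter drop out
    by symmetry. *)
Lemma pullback_curvature A (S : 'I_2 -> 'M[R]_2) (X : 'I_2 -> 'I_2 -> 'M[R]_2)
    (P : 'I_2 -> 'I_2 -> 'I_2 -> R)
    (B := fun a => \sum_d A a d *: S d)
    (Y := fun a b => \sum_d (P a b d *: S d + A b d *: \sum_e A a e *: X e d)) :
  (forall d, P 0 1 d = P 1 0 d) ->
  Y 0 1 - Y 1 0 + B 1 *m B 0 - B 0 *m B 1 =
  \det A *: (X 0 1 - X 1 0 + S 1 *m S 0 - S 0 *m S 1).
Proof.
move=> Psym; rewrite /Y /B det2 !sum_ord2 !Psym.
rewrite !(mulmxDl, mulmxDr) -!(scalemxAl, scalemxAr).
have sc (c : R) (Z : 'M[R]_2) i j : (c *: Z) i j = c * Z i j by rewrite mxE.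
by apply/matrixP => i j; rewrite !(add_mxE, opp_mxE, sc); ring.
Qed.

End two_by_two.

(** The hypothesis equates the mixed second derivatives of a matrix [A] that satisfies
    [d_a A = C_a A - A T_a]; [X] and [Y] are the derivatives of [C] and [T]. *)
Lemma gauge_algebra (R : realType) n (A Ca Cb Ta Tb Xab Xba Yab Yba : 'M[R]_n) :
  Xab *m A + Cb *m (Ca *m A - A *m Ta) - ((Ca *m A - A *m Ta) *m Tb + A *m Yab) =
  Xba *m A + Ca *m (Cb *m A - A *m Tb) - ((Cb *m A - A *m Tb) *m Ta + A *m Yba) ->
  (Xab - Xba + Cb *m Ca - Ca *m Cb) *m A =
  A *m (Yab - Yba + Tb *m Ta - Ta *m Tb).
Proof.
move=> H; apply/eqP; rewrite -subr_eq0; move/eqP: H; rewrite -subr_eq0 => /eqP <-.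
apply/eqP; rewrite !(mulmxDl, mulmxDr, mulNmx, mulmxN, mulmxA).
by apply/matrixP => i j; rewrite !(add_mxE, opp_mxE); ring.
Qed.

Lemma pullback_connection_sym (R : realType) n (A : 'M[R]_n)
    (S : 'I_n -> 'M[R]_n) a b k : (forall c d l, S c d l = S d c l) ->
  (A *m \sum_d A a d *: S d) b k = (A *m \sum_d A b d *: S d) a k.
Proof.
move=> Ssym; have E a' b' : (A *m \sum_d A a' d *: S d) b' k =
    \sum_c \sum_d A b' c * (A a' d * S d c k).
  rewrite mxE; apply: eq_bigr => c _; rewrite summxE mulr_sumr.
  by apply: eq_bigr => d _; rewrite mxE.
rewrite !E exchange_big /=; apply: eq_bigr => c _; apply: eq_bigr => d _.
by rewrite (Ssym c d) mulrCA.
Qed.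

(** * Connection and curvature under a change of charts *)

Section gauge.
Variables (R : realType).

Lemma smooth_differentiable n p q (U : set 'rV[R]_n) (f : 'rV[R]_n -> 'M[R]_(p, q)) x :
  open U -> smooth_on U f -> U x -> differentiable f x.
Proof.
move=> oU sf Ux.
have -> : f = \sum_i \sum_j (fun y => f y i j *: delta_mx i j).
  apply/funext => y; rewrite fct_sumE [LHS]matrix_sum_delta.
  by apply: eq_bigr => i _; rewrite fct_sumE.
apply: differentiable_sum => i; apply: differentiable_sum => j.
apply: differentiableZl; apply: (C1_differentiable oU) => //.
exact: (smooth_on_mxP f oU).1.
Qed.

Lemma is_derive_scale_mx (V : normedModType R) m n (k : V -> R)
    (A : V -> 'M[R]_(m, n)) x v dk dA :
  is_derive x v k dk -> is_derive x v A dA ->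
  is_derive x v (fun y => k y *: A y) (dk *: A x + k x *: dA).
Proof.
move=> hk hA; apply: mx_is_derive => i j.
have -> : (fun y => (k y *: A y) i j) = (k * (fun y => A y i j)).
  by apply/funext => y; rewrite mxE.
apply: (is_derive_eq (is_deriveM hk (is_derive_mx i j hA))).
rewrite !mxE /GRing.scale /=; ring.
Qed.

Variables (M : smoothManifold R 2) (g : metric M) (i j : chart_index M).
Let e (a : 'I_2) : 'rV[R]_2 := delta_mx 0 a.
Let tau := transition (mchart i) (mchart j).
Let O : set 'rV[R]_2 := overlap i j.
Let Gi := gmx g i.
Let Gj := gmx g j.
Let A (x : 'rV[R]_2) : 'M[R]_2 := \matrix_(a, b) ('D_(e a) tau x) 0 b.

Lemma gmx_unit (k : chart_index M) x : mimg k x -> gmx g k x \in unitmx.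
Proof.
move=> kx; rewrite -row_free_unit -kermx_eq0; apply/contraT => /rowV0Pn[v].
move=> /sub_kermxP vG v0; have := gmx_pos g kx v0.
by rewrite vG mul0mx mxE ltxx.
Qed.

Let oO : open O. Proof. exact: overlap_open. Qed.

Let tauj x : O x -> mimg j (tau x).
Proof. by case=> p [ip jp] <-; rewrite /tau /transition /= cmapK//; exists p. Qed.

Let Oi x : O x -> mimg i x. Proof. by move=> /overlapE[]. Qed.

Let stau : smooth_on O tau. Proof. exact: transition_smooth. Qed.

Let sA : smooth_on O A.
Proof.
apply/smooth_on_mxP => // a b.
have H := (smooth_on_mxP (fun x => 'D_(e a) tau x) oO).1 (smooth_on_derive _ stau).
by apply: smooth_on_eq (H 0 b) => // x _; rewrite mxE.
Qed.

Let GA x : O x -> Gi x = A x *m Gj (tau x) *m (A x)^T.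
Proof.
move=> [p [ip jp] <-]; have := @gmx_transition _ _ _ g i j p; rewrite /= -/tau => T.
have taup : tau (mmap i p) = mmap j p by rewrite /tau /transition /= cmapK.
have ent (X : 'M[R]_2) a b : (e a *m X *m (e b)^T) 0 0 = X a b.
  by rewrite trmx_delta -colE -rowE !mxE.
apply/matrixP => a b; rewrite -[LHS]ent (T _ _ ip jp) -[RHS]ent taup.
have rowA c : 'D_(e c) tau (mmap i p) = e c *m A (mmap i p).
  by rewrite -rowE; apply/rowP => d; rewrite !mxE.
by rewrite !rowA trmx_mul !mulmxA.
Qed.

Let unitA x : O x -> A x \in unitmx.
Proof.
move=> Ox; have := gmx_unit (Oi Ox); rewrite -/Gi GA// !unitmx_mul.
by case/andP => /andP[].
Qed.

Let comp_tau p q (f : 'rV[R]_2 -> 'M[R]_(p, q)) a x : smooth_on (mimg j) f ->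
  O x -> is_derive x (e a) (fun y => f (tau y)) (\sum_d A x a d *: 'D_(e d) f (tau x)).
Proof.
move=> sf Ox; have dtau : derivable tau x (e a) := smooth_on_derivable stau Ox.
have df := smooth_differentiable (@mimg_open _ _ _ j) sf (tauj Ox).
apply: (is_derive_eq (is_derive_comp dtau df)).
by rewrite derive_sum_delta//; apply: eq_bigr => d _; rewrite mxE.
Qed.

Let Ci a := connection e Gi a.
Let Cj a := connection e Gj a.
Let sCi a : smooth_on (mimg i) (Ci a).
Proof.
apply: connection_smooth; [exact: mimg_open|exact: gmx_smooth|exact: gmx_unit].
Qed.
Let sCj a : smooth_on (mimg j) (Cj a).
Proof.
apply: connection_smooth; [exact: mimg_open|exact: gmx_smooth|exact: gmx_unit].
Qed.

Let B a x := \sum_d A x a d *: Cj d (tau x).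

Let derive_A_entry a b k x : O x ->
  ('D_(e a) A x) b k = ('D_(e a) (fun y => 'D_(e b) tau y) x) 0 k.
Proof.
move=> Ox; rewrite (derive_mxE _ _ _ sA Ox).
rewrite (derive_mxE _ _ _ (smooth_on_derive _ stau) Ox).
suff -> : (fun y => A y b k) = (fun y => ('D_(e b) tau y) 0 k) by [].
by apply/funext => y; rewrite mxE.
Qed.

Let derive_A_sym a b k x : O x -> ('D_(e a) A x) b k = ('D_(e b) A x) a k.
Proof.
move=> Ox; have := derive_commute_mx (e a) (e b) oO stau Ox.
move=> /(congr1 (fun v : 'rV[R]_2 => v 0 k)) DD.
exact: (etrans (derive_A_entry a b k Ox)
                (etrans DD (esym (derive_A_entry b a k Ox)))).
Qed.

Let Cj_sym c d l x : O x -> Cj c (tau x) d l = Cj d (tau x) c l.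
Proof.
move=> Ox; apply: (@connection_sym _ _ _ _ (mimg j)).
- exact: mimg_open.
- by move=> y; exact: gmx_sym.
- exact: tauj.
Qed.

Let derive_G_pullback a x : O x -> 'D_(e a) (fun y => Gj (tau y)) x =
  B a x *m Gj (tau x) + Gj (tau x) *m (B a x)^T.
Proof.
move=> Ox; have [_ ->] := comp_tau a (@gmx_smooth _ _ _ g j) Ox.
rewrite /B mulmx_suml linear_sum /= mulmx_sumr -big_split /=.
apply: eq_bigr => d _; rewrite linearZ /= -scalemxAl -scalemxAr -scalerDr.
congr (_ *: _); apply: (@connection_metric _ _ _ _ (mimg j)).
- exact: mimg_open.
- exact: gmx_smooth.
- by move=> y; exact: gmx_sym.
- exact: gmx_unit.
- exact: tauj.
Qed.

(** The transformation law of the Christoffel symbols, deduced from uniqueness: the candidate [H] is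
    symmetric because second derivatives of [tau] commute, and metric by differentiating [GA]. *)
Let derive_A a x : O x -> 'D_(e a) A x = Ci a x *m A x - A x *m B a x.
Proof.
move=> Ox; apply/eqP; rewrite eq_sym subr_eq; apply/eqP.
pose H b := ('D_(e b) A x + A x *m B b x) *m invmx (A x).
suff <- : H a = Ci a x by rewrite /H mulmxKV// unitA.
apply: (@connection_unique _ _ _ _ (mimg i)) => //.
- exact: mimg_open.
- exact: gmx_smooth.
- by move=> y; exact: gmx_sym.
- exact: gmx_unit.
- exact: Oi.
- move=> b c k; rewrite /H [LHS]mxE [RHS]mxE; apply: eq_bigr => l _.
  apply: (congr1 (fun z => z * _)); rewrite [LHS]add_mxE [RHS]add_mxE.
  have Csym c' d l' : Cj c' (tau x) d l' = Cj d (tau x) c' l' by exact: Cj_sym.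
  exact: (f_equal2 +%R (derive_A_sym b c l Ox)
            (pullback_connection_sym (A x) b c l Csym)).
- move=> b; rewrite (derive_open_eq _ oO Ox GA).
  have dA := smooth_is_derive (e b) sA Ox.
  have dG := comp_tau b (@gmx_smooth _ _ _ g j) Ox.
  have [_ ->] := is_derive_mulmx (is_derive_mulmx dA dG) (is_derive_trmx dA).
  have [_ <-] := dG; rewrite derive_G_pullback//.
  have -> : Gi x *m (H b)^T = (H b *m Gi x)^T.
    by rewrite [RHS]trmx_mul [(Gi x)^T](gmx_sym g (Oi Ox)).
  have -> : H b *m Gi x = ('D_(e b) A x + A x *m B b x) *m Gj (tau x) *m (A x)^T.
    by rewrite GA// /H !mulmxA mulmxKV ?unitA.
  rewrite !trmx_mul trmxK [(Gj _)^T](gmx_sym g (tauj Ox)).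
  rewrite [(_ + _)^T]linearD /= [(A x *m B b x)^T]trmx_mul.
  by rewrite !(mulmxDl, mulmxDr, mulmxA) -!addrA; congr (_ + (_ + _)); rewrite addrC.
Qed.

(** The integrability condition of the equations [derive_A] for the Jacobian matrix, with the
    curvature of the pulled-back connection computed by [pullback_curvature]. *)
Lemma curvature_gauge x : O x -> curvmx e Gi 0 1 x *m A x =
  A x *m (\det (A x) *: curvmx e Gj 0 1 (tau x)).
Proof.
move=> Ox.
have dB a b : is_derive x (e a) (B b) (\sum_d (('D_(e a) A x) b d *: Cj d (tau x)
    + A x b d *: \sum_c A x a c *: 'D_(e c) (Cj d) (tau x))).
  have -> : B b = \sum_d (fun y => A y b d *: Cj d (tau y)).
    by apply/funext => y; rewrite fct_sumE.
  apply: is_derive_sum => d; apply: is_derive_scale_mx.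
    by apply: is_derive_mx; exact: smooth_is_derive sA Ox.
  exact: comp_tau.
have D2 a b : 'D_(e a) (fun y => 'D_(e b) A y) x =
    'D_(e a) (Ci b) x *m A x + Ci b x *m (Ci a x *m A x - A x *m B a x) -
    ((Ci a x *m A x - A x *m B a x) *m B b x + A x *m 'D_(e a) (B b) x).
  rewrite (derive_open_eq (e a) oO Ox (derive_A b)).
  have dA := smooth_is_derive (e a) sA Ox; rewrite (derive_A a Ox) in dA.
  have dC := smooth_is_derive (e a) (sCi b) (Oi Ox).
  have dBx : is_derive x (e a) (B b) ('D_(e a) (B b) x).
    by apply: derivableP; case: (dB a b).
  by have [_] := is_deriveB (is_derive_mulmx dC dA) (is_derive_mulmx dA dBx).
have DD := derive_commute_mx (e 0) (e 1) oO sA Ox.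
have GAUGE := gauge_algebra (etrans (esym (D2 0 1)) (etrans DD (D2 1 0))).
have [_ E01] := dB 0 1; have [_ E10] := dB 1 0.
have EY := f_equal2 (fun Y Z => Y - Z + B 1 x *m B 0 x - B 0 x *m B 1 x) E01 E10.
have PC := @pullback_curvature _ (A x) (fun d => Cj d (tau x))
  (fun c d => 'D_(e c) (Cj d) (tau x)) (fun a b d => ('D_(e a) A x) b d)
  (fun d => derive_A_sym 0 1 d Ox).
exact: (etrans GAUGE (congr1 (mulmx (A x)) (etrans EY PC))).
Qed.

Let curvature_form (k : chart_index M) x : mimg k x ->
  curvmx e (gmx g k) 0 1 x =
  ((curvmx e (gmx g k) 0 1 x *m gmx g k x) 1 0 / \det (gmx g k x)) *:
  (gmx g k x *m rot2 R).
Proof.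
move=> kx; apply: skew_curvature_form.
- exact: gmx_sym.
- exact: gmx_unit.
- apply: (@curvmx_skew _ _ _ _ (mimg k)) => //.
  + exact: mimg_open.
  + exact: gmx_smooth.
  + by move=> y; exact: gmx_sym.
  + exact: gmx_unit.
Qed.

Lemma curvature_invariant p : mdom i p -> mdom j p ->
  (curvmx e Gi 0 1 (mmap i p) *m Gi (mmap i p)) 1 0 / \det (Gi (mmap i p)) =
  (curvmx e Gj 0 1 (mmap j p) *m Gj (mmap j p)) 1 0 / \det (Gj (mmap j p)).
Proof.
move=> ip jp; set x := mmap i p; have Ox : O x by exists p.
have taux : tau x = mmap j p by rewrite /tau /transition /= cmapK.
rewrite -taux; apply: (gauge_curvature_invariant (curvature_gauge Ox)).
- exact: curvature_form (Oi Ox).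
- exact: curvature_form (tauj Ox).
- exact: GA.
- exact: gmx_unit (Oi Ox).
Qed.

End gauge.

(** * Perturbation of the geodesic flow *)

(** Unlike [between_MVT_le], this stays on the segment: between a time [s] and 1, the ball of radius
    [|1 - s|] about [s] could leave the interval of existence of the flow. *)
Lemma segment_MVT_le (R : realType) (f df : R -> R) (a b B : R) :
  (forall s, Num.min a b <= s <= Num.max a b -> is_derive s 1 f (df s)) ->
  (forall s, Num.min a b <= s <= Num.max a b -> `|df s| <= B) ->
  `|f b - f a| <= B * `|b - a|.
Proof.
wlog ab : a b / a <= b => [H dfs dfB|dfs dfB].
  have [/H|/ltW ba] := leP a b; first exact.
  by rewrite distrC (distrC b); apply: H => // s;
     rewrite minC maxC; [exact: dfs|exact: dfB].
move: dfs dfB; rewrite min_l// max_r// => dfs dfB.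
have [||s sab ->] := @MVT_segment _ f df a b ab.
- by move=> s /subset_itv_oo_cc; rewrite in_itv; exact: dfs.
- by apply: derivable_within_continuous => s; rewrite in_itv => /dfs; case.
by rewrite normrM ler_wpM2r// dfB//; move: sab; rewrite in_itv.
Qed.

Section perturbed_flow.
Variables (R : realType) (n : nat).
Local Notation V := 'M[R]_(2, n).
Variables (Q dQ : 'I_n -> R^o * V -> R) (y0 : V) (r1 : R).
Hypotheses (r1_gt0 : 0 < r1).
Hypothesis loclip_Q : forall k, loclip (Q k) ((0 : R^o), y0).
Hypothesis loclip_dQ : forall k, loclip (dQ k) ((0 : R^o), y0).
Hypothesis derive_Q : forall k (t : R) y, `|t| < r1 -> `|y - y0| < r1 ->
  is_derive t 1 (fun s : R => Q k (s, y)) (dQ k (t, y)).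

(* A point of the phase space is a matrix whose row 0 is the position and whose
   row 1 is the velocity; [z.1] is the parameter of the family of equations. *)
Definition flow_field (z : R^o * V) : V :=
  \matrix_(a, k) if a == 0 then z.2 1 k else Q k z.

Let pair_dist_lt (t r : R) (y : V) : `|t| < r -> `|y - y0| < r ->
  `|((t : R^o), y) - ((0 : R^o), y0)| < r.
Proof. by move=> tr yr; rewrite [`|_|]/(Num.max _ _) gt_max/= subr0 tr. Qed.

Let pair_dist_le (t t' : R) (y y' : V) :
  `|((t : R^o), y) - ((t' : R^o), y')| <= `|t - t'| + `|y - y'|.
Proof. by rewrite [`|_|]/(Num.max _ _) ge_max/= lerDl lerDr !normr_ge0. Qed.

Lemma loclip_flow_field : loclip flow_field ((0 : R^o), y0).
Proof.
apply: loclip_mx => a k; have [a0|a0] := eqVneq a 0.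
  rewrite (_ : (fun z => _) = (fun z : R^o * V => z.2 1 k)); last first.
    by apply/funext => z; rewrite mxE a0 eqxx.
  apply: loclip_le => -[t y] [t' y'] /=.
  rewrite (_ : y 1 k - y' 1 k = (y - y') 1 k); last by rewrite !mxE.
  by rewrite (le_trans (norm_mx_ge _ _ _))// le_max lexx orbT.
rewrite (_ : (fun z => _) = Q k) //.
by apply/funext => z; rewrite mxE (negbTE a0).
Qed.

(* Multiplying the field by [l] amounts to following the flow up to time [l]
   instead of [1]. *)
Lemma perturbed_flow (v := row 1 y0) (dx := fun k => dQ k ((0 : R^o), y0)) :
  exists K l0 r : R, [/\ 0 < K, 0 < l0 & 0 < r] /\
  forall l : R, 0 < l <= l0 -> exists y : R -> R -> V,
  [/\ forall t, `|t| < r -> y t 0 = y0,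
      forall t s : R, `|t| < r -> `|s| < 2 ->
        is_derive s 1 (y t) (l *: flow_field ((t : R^o), y t s)),
      forall t s : R, `|t| < r -> `|s| < 2 -> `|y t s - y0| <= l * K,
      forall t k, `|t| < r ->
        `|y t 1 0 k - y 0 1 0 k - l ^+ 2 * t / 2 * dx k| <=
        l ^+ 2 * `|t| * K * (`|t| + l) &
      forall (s : R) k, `|s| < 2 ->
        `|y 0 1 0 k - y 0 s 0 k - l * (1 - s) * v 0 k| <=
        l ^+ 2 * K * `|1 - s|].
Proof.
have [L [rL [L0 rL0 HL]]] := loclip_flow_field.
have [L' [rL' [L'0 rL'0 HL']]] : loclip (fun z => \row_k dQ k z) ((0 : R^o), y0).
  apply: loclip_mx => a k.
  by rewrite (_ : (fun z => _) = dQ k)//; apply/funext => z; rewrite mxE.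
pose r := Num.min r1 (Num.min rL rL').
have r0 : 0 < r by rewrite !lt_min r1_gt0 rL0.
have rP s : s < r -> [/\ s < r1, s < rL & s < rL'].
  by rewrite !lt_min => /andP[-> /andP[-> ->]].
pose B := `|flow_field ((0 : R^o), y0)| + L * r.
have B0 : 0 < B by rewrite ltr_wpDl// mulr_gt0.
have zz : `|((0 : R^o), y0) - ((0 : R^o), y0)| < rL by rewrite subrr normr0.
have Lip (t t' : R) y y' : `|t| < r -> `|y - y0| < r -> `|t'| < r -> `|y' - y0| < r ->
    `|flow_field ((t : R^o), y) - flow_field ((t' : R^o), y')| <=
    L * (`|t - t'| + `|y - y'|).
  move=> /rP[_ tr _] /rP[_ yr _] /rP[_ t'r _] /rP[_ y'r _].
  rewrite (le_trans (HL _ _ (pair_dist_lt tr yr) (pair_dist_lt t'r y'r)))//.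
  by rewrite ler_wpM2l ?(ltW L0).
have Bound (t : R) y : `|t| < r -> `|y - y0| < r -> `|flow_field ((t : R^o), y)| <= B.
  move=> tr yr; have /rP[_ trL _] := tr; have /rP[_ yrL _] := yr.
  rewrite -[flow_field _](subrK (flow_field ((0 : R^o), y0))).
  rewrite (le_trans (ler_normD _ _))// addrC lerD//.
  rewrite (le_trans (HL _ _ (pair_dist_lt trL yrL) zz))// ler_wpM2l ?(ltW L0)//.
  by rewrite ltW// pair_dist_lt.
pose rho := r / 2; have rho0 : 0 < rho by rewrite divr_gt0.
have rho_r : rho < r by rewrite /rho; lra.
(* Precomposing with the clamping [cl] makes the field globally Lipschitz, and
   solutions do not leave the region where [cl] is the identity. *)
pose cl (y : V) : V := \matrix_(a, b) clamp (y0 a b) rho (y a b).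
have cl_le y : `|cl y - y0| <= rho.
  apply: norm_mx_le => [|a b]; first exact: ltW.
  by rewrite !mxE clamp_dist_le// ltW.
have cl_lip y y' : `|cl y - cl y'| <= `|y - y'|.
  apply: norm_mx_le => // a b; rewrite !mxE (le_trans (clamp_lipschitz _ _ _ _))//.
  by have := norm_mx_ge (y - y') a b; rewrite !mxE.
have cl_id y : `|y - y0| <= rho -> cl y = y.
  move=> yr; apply/matrixP => a b; rewrite mxE clamp_id// (le_trans _ yr)//.
  by have := norm_mx_ge (y - y0) a b; rewrite !mxE.
have cl_r y : `|cl y - y0| < r by exact: le_lt_trans (cl_le y) rho_r.
(* A sum that dominates the constants of all the estimates below. *)
pose K := L' + 2 * B + L' * B * 2 + 2 * L ^+ 2 + 1.
have K0 : 0 < K by rewrite /K !addr_gt0 ?mulr_gt0 ?exprn_gt0.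
(* The first bound gives the scaled field the Lipschitz constant 1/4 of [picard]; the second keeps
   the solutions within [rho] of [y0] for times below 2. *)
pose l0 := Num.min (1 / (4 * L)) (rho / (2 * B)).
have l00 : 0 < l0 by rewrite lt_min !divr_gt0 ?mulr_gt0.
exists K, l0, r; split=> // l /andP[l_gt0]; rewrite le_min => /andP[lL lB].
rewrite ler_pdivlMr ?mulr_gt0// in lL; rewrite ler_pdivlMr ?mulr_gt0// in lB.
pose F (t : R) (y : V) := l *: flow_field ((t : R^o), cl y).
have r00 : `|0 : R| < r by rewrite normr0.
have Flip t y y' : `|t| < r -> `|F t y - F t y'| <= 4^-1 * `|y - y'|.
  move=> tr; rewrite -scalerBr normrZ gtr0_norm//.
  apply: (@le_trans _ _ (l * (L * `|y - y'|))).
    rewrite ler_wpM2l ?(ltW l_gt0)// (le_trans (Lip _ _ _ _ tr (cl_r y) tr (cl_r y')))//.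
    by rewrite subrr normr0 add0r ler_wpM2l ?(ltW L0).
  by rewrite mulrA ler_wpM2r//; lra.
have exy t : exists y : R -> V, `|t| < r -> y 0 = y0 /\
    forall s : R, `|s| < 2 -> is_derive s 1 y (F t (y s)).
  have [tr|tr] := boolP (`|t| < r); last by exists (fun=> 0).
  have [y [yE dy]] := @picard _ _ _ (F t) y0 (fun a b => Flip t a b tr).
  by exists y.
have [y Hy] := choice exy.
have y0E t : `|t| < r -> y t 0 = y0 by move=> /(Hy t)[].
have dy t (s : R) : `|t| < r -> `|s| < 2 -> is_derive s 1 (y t) (F t (y t s)).
  by move=> /(Hy t)[_]; exact.
have FB t z : `|t| < r -> `|F t z| <= l * B.
  by move=> tr; rewrite normrZ gtr0_norm// ler_wpM2l ?(ltW l_gt0)// Bound.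
have lB0 : 0 <= l * B by rewrite mulr_ge0 ?ltW.
have y_le t (s : R) : `|t| < r -> `|s| < 2 -> `|y t s - y0| <= l * B * `|s|.
  move=> tr s2; have := @mx_MVT_le _ _ _ (y t) (fun s => F t (y t s)) 0 s _ lB0.
  rewrite y0E// subr0; apply=> u; rewrite subr0 => us; last exact: FB.
  by apply: dy => //; exact: le_lt_trans s2.
have y_le2 t (s : R) : `|t| < r -> `|s| < 2 -> `|y t s - y0| <= l * (2 * B).
  move=> tr s2; rewrite (le_trans (y_le t s tr s2))// -mulrA.
  by rewrite ler_wpM2l ?(ltW l_gt0)// mulrC ler_wpM2r ?(ltW B0)// ltW.
have y_rho t (s : R) : `|t| < r -> `|s| < 2 -> `|y t s - y0| <= rho.
  by move=> tr s2; rewrite (le_trans (y_le2 t s tr s2)).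
have y_r t (s : R) : `|t| < r -> `|s| < 2 -> `|y t s - y0| < r.
  by move=> tr s2; rewrite (le_lt_trans (y_rho t s tr s2)).
have dy' t (s : R) : `|t| < r -> `|s| < 2 ->
    is_derive s 1 (y t) (l *: flow_field ((t : R^o), y t s)).
  by move=> tr s2; have := dy t s tr s2; rewrite /F cl_id//; exact: y_rho.
have le1lt2 (s : R) : `|s| <= 1 -> `|s| < 2 by move=> H; lra.
have dx0 t (s : R) k : `|t| < r -> `|s| < 2 ->
    is_derive s 1 (fun s => y t s 0 k) (l * y t s 1 k).
  by move=> tr s2; have := is_derive_mx 0 k (dy' t s tr s2); rewrite !mxE.
have dx1 t (s : R) k : `|t| < r -> `|s| < 2 ->
    is_derive s 1 (fun s => y t s 1 k) (l * Q k ((t : R^o), y t s)).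
  by move=> tr s2; have := is_derive_mx 1 k (dy' t s tr s2); rewrite !mxE.
exists y; split=> //.
- move=> t s tr s2; rewrite (le_trans (y_le2 t s tr s2))// ler_wpM2l ?(ltW l_gt0)//.
  have := mulr_gt0 L'0 B0; have := exprn_ge0 2 (ltW L0); rewrite /K; lra.
- move=> t k tr.
  have stab (s : R) : `|s| <= 1 -> `|y 0 s - y t s| <= 2 * (l * L * `|t|).
    apply: (@ode_stability _ _ _ (F 0) (F t)).
    + by move=> a b; exact: Flip.
    + move=> u u1; rewrite -scalerBr normrZ gtr0_norm// -mulrA.
      rewrite ler_wpM2l ?(ltW l_gt0)//.
      rewrite (le_trans (Lip _ _ _ _ r00 (cl_r _) tr (cl_r _)))// subrr normr0.
      by rewrite addr0 sub0r normrN.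
    + by move=> u u1; apply: dy => //; exact: le1lt2.
    + by move=> u u1; apply: dy => //; exact: le1lt2.
    + by rewrite !y0E.
  pose K1 := L' * (`|t| + l * B) + 2 * l * L ^+ 2.
  have K10 : 0 <= K1.
    by rewrite addr_ge0// ?mulr_ge0 ?exprn_ge0 ?addr_ge0 ?mulr_ge0// ltW.
  (* The change of [Q] is split into that of the parameter at a frozen state, by the mean value
     theorem and the Lipschitz bound on [dQ], and that of the state at parameter 0, by [stab]. *)
  have Qt (s : R) : `|s| <= 1 -> `|Q k ((t : R^o), y t s) - Q k ((0 : R^o), y 0 s)
      - t * dx k| <= `|t| * K1.
    move=> s1; have s2 := le1lt2 s s1.
    have yr := y_r t s tr s2; have yr0 := y_r 0 s r00 s2.
    have [|xi xit E] := @between_MVT _ (fun u => Q k ((u : R^o), y t s))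
      (fun u => dQ k ((u : R^o), y t s)) 0 t.
      move=> u; rewrite !subr0 => ut; apply: derive_Q; last by case/rP: yr.
      by have /rP[tr1 _ _] := tr; exact: le_lt_trans tr1.
    rewrite !subr0 in xit E.
    have xir : `|xi| < r by exact: le_lt_trans tr.
    have dQxi : `|dQ k ((xi : R^o), y t s) - dx k| <= L' * (`|t| + l * B).
      have /rP[_ _ xirL] := xir; have /rP[_ _ yrL] := yr.
      have z0L : `|((0 : R^o), y0) - ((0 : R^o), y0)| < rL' by rewrite subrr normr0.
      have := HL' _ _ (pair_dist_lt xirL yrL) z0L => H.
      have := le_trans (norm_mx_ge _ 0 k) H; rewrite !mxE => /le_trans; apply.
      rewrite ler_wpM2l ?(ltW L'0)// (le_trans (pair_dist_le _ _ _ _))// subr0 lerD//.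
      by rewrite (le_trans (y_le t s tr s2))// ler_piMr.
    have Lst : `|Q k ((0 : R^o), y t s) - Q k ((0 : R^o), y 0 s)| <=
        `|t| * (2 * l * L ^+ 2).
      have H := Lip 0 0 (y t s) (y 0 s) r00 yr r00 yr0.
      have := le_trans (norm_mx_ge _ 1 k) H; rewrite !mxE /= => /le_trans; apply.
      rewrite subrr normr0 add0r distrC.
      apply: (@le_trans _ _ (L * (2 * (l * L * `|t|)))).
        by rewrite ler_wpM2l ?(ltW L0)// stab.
      by rewrite (_ : L * _ = `|t| * (2 * l * L ^+ 2)) //; ring.
    have -> : Q k ((t : R^o), y t s) - Q k ((0 : R^o), y 0 s) - t * dx k =
        (Q k ((t : R^o), y t s) - Q k ((0 : R^o), y t s) - t * dx k) +
        (Q k ((0 : R^o), y t s) - Q k ((0 : R^o), y 0 s)) by ring.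
    rewrite E mulrC -mulrBr (le_trans (ler_normD _ _))// /K1 [leRHS]mulrDr lerD//.
    by rewrite normrM ler_wpM2l.
  have w1 (s : R) : `|s| <= 1 ->
      `|y t s 1 k - y 0 s 1 k - l * t * dx k * s| <= l * (`|t| * K1).
    move=> s1; have := @between_MVT_le _
      (fun s => y t s 1 k - y 0 s 1 k - l * t * dx k * s)
      (fun s => l * (Q k ((t : R^o), y t s) - Q k ((0 : R^o), y 0 s) - t * dx k))
      0 s (l * (`|t| * K1)).
    rewrite mulr0 subr0 !y0E// subrr !subr0 => H; apply: le_trans (H _ _) _.
    - move=> u; rewrite subr0 => us; have u2 := le1lt2 _ (le_trans us s1).
      have D := is_deriveB (is_deriveB (dx1 t u k tr u2) (dx1 0 u k r00 u2))
        (is_deriveZ (l * t * dx k) (is_derive_id u 1)).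
      by apply: (is_derive_eq D); rewrite /GRing.scale /=; ring.
    - move=> u; rewrite subr0 => us; rewrite normrM gtr0_norm//.
      by rewrite ler_wpM2l ?(ltW l_gt0)//; apply: Qt; exact: le_trans s1.
    - by rewrite ler_piMr// mulr_ge0 ?(ltW l_gt0)// mulr_ge0.
  (* Second integration: with the quadratic term subtracted, the derivative of the position error is
     [l] times the velocity error bounded in [w1]. *)
  have := @between_MVT_le _
      (fun s => y t s 0 k - y 0 s 0 k - (l ^+ 2 * t / 2 * dx k) * s ^+ 2)
      (fun s => l * (y t s 1 k - y 0 s 1 k - l * t * dx k * s))
      0 1 (l * (l * (`|t| * K1))).
  rewrite expr1n expr0n /= mulr1 mulr0 !y0E// subrr !subr0 normr1 mulr1.
  move=> H; apply: le_trans (H _ _) _.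
  - move=> u; rewrite subr0 => u1; have u2 := le1lt2 _ u1.
    have D := is_deriveB (is_deriveB (dx0 t u k tr u2) (dx0 0 u k r00 u2))
        (is_deriveZ (l ^+ 2 * t / 2 * dx k) (is_deriveX 2 (is_derive_id u 1))).
    apply: (is_derive_eq D).
    by rewrite /GRing.scale /= expr1 /GRing.scale /=; field.
  - move=> u; rewrite subr0 => u1; rewrite normrM gtr0_norm//.
    by rewrite ler_wpM2l ?(ltW l_gt0)// w1.
  - have -> : l * (l * (`|t| * K1)) = l ^+ 2 * `|t| * K1 by ring.
    rewrite -[leRHS]mulrA ler_wpM2l ?mulr_ge0 ?exprn_ge0 ?(ltW l_gt0)//.
    have t0 := normr_ge0 t; have L2 := exprn_ge0 2 (ltW L0).
    have h1 : 0 <= B * `|t| by rewrite !mulr_ge0// ?(ltW L'0) ?(ltW B0) ?(ltW l_gt0).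
    have h2 : 0 <= L' * B * `|t| by rewrite !mulr_ge0// ?(ltW L'0) ?(ltW B0) ?(ltW l_gt0).
    have h3 : 0 <= L ^+ 2 * `|t| by rewrite mulr_ge0// ?(ltW L'0) ?(ltW B0) ?(ltW l_gt0).
    have h4 : 0 <= L' * l by rewrite !mulr_ge0// ?(ltW L'0) ?(ltW B0) ?(ltW l_gt0).
    have h5 : 0 <= B * l by rewrite !mulr_ge0// ?(ltW L'0) ?(ltW B0) ?(ltW l_gt0).
    have h6 : 0 <= L' * B * l by rewrite !mulr_ge0// ?(ltW L'0) ?(ltW B0) ?(ltW l_gt0).
    have h7 : 0 <= L ^+ 2 * l by rewrite mulr_ge0// ?(ltW L'0) ?(ltW B0) ?(ltW l_gt0).
    have -> : K * (`|t| + l) = K1 + (L' * l + 2 * (B * `|t|) + 2 * (B * l) +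
        2 * (L' * B * `|t|) + L' * B * l + 2 * (L ^+ 2 * `|t|) + `|t| + l).
      rewrite /K /K1; ring.
    rewrite lerDl; have := ltW l_gt0; lra.
- move=> s k s2.
  have := @segment_MVT_le _ (fun u => y 0 u 0 k - l * v 0 k * u)
    (fun u => l * (y 0 u 1 k - v 0 k)) s 1 (l * (l * (2 * B))).
  have -> : y 0 1 0 k - l * v 0 k * 1 - (y 0 s 0 k - l * v 0 k * s) =
    y 0 1 0 k - y 0 s 0 k - l * (1 - s) * v 0 k by ring.
  have bet (u : R) : Num.min s 1 <= u <= Num.max s 1 -> `|u| < 2.
    move: s2; rewrite !ltr_norml; case: (leP s 1) => _; lra.
  move=> H; apply: le_trans (H _ _) _.
  - move=> u /bet u2.
    have D := is_deriveB (dx0 0 u k r00 u2)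
        (is_deriveZ (l * v 0 k) (is_derive_id u 1)).
    by apply: (is_derive_eq D); rewrite /GRing.scale /=; ring.
  - move=> u /bet u2; rewrite normrM gtr0_norm// ler_wpM2l ?(ltW l_gt0)//.
    have := le_trans (norm_mx_ge _ 1 k) (y_le2 0 u r00 u2).
    by rewrite /v !mxE.
  - rewrite ler_wpM2r// expr2 -!mulrA !ler_wpM2l ?(ltW l_gt0)//.
    have := mulr_gt0 L'0 B0; have := exprn_ge0 2 (ltW L0); rewrite /K; lra.
Qed.

End perturbed_flow.

(** * Coordinates of a vector bounded by its Riemannian norm *)

Section metric_bound.
Variables (R : realType) (M : smoothManifold R 2) (g : metric M) (i : chart_index M).

Lemma quad2E (G : 'M[R]_2) (v : 'rV[R]_2) : (v *m G *m v^T) 0 0 =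
  G 0 0 * v 0 0 ^+ 2 + (G 0 1 + G 1 0) * (v 0 0 * v 0 1) + G 1 1 * v 0 1 ^+ 2.
Proof. by rewrite !(mxE, sum_ord2); ring. Qed.

Lemma gmx_pos2 x : mimg i x -> let G := gmx g i x in
  [/\ G 0 1 = G 1 0, 0 < G 0 0, 0 < G 1 1 & 0 < \det G].
Proof.
move=> ix G; have G01 : G 0 1 = G 1 0.
  by have := congr1 (fun A : 'M[R]_2 => A 0 1) (gmx_sym g ix); rewrite mxE.
have pos (a b : R) : (a != 0) || (b != 0) ->
    0 < G 0 0 * a ^+ 2 + (G 0 1 + G 1 0) * (a * b) + G 1 1 * b ^+ 2.
  pose v : 'rV[R]_2 := \row_k if k == 0 then a else b.
  have va : v 0 0 = a by rewrite mxE.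
  have vb : v 0 1 = b by rewrite mxE.
  move=> ab; rewrite -va -vb -quad2E; apply: gmx_pos => //.
  apply/eqP => v0; move: ab; rewrite -va -vb v0 !mxE eqxx//.
have E0 : 0 < G 0 0 by have := pos 1 0; rewrite oner_neq0 => /(_ isT); lra.
have H0 : 0 < G 1 1.
  by have := pos 0 1; rewrite oner_neq0 orbT => /(_ isT); lra.
split=> //; have := pos (- G 0 1) (G 0 0); rewrite (gt_eqF E0) orbT => /(_ isT).
rewrite (_ : _ + _ + _ = G 0 0 * \det G); last by rewrite det2 -G01; ring.
by rewrite pmulr_rgt0.
Qed.

(** Completing the square bounds the square of a coordinate by the quadratic form times the other
    diagonal entry over the determinant; this ratio is continuous, hence locally bounded. *)
Lemma metric_bound x0 : mimg i x0 -> exists r C : R, [/\ 0 < r, 0 < C,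
  forall x, `|x - x0| < r -> mimg i x &
  forall x (v : 'rV[R]_2) k, `|x - x0| < r ->
    `|v 0 k| <= C * Num.sqrt ((v *m gmx g i x *m v^T) 0 0)].
Proof.
move=> ix0; have oU := @mimg_open _ _ _ i.
have sG : smooth_on (mimg i) (gmx g i) by exact: gmx_smooth.
have sGab a b := (smooth_on_mxP _ oU).1 sG a b.
have sD := smooth_on_det oU sG.
pose q a x := gmx g i x a a / \det (gmx g i x).
have q_ge0 a x : mimg i x -> 0 <= q a x.
  move=> ix; have [_ E0 H0 D0] := gmx_pos2 ix.
  by rewrite divr_ge0 ?(ltW D0)//; move: a; apply: forall_ord2; exact: ltW.
have q_near a : \forall x \near x0, q a x <= q a x0 + 1.
  have cq : {for x0, continuous (q a)}.
    apply: (smooth_on_continuous (U := mimg i)) ix0.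
    apply: smooth_on_mul => //; apply: smooth_on_inv => // x ix.
    by have [_ _ _ D0] := gmx_pos2 ix; rewrite (gt_eqF D0).
  near=> x; have : `|q a x0 - q a x| <= 1.
    by near: x; have /cvgrPdist_le/(_ _ ltr01) := cq.
  rewrite ler_norml; lra.
(* Besides bounding both ratios, [C] is at least 1, so that [C <= C ^+ 2] under the square root. *)
pose C := 1 + (q 0 x0 + 1) + (q 1 x0 + 1).
have C1 : 1 <= C by have := q_ge0 0 _ ix0; have := q_ge0 1 _ ix0; rewrite /C; lra.
have /nbhs_ballP[r /= r0 rP] : \forall x \near x0,
    mimg i x /\ forall a, q a x <= C.
  near=> x; split; first by near: x; exact: open_nbhs_nbhs.
  apply: forall_ord2.
    apply: (@le_trans _ _ (q 0 x0 + 1)); first by near: x; exact: q_near.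
    by have := q_ge0 1 _ ix0; rewrite /C; lra.
  apply: (@le_trans _ _ (q 1 x0 + 1)); first by near: x; exact: q_near.
  by have := q_ge0 0 _ ix0; rewrite /C; lra.
have inr x : `|x - x0| < r -> ball x0 r x.
  by rewrite -ball_normE /ball_/= distrC.
exists r, C; split=> //; first exact: lt_le_trans C1.
  by move=> x /inr/rP[].
move=> x v k /inr/rP[ix qC]; have [G01 E0 H0 D0] := gmx_pos2 ix.
set Q := (v *m _ *m _) 0 0.
have Q0 : 0 <= Q.
  have [v0|v0] := eqVneq v 0; first by rewrite /Q v0 !mul0mx mxE.
  by rewrite ltW// gmx_pos.
have C0 : 0 <= C := le_trans ler01 C1.
have -> : C * Num.sqrt Q = Num.sqrt (C ^+ 2 * Q).
  by rewrite sqrtrM ?exprn_ge0// sqrtr_sqr ger0_norm.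
rewrite -sqrtr_sqr; apply: ler_wsqrtr.
suff vQ : v 0 k ^+ 2 <= C * Q.
  by rewrite (le_trans vQ)// ler_wpM2r// expr2 ler_peMl.
have Cq (k' : 'I_2) : gmx g i x k' k' * Q <= C * (\det (gmx g i x) * Q).
  rewrite mulrA ler_wpM2r//.
  by have := qC k'; rewrite /q ler_pdivrMr.
rewrite -(ler_pM2l D0) [leRHS]mulrCA.
have QE : Q = gmx g i x 0 0 * v 0 0 ^+ 2 +
   (gmx g i x 0 1 + gmx g i x 0 1) * (v 0 0 * v 0 1) + gmx g i x 1 1 * v 0 1 ^+ 2.
  by rewrite /Q quad2E -G01.
move: k; apply: forall_ord2.
- apply: le_trans (Cq 1).
  have -> : gmx g i x 1 1 * Q = \det (gmx g i x) * v 0 0 ^+ 2 +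
      (gmx g i x 0 1 * v 0 0 + gmx g i x 1 1 * v 0 1) ^+ 2.
    by rewrite QE det2 -G01; ring.
  by rewrite lerDl sqr_ge0.
- apply: le_trans (Cq 0).
  have -> : gmx g i x 0 0 * Q = \det (gmx g i x) * v 0 1 ^+ 2 +
      (gmx g i x 0 0 * v 0 0 + gmx g i x 0 1 * v 0 1) ^+ 2.
    by rewrite QE det2 -G01; ring.
  by rewrite lerDl sqr_ge0.
Unshelve. all: by end_near. Qed.

End metric_bound.

(** * Geodesics as trajectories in phase space *)

Section geodesic_flow.
Variables (R : realType) (M : smoothManifold R 2) (g : R -> metric M).
Variable i : chart_index M.

Definition space_dir (a : 'I_2) : R^o * 'rV[R]_2 := (0, delta_mx 0 a).
Definition time_dir : R^o * 'rV[R]_2 := (1, 0).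
Definition gfam (z : R^o * 'rV[R]_2) : 'M[R]_2 := gmx (g z.1) i z.2.
Definition gam (k a b : 'I_2) : R^o * 'rV[R]_2 -> R := chr space_dir gfam k a b.
Definition dgam (k a b : 'I_2) (z : R^o * 'rV[R]_2) : R := 'D_time_dir (gam k a b) z.

Lemma christoffel_slice t k a b x : christoffel (g t) i k a b x = gam k a b (t, x).
Proof.
apply: (congr1 (fun r => 2^-1 * r)); apply: eq_bigr => l _.
have E1 := slice_derive (fun z => gfam z l b) t x (delta_mx 0 a).
have E2 := slice_derive (fun z => gfam z a l) t x (delta_mx 0 b).
have E3 := slice_derive (fun z => gfam z a b) t x (delta_mx 0 l).
apply: (congr1 (fun r => invmx (gfam (t, x)) k l * r)).
exact: (f_equal2 (fun r r' => r - r') (f_equal2 +%R E1 E2) E3).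
Qed.

Definition phase_proj (z : R^o * 'M[R]_2) : R^o * 'rV[R]_2 := (z.1, row 0 z.2).

Definition accel (k : 'I_2) (z : R^o * 'M[R]_2) : R :=
  - \sum_a \sum_b gam k a b (phase_proj z) * z.2 1 a * z.2 1 b.
Definition daccel (k : 'I_2) (z : R^o * 'M[R]_2) : R :=
  - \sum_a \sum_b dgam k a b (phase_proj z) * z.2 1 a * z.2 1 b.

Lemma loclip_quadratic (f : 'I_2 -> 'I_2 -> R^o * 'rV[R]_2 -> R) z :
  (forall a b, loclip (f a b) (phase_proj z)) ->
  loclip (fun z => - \sum_a \sum_b f a b (phase_proj z) * z.2 1 a * z.2 1 b) z.
Proof.
move=> lf; have lcoord a : loclip (fun z : R^o * 'M[R]_2 => z.2 1 a) z.
  apply: loclip_le => -[t y] [t' y'] /=.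
  rewrite (_ : y 1 a - y' 1 a = (y - y') 1 a); last by rewrite !mxE.
  by rewrite (le_trans (norm_mx_ge _ _ _))// le_max lexx orbT.
have lproj : loclip phase_proj z.
  apply: loclip_le => -[t y] [t' y'] /=.
  rewrite [leLHS]/(Num.max _ _) ge_max !le_max/= lexx /= orbC.
  rewrite (_ : row 0 y - row 0 y' = row 0 (y - y')); last by rewrite linearB.
  rewrite (_ : `|row 0 (y - y')| <= `|y - y'|)//.
  by apply: norm_mx_le => // a b; rewrite mxE norm_mx_ge.
apply: loclip_opp; apply: loclip_sum => a; apply: loclip_sum => b.
apply: loclip_mul; last exact: lcoord.
by apply: loclip_mul; last exact: lcoord; exact: loclip_comp.
Qed.

(** The velocity of the curve is [l] times row 1 of [y], whose derivative is [l] times the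
    acceleration: both terms of the geodesic equation carry [l ^+ 2]. *)
Lemma geodesic_of_flow (t l : R) (y : R -> 'M[R]_2) (p : M) (v : 'rV[R]_2) :
  (forall s : R, `|s| < 2 -> mimg i (row 0 (y s))) ->
  (forall s : R, `|s| < 2 -> is_derive s 1 y (l *: flow_field accel ((t : R^o), y s))) ->
  let c := fun s => cinv (mchart i) (row 0 (y s)) in
  is_geodesic (g t) `](-2 : R), 2[ c /\
  (c 0 = p -> row 1 (y 0) = v -> starts_at c p i (l *: v)).
Proof.
move=> iy dy c; set X := local_curve i c.
have near2 (s : R) : `|s| < 2 -> \forall u \near s, `|u| < 2.
  move=> s2; have s20 : 0 < 2 - `|s| by rewrite subr_gt0.
  near=> u; have : `|u - s| < 2 - `|s| by near: u; exact: (@near_norm_lt R R).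
  by move=> us; have := ler_normD (u - s) s; rewrite subrK; lra.
have XE (s : R) : `|s| < 2 -> X s = row 0 (y s).
  by move=> s2; rewrite /X /local_curve /= cinvK//; exact: iy.
have drow (s : R) : `|s| < 2 -> is_derive s 1 (fun s => row 0 (y s)) (l *: row 1 (y s)).
  move=> s2; apply: mx_is_derive => a k; rewrite !ord1.
  have := is_derive_mx 0 k (dy s s2); rewrite !mxE /=.
  suff -> : (fun u => y u 0 k) = (fun u => (row 0 (y u)) 0 k) by [].
  by apply/funext => u; rewrite mxE.
have dX (s : R) : `|s| < 2 -> is_derive s 1 X (l *: row 1 (y s)).
  move=> s2; apply: near_eq_is_derive (drow s s2).
  by near=> u; rewrite XE//; near: u; exact: near2.
have X'E (s : R) : `|s| < 2 -> derive1 X s = l *: row 1 (y s).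
  by move=> s2; rewrite derive1E; apply: derive_val; exact: dX.
have dX' (s : R) : `|s| < 2 ->
    is_derive s 1 (derive1 X) (l ^+ 2 *: \row_k accel k ((t : R^o), y s)).
  move=> s2.
  have H : is_derive s 1 (fun s => l *: row 1 (y s))
      (l ^+ 2 *: \row_k accel k ((t : R^o), y s)).
    apply: mx_is_derive => a k; rewrite !ord1.
    have := is_deriveZ l (is_derive_mx 1 k (dy s s2)); rewrite !mxE /=.
    rewrite -[_ *: (l * _)]/(l * (l * _)) mulrA -expr2.
    suff -> : (l \*: (fun u => y u 1 k)) = (fun u => (l *: row 1 (y u)) 0 k) by [].
    by apply/funext => u; rewrite !mxE.
  apply: near_eq_is_derive H.
  by near=> u; rewrite X'E//; near: u; exact: near2.
split.
  move=> s; rewrite /= in_itv /= -ltr_norml => s2; split.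
    apply: (@continuous_comp _ _ _ (fun s => row 0 (y s)) (cinv (mchart i))).
      exact: is_derive_continuous (drow s s2).
    by apply: cinv_continuous; exact: iy.
  exists i; split; first by apply: mdom_cinv; exact: iy.
  split.
  - near=> u; have u2 : `|u| < 2 by near: u; exact: near2.
    by have [] := dX u u2.
  - by have [] := dX' s s2.
  - move=> k; rewrite -/X.
    have X2E : derive1 (derive1 X) s = l ^+ 2 *: \row_k accel k ((t : R^o), y s).
      by rewrite derive1E; apply: derive_val; exact: dX'.
    rewrite X2E X'E// XE// !mxE /accel mulrN mulr_sumr.
    apply/eqP; rewrite addrC subr_eq0; apply/eqP; apply: eq_bigr => a _.
    rewrite mulr_sumr; apply: eq_bigr => b _; rewrite christoffel_slice !mxE.
    rewrite /phase_proj /=; ring.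
have z2 : `|0 : R| < 2 by rewrite normr0.
by move=> cp yv; split=> //; [have [] := dX 0 z2|rewrite X'E// yv].
Unshelve. all: by end_near. Qed.

End geodesic_flow.

(** [w] is the displacement of the endpoint due to the perturbation, [b] the chord of the
    unperturbed arc from a nearby point to its endpoint, roughly [h * v]. Taking the cross product
    of [v] with [w + b], which is small, removes the multiple of [v] and leaves the part of [p]
    across [v]. *)
Lemma cross_estimate (R : realType) (v w b p : 'I_2 -> R) (l t h K P e : R)
    (V := `|v 0| + `|v 1|) (m := l ^+ 2 * `|t| * K * (`|t| + l)) :
  0 < l -> 0 < K -> 0 < V -> 4 * (l * K) <= V ->
  (forall k, `|w k - l ^+ 2 * t / 2 * p k| <= m) ->
  (forall k, `|b k - h * v k| <= l * K * `|h|) ->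
  (forall k, `|w k + b k| <= e) -> (forall k, `|p k| <= P) ->
  l ^+ 2 * `|t| / 2 * `|v 0 * p 1 - v 1 * p 0| <=
  V * (e + m) + 4 * (l * K) * (e + l ^+ 2 * `|t| * P + m).
Proof.
move=> l0 K0 V0 lKV Hw Hb Hwb Hp.
have t0 := normr_ge0 t; have h0 := normr_ge0 h.
have l2t : 0 <= l ^+ 2 * `|t| by rewrite mulr_ge0// exprn_ge0// ltW.
have lK0 : 0 < l * K by rewrite mulr_gt0.
have P0 : 0 <= P by rewrite (le_trans _ (Hp 0)).
have l2 : `|l ^+ 2 * t / 2| = l ^+ 2 * `|t| / 2.
  rewrite normrM [`|l ^+ 2 * t|]normrM normfV (ger0_norm (exprn_ge0 2 (ltW l0))).
  by rewrite (ger0_norm (ler0n R 2)).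
pose E := e + l ^+ 2 * `|t| * P + m.
have bE k : `|b k| <= E.
  have -> : b k = (w k + b k) - (w k - l ^+ 2 * t / 2 * p k) -
    l ^+ 2 * t / 2 * p k by ring.
  rewrite (le_trans (ler_normB _ _))// [E](_ : _ = e + m + l ^+ 2 * `|t| * P).
    rewrite lerD//; first by rewrite (le_trans (ler_normB _ _))// lerD.
    rewrite normrM l2.
    have := ler_wpM2l l2t (Hp k); have := mulr_ge0 l2t (normr_ge0 (p k)); lra.
  by rewrite /E; ring.
have hv k : `|h| * `|v k| <= E + l * K * `|h|.
  rewrite -normrM -[h * v k](subrK (b k)) (le_trans (ler_normD _ _))// addrC.
  by rewrite lerD// distrC.
(* [h] is not known in advance. The chord is bounded by [E], and its deviation from [h * v], itself
   proportional to [h], is absorbed thanks to [4 * (l * K) <= V]. *)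
have hV : `|h| * V <= 4 * E.
  have : `|h| * V <= 2 * E + 2 * (l * K * `|h|).
    by rewrite mulrDr; have := hv 0; have := hv 1; lra.
  have : 4 * (l * K) * `|h| <= V * `|h| by rewrite ler_wpM2r.
  rewrite [V * _]mulrC; lra.
have -> : l ^+ 2 * `|t| / 2 * `|v 0 * p 1 - v 1 * p 0| =
    `|l ^+ 2 * t / 2 * (v 0 * p 1 - v 1 * p 0)|.
  by rewrite [RHS]normrM l2.
have -> : l ^+ 2 * t / 2 * (v 0 * p 1 - v 1 * p 0) =
  v 0 * ((w 1 + b 1) - (w 1 - l ^+ 2 * t / 2 * p 1) - (b 1 - h * v 1)) -
  v 1 * ((w 0 + b 0) - (w 0 - l ^+ 2 * t / 2 * p 0) - (b 0 - h * v 0)) by ring.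
have T k : `|(w k + b k) - (w k - l ^+ 2 * t / 2 * p k) - (b k - h * v k)| <=
    e + m + l * K * `|h|.
  rewrite (le_trans (ler_normB _ _))// lerD//.
  by rewrite (le_trans (ler_normB _ _))// lerD.
rewrite (le_trans (ler_normB _ _))// !normrM.
have T0 := ler_wpM2l (normr_ge0 (v 0)) (T 1).
have T1 := ler_wpM2l (normr_ge0 (v 1)) (T 0).
have : V * (l * K * `|h|) <= 4 * (l * K) * E.
  have -> : V * (l * K * `|h|) = l * K * (`|h| * V) by ring.
  have -> : 4 * (l * K) * E = l * K * (4 * E) by ring.
  by rewrite ler_wpM2l// ltW.
rewrite -/E; move: T0 T1; rewrite /V; lra.
Qed.

(** * The variation of the acceleration is parallel to the velocity *)

Section projective.
Variables (R : realType) (M : smoothManifold R 2) (eps : R) (g : R -> metric M).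
Hypotheses (eps_gt0 : 0 < eps) (g_smooth : smooth_family eps g).
Variable i : chart_index M.

Definition spacetime : set (R^o * 'rV[R]_2) :=
  [set z : R^o * 'rV[R]_2 | `|z.1| < eps /\ mimg i z.2].

Lemma spacetime_open : open spacetime.
Proof.
rewrite openE => -[t x] [/= te ix]; rewrite /interior.
have nt : \forall s \near (t : R^o), `|s| < eps.
  have e0 : 0 < eps - `|t| by rewrite subr_gt0.
  near=> s; have : `|s - t| < eps - `|t| by near: s; exact: (@near_norm_lt R R).
  by move=> H; have := ler_normD (s - t) t; rewrite subrK; lra.
have nx : \forall y \near x, mimg i y.
  by apply: open_nbhs_nbhs; split=> //; exact: mimg_open.
by exists ([set s | `|s| < eps], mimg i).
Unshelve. all: by end_near. Qed.

Lemma gfam_smooth : smooth_on spacetime (gfam g i).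
Proof. exact: g_smooth. Qed.

Lemma gfam_sym z : spacetime z -> (gfam g i z)^T = gfam g i z.
Proof. by case=> _; exact: gmx_sym. Qed.

Lemma gfam_unit z : spacetime z -> gfam g i z \in unitmx.
Proof. by case=> _; exact: gmx_unit. Qed.

Lemma gam_smooth k a b : smooth_on spacetime (gam g i k a b).
Proof.
apply: chr_smooth; [exact: spacetime_open|exact: gfam_smooth|exact: gfam_unit].
Qed.

Lemma accel_derive k (t : R) (y : 'M[R]_2) : `|t| < eps -> mimg i (row 0 y) ->
  is_derive t 1 (fun s : R => accel g i k ((s : R^o), y))
    (daccel g i k ((t : R^o), y)).
Proof.
move=> te iy.
have H a b : is_derive t 1
    (fun s : R => gam g i k a b ((s : R^o), row 0 y) * (y 1 a * y 1 b))
    (dgam g i k a b ((t : R^o), row 0 y) * (y 1 a * y 1 b)).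
  have zW : spacetime ((t : R^o), row 0 y) by split.
  have dG : is_derive t 1 (fun s : R => gam g i k a b ((s : R^o), row 0 y))
      (dgam g i k a b ((t : R^o), row 0 y)).
    apply: DeriveDef.
      apply/(slice_derivable1 (gam g i k a b) (t : R^o) (row 0 y) (1 : R^o)).
      exact: smooth_on_derivable (gam_smooth k a b) zW.
    exact: (slice_derive1 (gam g i k a b) (t : R^o) (row 0 y) (1 : R^o)).
  apply: (is_derive_eq (is_deriveM dG (is_derive_cst (y 1 a * y 1 b) t 1))).
  by rewrite scaler0 add0r [LHS]mulrC.
have := is_deriveN (is_derive_sum (fun a => is_derive_sum (fun b => H a b))).
rewrite /accel /daccel /phase_proj /= => D.
have -> : (fun s : R => - \sum_a \sum_b
     gam g i k a b ((s : R^o), row 0 y) * y 1 a * y 1 b) =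
  - \sum_a \sum_b (fun s : R => gam g i k a b ((s : R^o), row 0 y) * (y 1 a * y 1 b)).
  apply/funext => s; rewrite fctE fct_sumE; congr (- _); apply: eq_bigr => a _.
  by rewrite fct_sumE; apply: eq_bigr => b _; rewrite mulrA.
apply: (is_derive_eq D); congr (- _); apply: eq_bigr => a _; apply: eq_bigr => b _.
by rewrite mulrA.
Qed.

Hypothesis g_cogeo : infinitesimally_cogeodesical g.

(** By contradiction. If the cross product has absolute value [D > 0], [cross_estimate] bounds
    [l ^+ 2 * t * D / 2] by two kinds of terms: flow errors, made at most [l ^+ 2 * t * D / 8] by
    the choice of [l], and distance terms of order [t ^+ 2], made equally small by the later choice
    of [t]. *)
Lemma projective_condition (x0 v : 'rV[R]_2)
    (y0 : 'M[R]_2 := \matrix_(a, b) if a == 0 then x0 0 b else v 0 b)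
    (z0 := ((0 : R^o), y0)) : mimg i x0 ->
  v 0 0 * daccel g i 1 z0 = v 0 1 * daccel g i 0 z0.
Proof.
move=> ix0; have row0 : row 0 y0 = x0 by apply/rowP => b; rewrite !mxE.
have row1 : row 1 y0 = v by apply/rowP => b; rewrite !mxE.
have zW : spacetime (phase_proj z0) by split; rewrite /= ?normr0 ?row0.
have [rm [Cm [rm0 Cm0 rm_mimg rm_speed]]] := metric_bound (g 0) ix0.
have [||||K [l0 [r [[K0 l00 r0] flow]]]] :=
    @perturbed_flow R 2 (accel g i) (daccel g i) y0 (Num.min eps rm).
- by rewrite lt_min eps_gt0.
- move=> k; apply: loclip_quadratic => a b.
  exact: C1_loclip_prod spacetime_open (gam_smooth k a b 1) zW.
- move=> k; apply: loclip_quadratic => a b.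
  exact: C1_loclip_prod spacetime_open (smooth_on_derive _ (gam_smooth k a b) 1) zW.
- move=> k t y; rewrite !lt_min => /andP[te _] /andP[_ ym]; apply: accel_derive => //.
  apply: rm_mimg; rewrite -row0 -linearB /=; apply: le_lt_trans ym.
  by apply: norm_mx_le => // a b; rewrite mxE norm_mx_ge.
have [V0|V0] := eqVneq (`|v 0 0| + `|v 0 1|) 0.
  have v00 : v 0 0 = 0 by apply/eqP; rewrite -normr_le0 -V0 lerDl.
  have v01 : v 0 1 = 0 by apply/eqP; rewrite -normr_le0 -V0 lerDr.
  by rewrite v00 v01 !mul0r.
set V := `|v 0 0| + `|v 0 1| in V0.
have V_gt0 : 0 < V by rewrite lt_neqAle eq_sym V0 addr_ge0.
pose p k := daccel g i k z0; rewrite -/(p 1) -/(p 0).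
pose P := `|p 0| + `|p 1|; have P0 : 0 <= P by rewrite addr_ge0.
have pP : forall k, `|p k| <= P.
  by apply: forall_ord2; rewrite /P ?lerDl ?lerDr.
apply/eqP; rewrite -subr_eq0; apply/contraT => D_neq0.
pose D := `|v 0 0 * p 1 - v 0 1 * p 0|; have D0 : 0 < D by rewrite normr_gt0.
(* [A * l] dominates the left side of [H2] when [t <= l <= 1]. *)
pose A := 2 * V * K + 4 * K * (P + 2 * K) + 1.
have A0 : 0 < A.
  by rewrite ltr_wpDl// addr_ge0// !mulr_ge0 ?addr_ge0 ?mulr_ge0// ltW.
(* Beyond [l0] and 1, the bounds keep the trajectories within [rm / 8] of [x0], give the premise of
   [cross_estimate], and yield [H2]. *)
pose l := Num.min (Num.min l0 1) (Num.min (rm / (8 * K)) (Num.min (V / (4 * K)) (D / (8 * A)))).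
have l_gt0 : 0 < l by rewrite !lt_min l00 ltr01 !divr_gt0 ?mulr_gt0.
have : l <= l by [].
rewrite {2}/l !le_min => /andP[/andP[ll0 l1] /and3P[lrm lV lD]].
rewrite ler_pdivlMr ?mulr_gt0// in lrm; rewrite ler_pdivlMr ?mulr_gt0// in lV.
rewrite ler_pdivlMr ?mulr_gt0// in lD; clearbody l.
have [|y [y0E dy yK yest ybase]] := flow l; first by rewrite l_gt0.
have z2 : `|0 : R| < 2 by rewrite normr0.
have one2 : `|1 : R| < 2 by rewrite normr1 ltr1n.
have lK8 : l * K <= rm / 8 by rewrite ler_pdivlMr//; lra.
have x_near (t s : R) : `|t| < r -> `|s| < 2 -> `|row 0 (y t s) - x0| <= rm / 8.
  move=> tr s2; rewrite -row0 -linearB /=; apply: le_trans lK8.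
  apply: le_trans (yK t s tr s2).
  by apply: norm_mx_le => // a b; rewrite mxE norm_mx_ge.
have iy (t s : R) : `|t| < r -> `|s| < 2 -> mimg i (row 0 (y t s)).
  by move=> tr s2; apply: rm_mimg; apply: le_lt_trans (x_near t s tr s2) _; lra.
pose c (t s : R) := cinv (mchart i) (row 0 (y t s)).
pose I := `](-2 : R), 2[%classic.
have c_geod (t : R) : `|t| < r -> is_geodesic (g t) I (c t) /\
    starts_at (c t) (cinv (mchart i) x0) i (l *: v).
  move=> tr; have [cg cs] := geodesic_of_flow (cinv (mchart i) x0) v
    (fun s s2 => iy t s tr s2) (fun s s2 => dy t s tr s2).
  by split=> //; apply: cs; rewrite ?y0E// row0.
have I01 : interval_around_01 I.
  split; first exact: interval_open.
  - exact: interval_is_interval.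
  - by rewrite /I /= in_itv/= -ltr_norml.
  - by rewrite /I /= in_itv/= -ltr_norml.
have r00 : `|0 : R| < r by rewrite normr0.
have [cg0 cs0] := c_geod 0 r00.
have [C HC] := g_cogeo (mdom_cinv ix0) I01 cg0 cs0.
have [dl /= dl0 Hdl] := (nbhs_ballP _ _).1 HC.
(* [C] may be negative or zero; replacing it by [|C| + 1] makes the distance bound strict, and [Cm]
   converts it to coordinates. *)
pose c' := Cm * (`|C| + 1).
have c'0 : 0 < c' by rewrite mulr_gt0// ltr_wpDl.
pose A' := c' * (V + 4 * K) + 1.
have A'0 : 0 < A' by rewrite ltr_wpDl// mulr_ge0 ?ltW// addr_gt0// mulr_gt0.
(* Chosen after [l], on which [C] and [dl] depend; the last two bounds serve [chart_dist_le] and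
   [H1]. *)
pose t := Num.min (Num.min (dl / 2) (r / 2))
  (Num.min l (Num.min (rm / (8 * c')) (l ^+ 2 * D / (8 * A')))).
have t_gt0 : 0 < t by rewrite !lt_min l_gt0 !divr_gt0 ?mulr_gt0 ?exprn_gt0.
have : t <= t by [].
rewrite {2}/t !le_min => /andP[/andP[tdl tr2] /and3P[tl trm tD]].
rewrite ler_pdivlMr ?mulr_gt0// in trm; rewrite ler_pdivlMr ?mulr_gt0// in tD; clearbody t.
have tr : `|t| < r by rewrite gtr0_norm//; lra.
have [cgt cst] := c_geod t tr.
have t_ball : ball (0 : R) dl t.
  by rewrite -ball_normE /ball_/= sub0r normrN gtr0_norm//; lra.
have t_sq : 0 < t ^+ 2 by rewrite exprn_gt0.
have expc : is_exp (g t) (cinv (mchart i) x0) i (l *: v) (c t 1).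
  by exists I, (c t); split.
have : (dist_to_set (g 0%R) (c t 1%R) (c 0%R @` I) <
    ((`|C| + 1) * t ^+ 2)%R%:E)%E.
  have /(_ _ expc) Hd := Hdl _ t_ball.
  apply: le_lt_trans Hd _; rewrite lte_fin ltr_pM2r//.
  by rewrite (le_lt_trans (ler_norm C))// ltrDl.
(* The infimum need not be attained; strictness provides a point of the arc, at an unknown time
   [s]. *)
move=> /ereal_inf_lt[_ [_ [s Is <-] <-] dist_lt].
have s2 : `|s| < 2 by move: Is; rewrite /I /= in_itv/= -ltr_norml.
have e_le : Cm * ((`|C| + 1) * t ^+ 2) <= rm / 8.
  rewrite mulrA -/c' expr2 mulrA ler_pdivlMr//.
  have : c' * t * t * 8 <= c' * t * 1 * 8.
    have t1 : t <= 1 := le_trans tl l1.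
    by rewrite ler_wpM2r// ler_wpM2l// mulr_ge0// ltW.
  lra.
have key : `|row 0 (y 0 s) - row 0 (y t 1)| <= Cm * ((`|C| + 1) * t ^+ 2).
  apply: (chart_dist_le rm0 Cm0 rm_mimg rm_speed _ _ dist_lt).
  - by apply: le_lt_trans (x_near t 1 tr one2) _; lra.
  - by apply: le_lt_trans e_le _; lra.
  - exact: iy.
have Hw k : `|y t 1 0 k - y 0 1 0 k - l ^+ 2 * t / 2 * p k| <=
    l ^+ 2 * `|t| * K * (`|t| + l) by exact: yest.
have Hb k : `|y 0 1 0 k - y 0 s 0 k - l * (1 - s) * v 0 k| <=
    l * K * `|l * (1 - s)|.
  have := ybase s k s2; rewrite row1 => /le_trans; apply.
  rewrite normrM (gtr0_norm l_gt0).
  by rewrite (_ : l ^+ 2 * K * `|1 - s| = l * K * (l * `|1 - s|))//; ring.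
have Hwb k : `|(y t 1 0 k - y 0 1 0 k) + (y 0 1 0 k - y 0 s 0 k)| <= c' * t ^+ 2.
  rewrite subrKA distrC; have := le_trans (norm_mx_ge _ 0 k) key.
  by rewrite !mxE mulrA.
have lKV : 4 * (l * K) <= V by lra.
have := cross_estimate (w := fun k => y t 1 0 k - y 0 1 0 k)
  (b := fun k => y 0 1 0 k - y 0 s 0 k) (v := fun k => v 0 k) l_gt0 K0 V_gt0 lKV
  Hw Hb Hwb pP.
rewrite /= -/V -/D (gtr0_norm t_gt0).
have X0 : 0 < l ^+ 2 * t by rewrite mulr_gt0// exprn_gt0.
have H1 : c' * t ^+ 2 * (V + 4 * (l * K)) <= l ^+ 2 * t * (D / 8).
  have -> : c' * t ^+ 2 * (V + 4 * (l * K)) = t * (t * (c' * (V + 4 * (l * K)))) by ring.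
  have -> : l ^+ 2 * t * (D / 8) = t * (l ^+ 2 * D / 8) by ring.
  rewrite ler_wpM2l ?(ltW t_gt0)// ler_pdivlMr//.
  apply: le_trans tD; rewrite -mulrA ler_wpM2l ?(ltW t_gt0)// mulrC ler_wpM2l//.
  have lK1 : l * K <= K by rewrite ler_piMl// ltW.
  apply: (@le_trans _ _ (c' * (V + 4 * K))); last by rewrite lerDl.
  rewrite ler_wpM2l ?(ltW c'0)//; lra.
have H2 : V * (K * (t + l)) + 4 * (l * K) * (P + K * (t + l)) <= D / 8.
  have VK : 0 <= V * K by rewrite mulr_ge0 ?ltW.
  have KK : 0 <= l * K * K by rewrite !mulr_ge0 ?ltW.
  have a1 : V * K * (t + l) <= V * K * (2 * l) by rewrite ler_wpM2l//; lra.
  have a2 : l * K * K * (t + l) <= l * K * K * 2 by rewrite ler_wpM2l//; lra.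
  rewrite ler_pdivlMr//; move: lD; rewrite /A => lD; lra.
have H3 := ler_wpM2l (ltW X0) H2.
have XD : 0 < l ^+ 2 * t * D by rewrite mulr_gt0.
lra.
Qed.

End projective.

(** * The variation of the curvature *)

Section beltrami_algebra.
Variable R : realType.
Implicit Types G h : 'M[R]_2.

(** The hypothesis is the vanishing of a binary cubic form; four directions of [v] determine its
    four coefficients. *)
Lemma projective_form (S : 'I_2 -> 'I_2 -> 'I_2 -> R) :
  (forall k a b, S k a b = S k b a) ->
  (forall v : 'rV[R]_2, v 0 0 * (- \sum_a \sum_b S 1 a b * v 0 a * v 0 b) =
                        v 0 1 * (- \sum_a \sum_b S 0 a b * v 0 a * v 0 b)) ->
  [/\ S 1 0 0 = 0, S 0 1 1 = 0, S 0 0 0 = 2 * S 1 0 1 & S 1 1 1 = 2 * S 0 0 1].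
Proof.
move=> Ssym H.
have E (x y : R) : x * (S 1 0 0 * x * x + 2 * S 1 0 1 * x * y + S 1 1 1 * y * y) =
    y * (S 0 0 0 * x * x + 2 * S 0 0 1 * x * y + S 0 1 1 * y * y).
  have := H (\row_k if k == 0 then x else y).
  rewrite !sum_ord2 !mxE /= (Ssym 1 1 0) (Ssym 0 1 0); lra.
have := E 1 0; have := E 0 1; have := E 1 1; have := E 1 (-1).
by split; lra.
Qed.

(* The trace of the two sides shows that the derivative [p] of [psi] is
   symmetric; the other entries then determine it. *)
Lemma curvature_variation G h (C0 C1 T0 T1 : 'M[R]_2) (D0T1 D1T0 : 'M[R]_2) (k k' : R)
    (psi : 'I_2 -> R) (p : 'I_2 -> 'I_2 -> R) :
  G 0 1 = G 1 0 -> h 0 1 = h 1 0 -> (forall l, C0 1 l = C1 0 l) ->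
  [/\ T0 0 0 = 2 * psi 0, T0 0 1 = 0, T0 1 0 = psi 1 & T0 1 1 = psi 0] ->
  [/\ T1 0 0 = psi 1, T1 0 1 = psi 0, T1 1 0 = 0 & T1 1 1 = 2 * psi 1] ->
  [/\ D0T1 0 0 = p 0 1, D0T1 0 1 = p 0 0, D0T1 1 0 = 0 & D0T1 1 1 = 2 * p 0 1] ->
  [/\ D1T0 0 0 = 2 * p 1 0, D1T0 0 1 = 0, D1T0 1 0 = p 1 1 & D1T0 1 1 = p 1 0] ->
  D0T1 - D1T0 + (T1 *m C0 + C1 *m T0) - (T0 *m C1 + C0 *m T1) =
    k' *: (G *m rot2 R) + k *: (h *m rot2 R) ->
  forall b, p 0 b = \sum_l C0 b l * psi l - k' * G 0 b - k * h 0 b /\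
            p 1 b = \sum_l C1 b l * psi l - k' * G 1 b - k * h 1 b.
Proof.
move=> G01 h01 Csym [a1 a2 a3 a4] [b1 b2 b3 b4] [c1 c2 c3 c4] [d1 d2 d3 d4] H.
have [r00 r01 r10 r11] := rot2E R.
have ent i j := congr1 (fun A : 'M[R]_2 => A i j) H.
have sc (c : R) (Z : 'M[R]_2) i j : (c *: Z) i j = c * Z i j by rewrite mxE.
have mm (A B : 'M[R]_2) i j : (A *m B) i j = A i 0 * B 0 j + A i 1 * B 1 j.
  by rewrite mxE sum_ord2.
move: (ent 0 0) (ent 0 1) (ent 1 0) (ent 1 1).
rewrite !(add_mxE, opp_mxE, sc, mm) r00 r01 r10 r11 a1 a2 a3 a4 b1 b2 b3 b4.
rewrite c1 c2 c3 c4 d1 d2 d3 d4 G01 h01 (Csym 0) (Csym 1) => e1 e2 e3 e4.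
by apply: forall_ord2; rewrite !sum_ord2 ?G01 ?h01 ?(Csym 0) ?(Csym 1); split; lra.
Qed.

(** The last hypothesis equates the mixed second derivatives of [psi], with [k] treated as a
    constant. The curvature term acting on [psi] cancels the [T] terms in [k * Dh], leaving
    [dk 0 * G 1 b = dk 1 * G 0 b], and [G] is nondegenerate. *)
Lemma curvature_variation_constant G h (C0 C1 T0 T1 : 'M[R]_2) (D0C1 D1C0 : 'M[R]_2) (k k' : R)
    (psi : 'I_2 -> R) (p : 'I_2 -> 'I_2 -> R) (dk : 'I_2 -> R)
    (DG Dh : 'I_2 -> 'M[R]_2) :
  G 0 1 = G 1 0 -> h 0 1 = h 1 0 -> \det G != 0 -> (forall l, C0 1 l = C1 0 l) ->
  [/\ T0 0 0 = 2 * psi 0, T0 0 1 = 0, T0 1 0 = psi 1 & T0 1 1 = psi 0] ->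
  [/\ T1 0 0 = psi 1, T1 0 1 = psi 0, T1 1 0 = 0 & T1 1 1 = 2 * psi 1] ->
  D0C1 - D1C0 + C1 *m C0 - C0 *m C1 = k *: (G *m rot2 R) ->
  DG 0 = C0 *m G + G *m C0^T -> DG 1 = C1 *m G + G *m C1^T ->
  Dh 0 = (T0 *m G + C0 *m h) + (h *m C0^T + G *m T0^T) ->
  Dh 1 = (T1 *m G + C1 *m h) + (h *m C1^T + G *m T1^T) ->
  (forall b, p 0 b = \sum_l C0 b l * psi l - k' * G 0 b - k * h 0 b /\
             p 1 b = \sum_l C1 b l * psi l - k' * G 1 b - k * h 1 b) ->
  (forall b, \sum_l (D0C1 b l * psi l + C1 b l * p 0 l) -
       (dk 0 * G 1 b + k' * DG 0 1 b) - k * Dh 0 1 b =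
     \sum_l (D1C0 b l * psi l + C0 b l * p 1 l) -
       (dk 1 * G 0 b + k' * DG 1 0 b) - k * Dh 1 0 b) ->
  forall a, dk a = 0.
Proof.
move=> G01 h01 dG Csym [a1 a2 a3 a4] [b1 b2 b3 b4] H DG0 DG1 Dh0 Dh1 Hp Hd.
have [r00 r01 r10 r11] := rot2E R.
have sc (c : R) (Z : 'M[R]_2) i j : (c *: Z) i j = c * Z i j by rewrite mxE.
have tr (Z : 'M[R]_2) i j : Z^T i j = Z j i by rewrite mxE.
have mm (A B : 'M[R]_2) i j : (A *m B) i j = A i 0 * B 0 j + A i 1 * B 1 j.
  by rewrite mxE sum_ord2.
have X i j : D0C1 i j = D1C0 i j - (C1 *m C0) i j + (C0 *m C1) i j +
    k * (G *m rot2 R) i j.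
  have := congr1 (fun A : 'M[R]_2 => A i j) H.
  rewrite !(add_mxE, opp_mxE, sc); lra.
have key b : dk 0 * G 1 b = dk 1 * G 0 b.
  have [p00 p10] := Hp 0; have [p01 p11] := Hp 1.
  have := Hd b; rewrite !sum_ord2 p00 p10 p01 p11 DG0 DG1 Dh0 Dh1 !X !sum_ord2.
  rewrite !(add_mxE, sc, mm, tr) r00 r01 r10 r11.
  move: b; apply: forall_ord2;
    rewrite ?a1 ?a2 ?a3 ?a4 ?b1 ?b2 ?b3 ?b4 ?G01 ?h01 ?(Csym 0) ?(Csym 1); lra.
have E a : dk a * \det G = 0.
  have k0 := key 0; have k1 := key 1; move: a; rewrite det2; apply: forall_ord2.
    have -> : dk 0 * (G 0 0 * G 1 1 - G 0 1 * G 1 0) =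
      (dk 0 * G 1 1) * G 0 0 - (dk 0 * G 1 0) * G 0 1 by ring.
    by rewrite k0 k1; ring.
  have -> : dk 1 * (G 0 0 * G 1 1 - G 0 1 * G 1 0) =
    (dk 1 * G 0 0) * G 1 1 - (dk 1 * G 0 1) * G 1 0 by ring.
  by rewrite -k0 -k1; ring.
by move=> a; apply/eqP; have /eqP := E a; rewrite mulf_eq0 (negbTE dG) orbF.
Qed.

End beltrami_algebra.

Section gauss.
Variables (R : realType) (M : smoothManifold R 2).
Local Notation dir a := (delta_mx 0 a : 'rV[R]_2).

(** The scalar factor of [G *m rot2] in [skew_curvature_form]. *)
Definition gaussK (V : normedModType R) (e : 'I_2 -> V) (G : V -> 'M[R]_2) (z : V) : R :=
  (curvmx e G 0 1 z *m G z) 1 0 / \det (G z).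

Lemma riemannE (g : metric M) i l a b c x : mimg i x ->
  riemann g i l a b c x = curvmx (fun a => dir a) (gmx g i) a b x c l.
Proof.
move=> ix; have sC d : smooth_on (mimg i) (connection (fun a => dir a) (gmx g i) d).
  apply: connection_smooth; [exact: mimg_open|exact: gmx_smooth|exact: gmx_unit].
have E d d' : partial d (christoffel g i l d' c) x =
    ('D_(dir d) (connection (fun a => dir a) (gmx g i) d') x) c l.
  rewrite (derive_mxE _ _ _ (sC d') ix).
  suff -> : (fun y => connection (fun a => dir a) (gmx g i) d' y c l) =
    christoffel g i l d' c by [].
  by apply/funext => y; rewrite mxE.
have P d d' : \sum_(m < 2) christoffel g i m d c x * christoffel g i l d' m x =
    (connection (fun a => dir a) (gmx g i) d x *m
     connection (fun a => dir a) (gmx g i) d' x) c l.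
  by rewrite mxE; apply: eq_bigr => m _; rewrite !mxE.
rewrite /riemann /curvmx !E sumrB (P b a) (P a b).
by rewrite !(add_mxE, opp_mxE) addrA.
Qed.

Lemma gauss_curvatureE (g : metric M) i p : mdom i p ->
  gauss_curvature g p = gaussK (fun a => dir a) (gmx g i) (mmap i p).
Proof.
move=> ip; set j := chart_at p; have jp : mdom j p by exact: chart_atP.
have := curvature_invariant g ip jp; rewrite /gaussK => ->.
rewrite /gauss_curvature -/j; congr (_ / _).
rewrite mxE; apply: eq_bigr => l _; rewrite mulrC; congr (_ * _).
by apply: riemannE; exact: mdom_mimg.
Qed.

End gauss.

(** * Connection, metric and curvature varied on spacetime *)

Section variation.
Variables (R : realType) (M : smoothManifold R 2) (eps : R) (g : R -> metric M).
Hypotheses (eps_gt0 : 0 < eps) (g_smooth : smooth_family eps g).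
Hypothesis g_cogeo : infinitesimally_cogeodesical g.
Variable k : R.
Hypothesis g0_constant : forall p : M, gauss_curvature (g 0) p = k.
Variable i : chart_index M.

Let e : 'I_2 -> R^o * 'rV[R]_2 := @space_dir R.
Let td : R^o * 'rV[R]_2 := time_dir R.
Let W := spacetime eps i.
Let G := gfam g i.
Let C a := connection e G a.
Let T a z := 'D_td (C a) z.
Let h z := 'D_td G z.
Let K z := gaussK e G z.
Let kappa z := 'D_td K z.
(** The components that [projective_form] singles out, taken at all times of the family so as to be
    smooth on an open set, although they describe [T] only at time 0. *)
Let psi (l : 'I_2) z : R := if l == 0 then dgam g i 1 0 1 z else dgam g i 0 0 1 z.

Let oW : open W. Proof. exact: spacetime_open. Qed.
Let sG : smooth_on W G. Proof. exact: gfam_smooth. Qed.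
Let symG z : W z -> (G z)^T = G z. Proof. exact: gfam_sym. Qed.
Let unitG z : W z -> G z \in unitmx. Proof. exact: gfam_unit. Qed.
Let sC a : smooth_on W (C a). Proof. exact: connection_smooth. Qed.
Let sT a : smooth_on W (T a). Proof. exact: smooth_on_derive. Qed.
Let sh : smooth_on W h. Proof. exact: smooth_on_derive. Qed.
Let sF : smooth_on W (curvmx e G 0 1). Proof. exact: curvmx_smooth. Qed.

Let sK : smooth_on W K.
Proof.
apply: smooth_on_mul => //.
  by apply: (smooth_on_mxP (fun z => curvmx e G 0 1 z *m G z) oW).1; exact: smooth_on_mulmx.
apply: smooth_on_inv => //; last exact: smooth_on_det.
by move=> z Wz; rewrite -unitfE -unitmxE unitG.
Qed.

Let skappa : smooth_on W kappa. Proof. exact: smooth_on_derive. Qed.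

Let spsi l : smooth_on W (psi l).
Proof.
by move: l; apply: forall_ord2; apply: smooth_on_derive; exact: gam_smooth.
Qed.

Lemma gauss_curvature_slice t p : mdom i p ->
  gauss_curvature (g t) p = K ((t : R^o), mmap i p).
Proof.
move=> ip; rewrite (gauss_curvatureE _ ip) /K /gaussK.
have CE a x : connection (fun a => delta_mx 0 a) (gmx (g t) i) a x = C a ((t : R^o), x).
  apply/matrixP => b l; rewrite [LHS]mxE [RHS]mxE.
  exact: (christoffel_slice g i t l a b x).
have DC a b x : 'D_(delta_mx 0 a) (connection (fun a => delta_mx 0 a) (gmx (g t) i) b) x
    = 'D_(e a) (C b) ((t : R^o), x).
  rewrite -(slice_derive (C b) (t : R^o) x (delta_mx 0 a)).
  suff -> : connection (fun a => delta_mx 0 a) (gmx (g t) i) b =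
    (fun y => C b ((t : R^o), y)) by [].
  by apply/funext => y; exact: CE.
by rewrite {1}/curvmx !DC !CE.
Qed.

Let Wslice x : mimg i x -> W ((0 : R^o), x).
Proof. by move=> ix; split; rewrite //= normr0. Qed.

(** The identities derived from the hypothesis hold at time 0 only; space derivatives stay inside
    that slice, so they may still be differentiated. *)
Let slice_derive_eq (f1 f2 : R^o * 'rV[R]_2 -> R) a x :
  (forall y, mimg i y -> f1 ((0 : R^o), y) = f2 ((0 : R^o), y)) -> mimg i x ->
  'D_(e a) f1 ((0 : R^o), x) = 'D_(e a) f2 ((0 : R^o), x).
Proof.
move=> f12 ix; have E1 := slice_derive f1 (0 : R^o) x (delta_mx 0 a).
have E2 := slice_derive f2 (0 : R^o) x (delta_mx 0 a).
have E3 := derive_open_eq (delta_mx 0 a) (@mimg_open _ _ _ i) ix f12.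
exact: (etrans (esym E1) (etrans E3 E2)).
Qed.

Let K_slice x : mimg i x -> K ((0 : R^o), x) = k.
Proof.
move=> ix; have ip := mdom_cinv ix.
by rewrite -[in LHS](cinvK ix) -gauss_curvature_slice.
Qed.

Let T_entry a b l z : W z -> T a z b l = dgam g i l a b z.
Proof.
move=> Wz; rewrite /T (derive_mxE _ _ _ (sC a) Wz) /dgam.
suff -> : (fun y => C a y b l) = gam g i l a b by [].
by apply/funext => y; rewrite mxE.
Qed.

Let dgam_sym l a b z : W z -> dgam g i l a b z = dgam g i l b a z.
Proof.
move=> Wz; apply: (derive_open_eq _ oW Wz) => y Wy.
have := @connection_sym _ _ _ e W G oW symG a b l y Wy.
by rewrite mxE [RHS]mxE.
Qed.

Let T_form x : mimg i x -> let z := ((0 : R^o), x) in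
  [/\ T 0 z 0 0 = 2 * psi 0 z, T 0 z 0 1 = 0, T 0 z 1 0 = psi 1 z &
      T 0 z 1 1 = psi 0 z] /\
  [/\ T 1 z 0 0 = psi 1 z, T 1 z 0 1 = psi 0 z, T 1 z 1 0 = 0 &
      T 1 z 1 1 = 2 * psi 1 z].
Proof.
move=> ix z; have Wz := Wslice ix.
have [||S1 S2 S3 S4] := @projective_form R (fun l a b => dgam g i l a b z).
- by move=> l a b; exact: dgam_sym.
- move=> v; have := projective_condition eps_gt0 g_smooth g_cogeo v ix.
  rewrite /daccel /phase_proj /=.
  have -> : row 0 (\matrix_(a < 2, b < 2) if a == 0 then x 0 b else v 0 b) = x.
    by apply/rowP => b; rewrite !mxE.
  by rewrite !sum_ord2 !mxE.
split; split.
- exact: (etrans (T_entry 0 0 0 Wz) S3).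
- exact: (etrans (T_entry 0 0 1 Wz) S1).
- exact: (T_entry 0 1 0 Wz).
- exact: (T_entry 0 1 1 Wz).
- exact: (etrans (T_entry 1 0 0 Wz) (dgam_sym 0 1 0 Wz)).
- exact: (etrans (T_entry 1 0 1 Wz) (dgam_sym 1 1 0 Wz)).
- exact: (etrans (T_entry 1 1 0 Wz) S2).
- exact: (etrans (T_entry 1 1 1 Wz) S4).
Qed.

Let h_sym z : W z -> h z 0 1 = h z 1 0.
Proof.
move=> Wz; rewrite /h !(derive_mxE _ _ _ sG Wz).
by apply: (derive_open_eq _ oW Wz) => y Wy; rewrite -[in LHS](symG Wy) mxE.
Qed.

Let derive_G a z : W z -> 'D_(e a) G z = C a z *m G z + G z *m (C a z)^T.
Proof. exact: connection_metric. Qed.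

(** Metric compatibility holds at all times of the family, hence can be differentiated in time. *)
Let derive_h a z : W z -> 'D_(e a) h z =
  (T a z *m G z + C a z *m h z) + (h z *m (C a z)^T + G z *m (T a z)^T).
Proof.
move=> Wz; have DD := derive_commute_mx (e a) td oW sG Wz.
apply: (etrans DD).
apply: (etrans (derive_open_eq td oW Wz (fun y Wy => derive_G a Wy))).
have dC := smooth_is_derive td (sC a) Wz.
have dG := smooth_is_derive td sG Wz.
by have [_] := is_deriveD (is_derive_mulmx dC dG) (is_derive_mulmx dG (is_derive_trmx dC)).
Qed.

Let curvature_form z : W z -> curvmx e G 0 1 z = K z *: (G z *m rot2 R).
Proof.
move=> Wz; apply: skew_curvature_form; [exact: symG|exact: unitG|].
exact: (@curvmx_skew _ _ _ e W G oW sG symG unitG).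
Qed.

(** The time derivative of [curvature_form], with the time and space derivatives of the connection
    exchanged. *)
Let curvature_form_variation z : W z ->
  'D_(e 0) (T 1) z - 'D_(e 1) (T 0) z + (T 1 z *m C 0 z + C 1 z *m T 0 z) -
  (T 0 z *m C 1 z + C 0 z *m T 1 z) =
  kappa z *: (G z *m rot2 R) + K z *: (h z *m rot2 R).
Proof.
move=> Wz.
have dT a b : is_derive z td (fun y => 'D_(e a) (C b) y) ('D_(e a) (T b) z).
  apply: (is_derive_eq (smooth_is_derive td (smooth_on_derive (e a) (sC b)) Wz)).
  exact (derive_commute_mx td (e a) oW (sC b) Wz).
have dC a : is_derive z td (C a) (T a z) by exact: smooth_is_derive (sC a) Wz.
have L := is_deriveB (is_deriveD (is_deriveB (dT 0 1) (dT 1 0))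
  (is_derive_mulmx (dC 1) (dC 0))) (is_derive_mulmx (dC 0) (dC 1)).
have dG := smooth_is_derive td sG Wz; have dK := smooth_is_derive td sK Wz.
have Rr := is_derive_scale_mx dK (is_derive_mulmx dG (is_derive_cst (rot2 R) z td)).
have [_ EL] := L; have [_ ER] := Rr.
rewrite mulmx0 addr0 in ER.
exact: (etrans (esym EL) (etrans (derive_open_eq td oW Wz curvature_form) ER)).
Qed.

Let psi_d a b z := 'D_(e a) (psi b) z.

Let derive_T x : mimg i x -> let z := ((0 : R^o), x) in
  [/\ ('D_(e 0) (T 1) z) 0 0 = psi_d 0 1 z, ('D_(e 0) (T 1) z) 0 1 = psi_d 0 0 z,
      ('D_(e 0) (T 1) z) 1 0 = 0 & ('D_(e 0) (T 1) z) 1 1 = 2 * psi_d 0 1 z] /\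
  [/\ ('D_(e 1) (T 0) z) 0 0 = 2 * psi_d 1 0 z, ('D_(e 1) (T 0) z) 0 1 = 0,
      ('D_(e 1) (T 0) z) 1 0 = psi_d 1 1 z & ('D_(e 1) (T 0) z) 1 1 = psi_d 1 0 z].
Proof.
move=> ix z; have Wz := Wslice ix.
have ent a b l m : ('D_(e a) (T b) z) l m = 'D_(e a) (fun y => T b y l m) z.
  exact: derive_mxE (sT b) Wz.
have D2 a l : 'D_(e a) (fun y => 2 * psi l y) z = 2 * psi_d a l z.
  have [_] := is_deriveZ 2 (smooth_is_derive (e a) (spsi l) Wz).
  by [].
have D0 a : 'D_(e a) (fun=> 0 : R) z = 0 by exact: derive_cst.
have T0E y (iy : mimg i y) := (T_form iy).1.
have T1E y (iy : mimg i y) := (T_form iy).2.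
split; split.
- apply: (etrans (ent 0 1 0 0)); apply: slice_derive_eq => // y iy.
  by case: (T1E y iy).
- apply: (etrans (ent 0 1 0 1)); apply: slice_derive_eq => // y iy.
  by case: (T1E y iy).
- apply: (etrans (ent 0 1 1 0)); apply: etrans (D0 0).
  by apply: slice_derive_eq => // y iy; case: (T1E y iy).
- apply: (etrans (ent 0 1 1 1)); apply: etrans (D2 0 1).
  by apply: slice_derive_eq => // y iy; case: (T1E y iy).
- apply: (etrans (ent 1 0 0 0)); apply: etrans (D2 1 0).
  by apply: slice_derive_eq => // y iy; case: (T0E y iy).
- apply: (etrans (ent 1 0 0 1)); apply: etrans (D0 1).
  by apply: slice_derive_eq => // y iy; case: (T0E y iy).
- apply: (etrans (ent 1 0 1 0)); apply: slice_derive_eq => // y iy.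
  by case: (T0E y iy).
- apply: (etrans (ent 1 0 1 1)); apply: slice_derive_eq => // y iy.
  by case: (T0E y iy).
Qed.

Let derive_psi x : mimg i x -> let z := ((0 : R^o), x) in
  forall b, psi_d 0 b z = \sum_l C 0 z b l * psi l z - kappa z * G z 0 b - k * h z 0 b /\
            psi_d 1 b z = \sum_l C 1 z b l * psi l z - kappa z * G z 1 b - k * h z 1 b.
Proof.
move=> ix z; have Wz := Wslice ix.
have [T0 T1] := T_form ix; have [DT1 DT0] := derive_T ix.
apply: (curvature_variation (C0 := C 0 z) (C1 := C 1 z) (psi := fun l => psi l z)
   (p := fun a b => psi_d a b z) _ (h_sym Wz) _ T0 T1 DT1 DT0).
- by rewrite -[in LHS](symG Wz) mxE.
- by move=> l; exact: (@connection_sym _ _ _ e W G oW symG).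
- by rewrite -(K_slice ix); exact: curvature_form_variation.
Qed.

(** Differentiating [derive_psi] once more along the slice uses that [k] is the same number at every
    point; the mixed derivatives of [psi] then feed [curvature_variation_constant]. *)
Lemma kappa_derive_eq0 x a : mimg i x -> 'D_(e a) kappa ((0 : R^o), x) = 0.
Proof.
move=> ix; set z := ((0 : R^o), x); have Wz := Wslice ix.
have [T0 T1] := T_form ix.
have Dp c d b : (forall y, mimg i y -> psi_d d b ((0 : R^o), y) =
      \sum_l C d ((0 : R^o), y) b l * psi l ((0 : R^o), y) -
      kappa ((0 : R^o), y) * G ((0 : R^o), y) d b - k * h ((0 : R^o), y) d b) ->
    'D_(e c) (psi_d d b) z = \sum_l (('D_(e c) (C d) z) b l * psi l z + C d z b l * psi_d c l z) -
      ('D_(e c) kappa z * G z d b + kappa z * ('D_(e c) G z) d b) -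
      k * ('D_(e c) h z) d b.
  move=> H; pose f2 y := \sum_l C d y b l * psi l y - kappa y * G y d b - k * h y d b.
  apply: (etrans (@slice_derive_eq (psi_d d b) f2 c x H ix)).
  have dC l := is_derive_mx b l (smooth_is_derive (e c) (sC d) Wz).
  have dpsi l := smooth_is_derive (e c) (spsi l) Wz.
  have dG := is_derive_mx d b (smooth_is_derive (e c) sG Wz).
  have dh := is_derive_mx d b (smooth_is_derive (e c) sh Wz).
  have dkap := smooth_is_derive (e c) skappa Wz.
  have := is_deriveB (is_deriveB (is_derive_sum (fun l => is_deriveM (dC l) (dpsi l)))
    (is_deriveM dkap dG)) (is_deriveZ k dh).
  move=> [_ D]; apply: etrans (etrans D _).
    have FE : f2 = \sum_l ((fun y => C d y b l) * psi l) -
        kappa * (fun y => G y d b) - k \*: (fun y => h y d b).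
      by apply/funext => y; rewrite /f2 !fctE fct_sumE.
    exact: (congr1 (fun f => 'D_(e c) f z) FE).
  congr (_ - _ - _); last by rewrite addrC [X in X + _]mulrC.
  by apply: eq_bigr => l _; rewrite addrC [X in X + _]mulrC.
have DD b := derive_commute (e 0) (e 1) oW (spsi b) Wz.
have P1 b := Dp 0 1 b (fun y iy => (derive_psi iy b).2).
have P0 b := Dp 1 0 b (fun y iy => (derive_psi iy b).1).
apply: (curvature_variation_constant (G := G z) (h := h z) (C0 := C 0 z) (C1 := C 1 z)
  (psi := fun l => psi l z) (p := fun a b => psi_d a b z)
  (dk := fun a => 'D_(e a) kappa z) (DG := fun a => 'D_(e a) G z)
  (Dh := fun a => 'D_(e a) h z) _ (h_sym Wz) _ _ T0 T1 _ (derive_G 0 Wz)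
  (derive_G 1 Wz) (derive_h 0 Wz) (derive_h 1 Wz) (derive_psi ix)
  (fun b => etrans (esym (P1 b)) (etrans (DD b) (P0 b)))).
- by rewrite -[in LHS](symG Wz) mxE.
- by rewrite -unitfE -unitmxE unitG.
- by move=> l; exact: (@connection_sym _ _ _ e W G oW symG).
- by rewrite -(K_slice ix) -curvature_form.
Qed.

Lemma gauss_curvature_variation p : mdom i p ->
  is_derive (0 : R) (1 : R) (fun t : R => gauss_curvature (g t) p)
    (kappa ((0 : R^o), mmap i p)).
Proof.
move=> ip; have Wz := Wslice (mdom_mimg ip).
have -> : (fun t : R => gauss_curvature (g t) p) =
    (fun t : R => K ((t : R^o), mmap i p)).
  by apply/funext => t; exact: gauss_curvature_slice.
apply: DeriveDef.
  apply/(slice_derivable1 K (0 : R^o) (mmap i p) (1 : R^o)).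
  exact: smooth_on_derivable sK Wz.
exact: (slice_derive1 K (0 : R^o) (mmap i p) (1 : R^o)).
Qed.

Lemma kappa_locally_constant p : mdom i p -> \forall q \near p,
  mdom i q /\ kappa ((0 : R^o), mmap i q) = kappa ((0 : R^o), mmap i p).
Proof.
move=> ip; set x := mmap i p; have ix : mimg i x by exact: mdom_mimg.
have /nbhs_ballP[r /= r0 rP] : \forall y \near x, mimg i y.
  by apply: open_nbhs_nbhs; split=> //; exact: mimg_open.
pose f y := kappa ((0 : R^o), y).
(* In dimension two the path of [MVT_frame] strays by at most twice [|y - x|], so [r / 3] keeps it
   in the chart. *)
have f_const y : `|y - x| < r / 3 -> f y = f x.
  move=> yr; pose d := y - x.
  have bound : \sum_(a < 2) `|d 0 a| * `|delta_mx 0 a : 'rV[R]_2| < r.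
    apply: (@le_lt_trans _ _ (`|d| + `|d|)); last by rewrite /d; lra.
    rewrite sum_ord2 lerD// -[leRHS]mulr1 ler_pM// ?norm_delta_mx_le//;
      exact: norm_mx_ge.
  have inr w : `|w - x| <= \sum_(a < 2) `|d 0 a| * `|delta_mx 0 a : 'rV[R]_2| ->
      mimg i w.
    by move=> wx; apply: rP; rewrite -ball_normE /ball_/= distrC (le_lt_trans wx).
  have df w a : mimg i w -> derivable f w (delta_mx 0 a).
    move=> iw; apply/(slice_derivable kappa (0 : R^o) w (delta_mx 0 a)).
    exact: smooth_on_derivable skappa (Wslice iw).
  have [|xi xix] := @MVT_frame _ _ 2 (fun a => delta_mx 0 a) (fun a => d 0 a) f x.
    by move=> w a /inr; exact: df.
  rewrite -(row_sum_delta d) [x + d]addrC [d + x]subrK => E.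
  apply/eqP; rewrite -subr_eq0 E; apply/eqP; apply: big1 => a _.
  have -> : 'D_(delta_mx 0 a) f (xi a) = 0; last by rewrite mulr0.
  apply: (etrans (slice_derive kappa (0 : R^o) (xi a) (delta_mx 0 a))).
  by apply: kappa_derive_eq0; apply: inr.
have r30 : 0 < r / 3 by rewrite divr_gt0.
near=> q; split; first by near: q; exact: near_mdom.
apply: f_const; rewrite distrC.
by near: q; have /cvgrPdist_lt/(_ _ r30) := mmap_continuous ip.
Unshelve. all: by end_near. Qed.

End variation.

Theorem theorem11 (R : realType) (M : smoothManifold R 2) (eps : R)
  (g : R -> metric M)
  (eps_gt0 : 0 < eps)
  (g_smooth : smooth_family eps g)
  (g0_constant : exists k : R, forall p : M, gauss_curvature (g 0) p = k)
  (g_cogeodesical : infinitesimally_cogeodesical g) :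
  exists kappa : R, forall p : M,
    is_derive (0 : R) (1 : R) (fun t : R => gauss_curvature (g t) p) kappa.
Proof.
have [k g0k] := g0_constant.
(* Defined without a chart: it glues the functions [kappa] of all charts. *)
pose dK p := 'D_1 (fun t : R => gauss_curvature (g t) p) 0.
have dKE i p : mdom i p ->
    dK p = 'D_(time_dir R) (gaussK (@space_dir R) (gfam g i)) ((0 : R^o), mmap i p).
  by move=> ip; case: (gauss_curvature_variation eps_gt0 g_smooth ip).
have dK_der p : is_derive (0 : R) (1 : R) (fun t : R => gauss_curvature (g t) p) (dK p).
  have ip : mdom (chart_at p) p by exact: chart_atP.
  by have [D _] := gauss_curvature_variation eps_gt0 g_smooth ip; exact: DeriveDef.
have dK_loc p : \forall q \near p, dK q = dK p.
  have ip : mdom (chart_at p) p by exact: chart_atP.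
  have := kappa_locally_constant eps_gt0 g_smooth g_cogeodesical g0k ip.
  by apply: filterS => q [iq E]; rewrite (dKE _ _ ip) (dKE _ _ iq).
(* Connectedness does not exclude the empty manifold. *)
have [[p0]|noM] := pselect (inhabited M); last first.
  by exists 0 => p; case: noM; exists.
exists (dK p0) => p.
suff -> : dK p0 = dK p by exact: dK_der.
pose B := [set q : M | dK q = dK p0].
have Bopen : open B.
  rewrite openE => q Bq; have := dK_loc q; apply: filterS => q' dKq'.
  exact: etrans dKq' Bq.
have BCopen : open (~` B).
  rewrite openE => q Bq; have := dK_loc q; apply: filterS => q' dKq' Bq'.
  by apply: Bq; exact: etrans (esym dKq') Bq'.
have BT : B = [set: M].
  apply: (@carrier_connected _ _ M).
  - by exists p0.
  - by exists B => //; rewrite setTI.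
  - by exists B; [rewrite -[B]setCK; exact: open_closedC|rewrite setTI].
by have : B p by rewrite BT.
Qed.
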